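(* Let $n\ge 3$ and let $F=u\,\phi(x^0,r,s,z)$ be a cylindrically symmetric Finsler metric on $I\times\mathbb{B}^n(\rho)$ as in the context. Then $F$ has vanishing Douglas curvature if and only if $\phi$ satisfies $$z\Psi\Big(\frac{U_s}{z}\Big)=0,\quad z\Psi\Big(\frac{U_z}{z}\Big)=0,\quad U_{zzz}=0,$$ $$z\Psi\Big(\frac{R_s}{z}\Big)=0,\quad z\Psi\Big(\frac{R_z}{z}\Big)=0,\quad R_{zzz}=0,$$ $$z\Psi\Big(\frac{T}{z}\Big)=0,\quad T_{zz}=0.$$
   Context: $\rho>0$, $I\subset\mathbb{R}$ an open interval, $\mathbb{B}^n(\rho)$ the open Euclidean ball of radius $\rho$ at $0$ in $\mathbb{R}^n$. Points $x=(x^0,\overline{x})$, tangent vectors $y=(y^0,\overline{y})$; $u=|\overline{y}|$, $r=|\overline{x}|$, $s=\langle\overline{x},\overline{y}\rangle/u$, $z=y^0/u$. $F=u\,\phi(x^0,r,s,z)$ with $\phi>0$ smooth and $F$ a Finsler metric. Subscripts denote partial derivatives. $\Omega=\phi-s\phi_s-z\phi_z$, $\Lambda=\Omega\phi_{zz}+(r^2-s^2)(\phi_{ss}\phi_{zz}-\phi_{sz}^2)$, $\varphi=z\phi_{x^0}+\frac sr\phi_r+\phi_s$, $U=\frac{1}{2\Lambda}\{(\varphi_s-\frac2r\phi_r)\phi_{zz}-(\varphi_z-2\phi_{x^0})\phi_{sz}\}$, $V=\frac{1}{2\Lambda}\{(\varphi_s-\frac2r\phi_r)\phi_{sz}-(\varphi_z-2\phi_{x^0})\phi_{ss}\}$,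 $L=\frac{\Omega}{2\Lambda}(\varphi_z-2\phi_{x^0})-(r^2-s^2)V$, $R=L-\frac{z}{n+2}[L_z-(n-1)sU+(r^2-s^2)U_s]$, $T=\frac1{n+2}\{3sU+L_z+(r^2-s^2)U_s\}$. For a function $\Theta(x^0,r,s,z)$, $\Psi(\Theta)=-s\Theta_s-z\Theta_z$. The Douglas curvature of $F$ is $D^A_{BCD}=\frac{\partial^3}{\partial y^B\partial y^C\partial y^D}\big(G^A-\frac{1}{n+2}\sum_{E=0}^n\frac{\partial G^E}{\partial y^E}y^A\big)$, $A,B,C,D\in\{0,\dots,n\}$, where $G^A=\frac14g^{AB}\{[F^2]_{x^Cy^B}y^C-[F^2]_{x^B}\}$ are the geodesic coefficients ($g_{AB}=\frac12[F^2]_{y^Ay^B}$, summation convention); ''vanishing Douglas curvature'' means all $D^A_{BCD}=0$. *)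

(* Defs.v *)
From HB Require Import structures.
From mathcomp Require Import all_boot all_order all_algebra.
From mathcomp Require Import all_classical all_reals.
From mathcomp Require Import topology normedtype derive.
Set Implicit Arguments. Unset Strict Implicit. Unset Printing Implicit Defensive.
Import Order.TTheory GRing.Theory Num.Theory.
Import numFieldNormedType.Exports.
Local Open Scope classical_set_scope.
Local Open Scope ring_scope.

Section Defs.
Variable R : realType.

Fixpoint Ck (V : normedModType R) (k : nat) (U : set V) (f : V -> R) : Prop :=
  match k with
  | 0%N => {within U, continuous f}
  | k'.+1 => (forall a, U a -> differentiable f a) /\
             (forall v : V, Ck k' U (fun a => derive f a v))
  end.

Definition smooth_on (V : normedModType R) (U : set V) (f : V -> R) :=
  forall k, Ck k U f.

Variable n : nat.
Notation vec := 'rV[R]_(n.+1).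

Definition ebasis (A : 'I_n.+1) : vec := delta_mx 0 A.

Definition bar_dot (x y : vec) : R :=
  \sum_(i < n) x 0 (lift ord0 i) * y 0 (lift ord0 i).
Definition bar_norm (x : vec) : R := Num.sqrt (bar_dot x x).

Definition cyl_domain (I : set R) (rho : R) : set vec :=
  [set x : vec | I (x 0 ord0) /\ bar_norm x < rho].

Definition dx (A : 'I_n.+1) (G : vec -> vec -> R) : vec -> vec -> R :=
  fun x y => derive (fun x' => G x' y) x (ebasis A).
Definition dy (A : 'I_n.+1) (G : vec -> vec -> R) : vec -> vec -> R :=
  fun x y => derive (fun y' => G x y') y (ebasis A).

Definition Fsq (F : vec -> vec -> R) : vec -> vec -> R := fun x y => F x y ^+ 2.

Definition gten (F : vec -> vec -> R) (x y : vec) : 'M[R]_(n.+1) :=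
  \matrix_(A, B) (2^-1 * dy A (dy B (Fsq F)) x y).

Definition is_Finsler (M : set vec) (F : vec -> vec -> R) : Prop :=
  [/\ smooth_on [set p : vec * vec | M p.1 /\ p.2 != 0] (fun p => F p.1 p.2),
      (forall x y, M x -> y != 0 -> 0 < F x y),
      (forall x y (l : R), M x -> 0 < l -> F x (l *: y) = l * F x y) &
      (forall x y, M x -> y != 0 -> forall v : vec, v != 0 ->
         0 < \sum_(A < n.+1) \sum_(B < n.+1) gten F x y A B * v 0 A * v 0 B)].

Definition geod (F : vec -> vec -> R) (A : 'I_n.+1) : vec -> vec -> R :=
  fun x y => 4^-1 * \sum_(B < n.+1) invmx (gten F x y) A B *
     (\sum_(C < n.+1) dx C (dy B (Fsq F)) x y * y 0 C - dx B (Fsq F) x y).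

Definition douglas (F : vec -> vec -> R) (A B C D : 'I_n.+1) : vec -> vec -> R :=
  dy B (dy C (dy D (fun x y =>
     geod F A x y - (n.+2%:R)^-1 *
        (\sum_(E < n.+1) dy E (geod F E) x y) * y 0 A))).

Definition vanishing_Douglas (M : set vec) (F : vec -> vec -> R) : Prop :=
  forall x y, M x -> y != 0 -> forall A B C D, douglas F A B C D x y = 0.

End Defs.

Section Phi.
Variable R : realType.
Definition fun4 := R -> R -> R -> R -> R.

Definition d0 (f : fun4) : fun4 := fun a r s z => derive1 (fun t => f t r s z) a.
Definition dr (f : fun4) : fun4 := fun a r s z => derive1 (fun t => f a t s z) r.
Definition ds (f : fun4) : fun4 := fun a r s z => derive1 (fun t => f a r t z) s.
Definition dz (f : fun4) : fun4 := fun a r s z => derive1 (fun t => f a r s t) z.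

Variable phi : fun4.
Variable n : nat.

Definition Omega : fun4 := fun a r s z =>
  phi a r s z - s * ds phi a r s z - z * dz phi a r s z.
Definition Lambda : fun4 := fun a r s z =>
  Omega a r s z * dz (dz phi) a r s z + (r ^+ 2 - s ^+ 2) *
  (ds (ds phi) a r s z * dz (dz phi) a r s z - ds (dz phi) a r s z ^+ 2).
Definition vphi : fun4 := fun a r s z =>
  z * d0 phi a r s z + s / r * dr phi a r s z + ds phi a r s z.
Definition Uf : fun4 := fun a r s z =>
  (2 * Lambda a r s z)^-1 *
  ((ds vphi a r s z - 2 / r * dr phi a r s z) * dz (dz phi) a r s z
   - (dz vphi a r s z - 2 * d0 phi a r s z) * ds (dz phi) a r s z).
Definition Vf : fun4 := fun a r s z =>
  (2 * Lambda a r s z)^-1 *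
  ((ds vphi a r s z - 2 / r * dr phi a r s z) * ds (dz phi) a r s z
   - (dz vphi a r s z - 2 * d0 phi a r s z) * ds (ds phi) a r s z).
Definition Lf : fun4 := fun a r s z =>
  Omega a r s z / (2 * Lambda a r s z) * (dz vphi a r s z - 2 * d0 phi a r s z)
  - (r ^+ 2 - s ^+ 2) * Vf a r s z.
Definition Rf : fun4 := fun a r s z =>
  Lf a r s z - z / (n.+2%:R) *
  (dz Lf a r s z - (n.-1)%:R * s * Uf a r s z + (r ^+ 2 - s ^+ 2) * ds Uf a r s z).
Definition Tf : fun4 := fun a r s z =>
  (n.+2%:R)^-1 *
  (3 * s * Uf a r s z + dz Lf a r s z + (r ^+ 2 - s ^+ 2) * ds Uf a r s z).

End Phi.

Definition Psi (R : realType) (Th : fun4 R) : fun4 R := fun a r s z =>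
  - s * ds Th a r s z - z * dz Th a r s z.

Definition over_z (R : realType) (Th : fun4 R) : fun4 R := fun a r s z => Th a r s z / z.

Definition uncurry4 (R : realType) (f : fun4 R) : 'rV[R]_4 -> R :=
  fun p => f (p 0 0) (p 0 1) (p 0 2%:R) (p 0 3%:R).

(* Main.v *)
Require Import Defs.
From HB Require Import structures.
From mathcomp Require Import all_boot all_order all_algebra.
From mathcomp Require Import all_classical all_reals.
From mathcomp Require Import topology normedtype derive.
From mathcomp Require Import landau realfun.
From mathcomp Require Import ring.
Set Implicit Arguments. Unset Strict Implicit. Unset Printing Implicit Defensive.
Import Order.TTheory GRing.Theory Num.Theory.
Import numFieldNormedType.Exports.
Local Open Scope classical_set_scope.
Local Open Scope ring_scope.

(** Modulo the direction y, the spray of F is Q = u^2 (L + z s U) e_0 + u^2 U x (x standing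
    for its bar part).  It is the solution of
    F_{x^C y^B} y^C - F_{x^B} = 2 F_{y^B y^C} Q^C, which for such Q is a 2x2 linear system
    for (L, U) with determinant Lambda, nonzero by strong convexity; P y with P = u Pf
    completes Q to the geodesic coefficients.  Since P y drops out of the projective
    spray, the latter has components u^2 R (index 0) and u^2 U x^i - u T y^i.  The Douglas
    curvature vanishes iff these are quadratic in y on every fibre, i.e. iff U and R are of
    the form a + b s^2 + c s z + d z^2 and T is of the form b s + c z, with coefficients
    depending on (x^0, r); that is what the eight equations say, as
    z Psi(f / z) = f - s f_s - z f_z.  Points with x = 0, y = 0 (bar parts) or with bar
    parts parallel are reached by continuity of the Douglas curvature. *)

(** The coefficients a, b, c, d are never constructed: being quadratic is expressed throughout by
    derivatives, in y on the fibres and in (s, z) for the profiles. Necessity rests on n >= 3: the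
    bar parts of x and y span only a plane, so there are points where some coordinate bar direction
    e is orthogonal to both. At such a point r, s, z and u are stationary when y moves along e, and
    differentiating along e singles out one coefficient at a time. Each bar component of the
    projective spray mixes U and T, so the order matters. In the component along e, U is multiplied
    by <x, e>, which is constant in y and vanishes at the point; this gives T alone. With T known to
    be linear, the component along x gives U. The constant n + 2 is the n + 1 of the divergence of y
    plus 1 from Euler's identity for the factor P of degree one. *)

(** * Functions of class C^k on open subsets of a normed space *)

(** The difference [g - f] is zero near [a], hence has differential 0 there; adding it to [f]
    transfers differentiability. *)
Lemma near_eq_differentiable (R : realType) (V W : normedModType R)
    (f g : V -> W) (a : V) :
  (\near a, f a = g a) -> differentiable f a -> differentiable g a.
Proof.
move=> fg df.
have h0 : (\near a, (g - f) a = 0).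
  by near do (rewrite -[LHS]/(g _ - f _); apply/eqP; rewrite subr_eq0; apply/eqP/esym).
have hh : (g - f) \o shift a = cst ((g - f) a) + 0 +o_ 0 id.
  rewrite (nbhs_singleton h0).
  apply/eqaddoE/eqaddoP => e e0.
  move: h0; rewrite (near_shift 0 a) => h0.
  near=> y.
  have -> : ((g - f) \o shift a - (cst 0 + (0 : V -> W))) y = 0.
    rewrite -[LHS]/((g - f) (y + a) - (0 + 0)) addr0 subr0.
    have : (g - f) (y + (a - 0)) = 0 by near: y; apply: h0.
    by rewrite subr0.
  by rewrite normr0 mulr_ge0// ltW.
have dh : 'd (g - f) a = 0 :> (V -> W).
  pose z : {linear V -> W} := \0.
  have -> : (0 : V -> W) = z by [].
  by apply: diff_unique => //; exact: cst_continuous.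
have -> : g = (g - f) + f by apply/funext => x; rewrite -[RHS]/(g x - f x + f x) subrK.
apply: differentiableD => //.
by apply/diff_locallyP; rewrite dh; split => //; exact: cst_continuous.
Unshelve. all: by end_near. Qed.

Section Smooth.
Context {R : realType} {V : normedModType R}.
Implicit Types (O : set V) (f g : V -> R).

Lemma Ck0P O f : open O ->
  Ck 0 O f <-> (forall a, O a -> {for a, continuous f}).
Proof.
move=> oO; rewrite /= continuous_open_subspace//; split=> h a.
  by move=> Oa; apply: h; rewrite inE.
by rewrite inE; exact: h.
Qed.

Lemma open_near_eq O f g a : open O -> (forall b, O b -> f b = g b) -> O a ->
  \forall b \near a, f b = g b.
Proof. by move=> oO fg Oa; apply: filterS (open_nbhs_nbhs (conj oO Oa)). Qed.

Lemma derive_open_eq O f g a v : open O -> (forall b, O b -> f b = g b) ->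
  O a -> 'D_v f a = 'D_v g a.
Proof. by move=> oO fg Oa; apply: near_eq_derive; exact: open_near_eq fg Oa. Qed.

(** [derive] is total while differentiation formulas hold only on [O]; this lets the actual
    derivative be replaced by its formula at every order of regularity. *)
Lemma Ck_ext k O f g : open O -> (forall a, O a -> f a = g a) ->
  Ck k O f -> Ck k O g.
Proof.
move=> oO; elim: k f g => [|k IH] f g fg.
  move=> /(Ck0P f oO) fc; apply/(Ck0P g oO) => a Oa.
  have fga := open_near_eq oO fg Oa.
  have : g @ a --> g a; last by [].
  rewrite -(fg a Oa); apply: cvg_trans (fc a Oa).
  exact: near_eq_cvg fga.
move=> [df kf]; split=> [a Oa|v].
  by apply: near_eq_differentiable (df a Oa); exact: open_near_eq fg Oa.
by apply: IH (kf v) => a Oa; exact: derive_open_eq fg Oa.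
Qed.

Lemma CkW k O f : open O -> Ck k.+1 O f -> Ck k O f.
Proof.
move=> oO; elim: k f => [|k IH] f.
  move=> [df _]; apply/(Ck0P f oO) => a Oa.
  exact/differentiable_continuous/df.
by move=> [df kf]; split => // v; apply: IH.
Qed.

Lemma Ck_cst k O (c : R) : open O -> Ck k O (fun=> c).
Proof.
move=> oO; elim: k c => [|k IH] c.
  by apply/(Ck0P _ oO) => a _; exact: cst_continuous.
split=> [a _|v]; first exact: differentiable_cst.
apply: (@Ck_ext _ _ (fun=> 0)) => // a _.
by rewrite derive_cst.
Qed.

Lemma Ck_add k O f g : open O -> Ck k O f -> Ck k O g ->
  Ck k O (fun a => f a + g a).
Proof.
move=> oO; elim: k f g => [|k IH] f g.
  move=> /(Ck0P f oO) cf /(Ck0P g oO) cg; apply/(Ck0P _ oO) => a Oa.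
  exact: continuousD (cf a Oa) (cg a Oa).
move=> [df kf] [dg kg]; split=> [a Oa|v].
  exact: differentiableD (df a Oa) (dg a Oa).
apply: Ck_ext (IH _ _ (kf v) (kg v)) => // a Oa.
by rewrite deriveD//; apply: diff_derivable; [exact: df|exact: dg].
Qed.

Lemma Ck_mul k O f g : open O -> Ck k O f -> Ck k O g ->
  Ck k O (fun a => f a * g a).
Proof.
move=> oO; elim: k f g => [|k IH] f g.
  move=> /(Ck0P f oO) cf /(Ck0P g oO) cg; apply/(Ck0P _ oO) => a Oa.
  exact: continuousM (cf a Oa) (cg a Oa).
move=> hf hg; have [df kf] := hf; have [dg kg] := hg; split=> [a Oa|v].
  exact: differentiableM (df a Oa) (dg a Oa).
have h1 := IH _ _ (CkW oO hf) (kg v).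
have h2 := IH _ _ (CkW oO hg) (kf v).
apply: Ck_ext (Ck_add oO h1 h2) => // a Oa.
by rewrite deriveM//; apply: diff_derivable; [exact: df|exact: dg].
Qed.

(** Bootstrap on [k]: the derivative of 1/f is -(1/f)^2 times that of f, and 1/f is already known to
    be one order less regular. *)
Lemma Ck_inv k O f : open O -> (forall a, O a -> f a != 0) -> Ck k O f ->
  Ck k O (fun a => (f a)^-1).
Proof.
move=> oO f0; elim: k => [|k IH].
  move=> /(Ck0P f oO) cf; apply/(Ck0P _ oO) => a Oa.
  by apply: (continuous_comp (cf a Oa)); apply: inv_continuous; exact: f0.
move=> hf; have [df kf] := hf; split=> [a Oa|v].
  by apply: differentiableV; [exact: df|exact: f0].
have iV := IH (CkW oO hf).
have h1 := Ck_mul oO (Ck_mul oO iV iV) (kf v).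
apply: Ck_ext (Ck_mul oO (Ck_cst k (-1) oO) h1) => // a Oa.
rewrite deriveV ?f0//; last exact/diff_derivable/df.
by rewrite -[RHS]/(- (f a) ^- 2 * 'D_v f a) mulN1r mulNr expr2 invfM.
Qed.

Lemma derive_comp1 (h : R -> R) f a v d : differentiable f a ->
  is_derive (f a) 1 h d -> 'D_v (h \o f) a = d * 'D_v f a.
Proof.
move=> df [dh hd].
have dh' : differentiable h (f a) by exact/derivable1_diffP.
rewrite deriveE; last exact: differentiable_comp.
rewrite diff_comp//= (deriveE v df); set c := 'd f a v.
rewrite -[c in LHS]mulr1 -[_ * 1]/(c *: (1 : R)) linearZ.
by rewrite -(deriveE _ dh') hd -[LHS]/(c * d) mulrC.
Qed.

(** The same bootstrap, the derivative being that of f divided by 2 sqrt f. *)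
Lemma Ck_sqrt k O f : open O -> (forall a, O a -> 0 < f a) -> Ck k O f ->
  Ck k O (fun a => Num.sqrt (f a)).
Proof.
move=> oO f0; elim: k => [|k IH].
  move=> /(Ck0P f oO) cf; apply/(Ck0P _ oO) => a Oa.
  by apply: (continuous_comp (cf a Oa)); exact: sqrt_continuous.
move=> hf; have [df kf] := hf; split=> [a Oa|v].
  apply: (@differentiable_comp _ _ _ _ f Num.sqrt); first exact: df.
  by apply/derivable1_diffP; case: (is_derive1_sqrt (f0 _ Oa)).
have iS := IH (CkW oO hf).
have h1 := Ck_mul oO (Ck_cst k 2 oO) iS.
have h2 : Ck k O (fun a => (2 * Num.sqrt (f a))^-1).
  by apply: (Ck_inv oO _ h1) => a Oa; rewrite mulf_neq0// gt_eqF// sqrtr_gt0 f0.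
apply: Ck_ext (Ck_mul oO h2 (kf v)) => // a Oa.
by rewrite -[RHS]/('D_v (Num.sqrt \o f) a)
  (derive_comp1 _ (df _ Oa) (is_derive1_sqrt (f0 _ Oa))).
Qed.

Lemma Ck_linear k O (f : {linear V -> R}) : open O -> continuous f -> Ck k O f.
Proof.
move=> oO cf; case: k => [|k].
  by apply/(Ck0P _ oO) => a _; exact: cf.
have df a : differentiable f a by exact: linear_differentiable.
split=> [a _|v]; first exact: df.
by apply: (Ck_ext oO) (Ck_cst k (f v) oO) => a _; rewrite deriveE// diff_lin.
Qed.

Lemma smooth_ext {O f g} : open O -> (forall a, O a -> f a = g a) ->
  smooth_on O f -> smooth_on O g.
Proof. by move=> oO fg sf k; exact: Ck_ext fg (sf k). Qed.

Lemma smooth_cst O c : open O -> smooth_on O (fun=> c).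
Proof. by move=> oO k; exact: Ck_cst. Qed.

Lemma smoothD {O f g} : open O -> smooth_on O f -> smooth_on O g ->
  smooth_on O (fun a => f a + g a).
Proof. by move=> oO sf sg k; exact: Ck_add. Qed.

Lemma smoothM {O f g} : open O -> smooth_on O f -> smooth_on O g ->
  smooth_on O (fun a => f a * g a).
Proof. by move=> oO sf sg k; exact: Ck_mul. Qed.

Lemma smoothN {O f} : open O -> smooth_on O f -> smooth_on O (fun a => - f a).
Proof.
move=> oO sf; apply: (smooth_ext oO) (smoothM oO (smooth_cst (-1) oO) sf) => a _.
by rewrite mulN1r.
Qed.

Lemma smoothB {O f g} : open O -> smooth_on O f -> smooth_on O g ->
  smooth_on O (fun a => f a - g a).
Proof. by move=> oO sf sg; apply: smoothD => //; exact: smoothN. Qed.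

Lemma smoothX {O f} n : open O -> smooth_on O f ->
  smooth_on O (fun a => f a ^+ n).
Proof.
move=> oO sf; elim: n => [|n IH].
  exact: smooth_cst.
by apply: (smooth_ext oO) (smoothM oO sf IH) => a _; rewrite exprS.
Qed.

Lemma smoothV {O f} : open O -> (forall a, O a -> f a != 0) -> smooth_on O f ->
  smooth_on O (fun a => (f a)^-1).
Proof. by move=> oO f0 sf k; exact: Ck_inv. Qed.

Lemma smooth_sqrt {O f} : open O -> (forall a, O a -> 0 < f a) ->
  smooth_on O f -> smooth_on O (fun a => Num.sqrt (f a)).
Proof. by move=> oO f0 sf k; exact: Ck_sqrt. Qed.

Lemma smooth_sum {O} (I : Type) (r : seq I) (P : pred I) (F : I -> V -> R) :
  open O -> (forall i, P i -> smooth_on O (F i)) ->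
  smooth_on O (fun a => \sum_(i <- r | P i) F i a).
Proof.
move=> oO sF; elim: r => [|i r IH].
  by apply: (smooth_ext oO) (smooth_cst 0 oO) => a _; rewrite big_nil.
case Pi : (P i).
  by apply: (smooth_ext oO) (smoothD oO (sF i Pi) IH) => a _; rewrite big_cons Pi.
by apply: (smooth_ext oO) IH => a _; rewrite big_cons Pi.
Qed.

Lemma smooth_prod {O} (I : Type) (r : seq I) (P : pred I) (F : I -> V -> R) :
  open O -> (forall i, P i -> smooth_on O (F i)) ->
  smooth_on O (fun a => \prod_(i <- r | P i) F i a).
Proof.
move=> oO sF; elim: r => [|i r IH].
  by apply: (smooth_ext oO) (smooth_cst 1 oO) => a _; rewrite big_nil.
case Pi : (P i).
  by apply: (smooth_ext oO) (smoothM oO (sF i Pi) IH) => a _; rewrite big_cons Pi.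
by apply: (smooth_ext oO) IH => a _; rewrite big_cons Pi.
Qed.

Lemma smooth_derive {O f} v : smooth_on O f -> smooth_on O ('D_v f).
Proof. by move=> sf k; have [_] := sf k.+1; exact. Qed.

Lemma smooth_diff {O f a} : smooth_on O f -> O a -> differentiable f a.
Proof. by move=> sf Oa; have [+ _] := sf 1%N; exact. Qed.

Lemma smooth_derivable {O f a v} : smooth_on O f -> O a -> derivable f a v.
Proof. by move=> sf Oa; apply/diff_derivable/(smooth_diff sf). Qed.

Lemma smooth_continuous {O f a} : smooth_on O f -> O a -> {for a, continuous f}.
Proof. by move=> sf Oa; exact/differentiable_continuous/(smooth_diff sf). Qed.

(** Continuity on [O'] is drawn from differentiability on [O], one order higher; hence the statement
    for all orders at once instead of a fixed [k]. *)
Lemma smooth_sub {O O' f} : open O -> open O' -> O' `<=` O -> smooth_on O f ->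
  smooth_on O' f.
Proof.
move=> oO oO' sub sf k; elim: k f sf => [|k IH] f sf.
  by apply/(Ck0P f oO') => a /sub; exact: smooth_continuous.
split=> [a /sub|v]; first exact: smooth_diff.
exact/IH/smooth_derive.
Qed.

Lemma deriveZv f a c v : differentiable f a -> 'D_(c *: v) f a = c * 'D_v f a.
Proof. by move=> df; rewrite !deriveE// linearZ. Qed.

Lemma derive_sumv (I : Type) (r : seq I) (P : pred I) (F : I -> V) f a :
  differentiable f a ->
  'D_(\sum_(i <- r | P i) F i) f a = \sum_(i <- r | P i) 'D_(F i) f a.
Proof.
by move=> df; rewrite deriveE// linear_sum; apply: eq_bigr => i _; rewrite deriveE.
Qed.

End Smooth.

(** * Chain rule through coordinates *)

Section Composition.
Context {R : realType} {V : normedModType R} {m : nat}.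

Lemma row_sum_delta (c : 'I_m -> R) :
  \row_i c i = \sum_i c i *: (delta_mx 0 i : 'rV[R]_m).
Proof.
apply/rowP => j; rewrite mxE summxE (bigD1 j)//= big1 ?addr0.
  by rewrite !mxE !eqxx mulr1.
by move=> i /negPf ij; rewrite !mxE eq_sym ij andbF mulr0.
Qed.

Lemma differentiable_row (c : 'I_m -> V -> R) a :
  (forall i, differentiable (c i) a) ->
  differentiable (fun b => \row_i c i b) a.
Proof.
move=> dc.
have -> : (fun b => \row_i c i b) =
    \sum_i (fun b => c i b *: (delta_mx 0 i : 'rV[R]_m)).
  by apply/funext => b; rewrite row_sum_delta fct_sumE.
by apply: differentiable_sum => i; exact: differentiableZl.
Qed.

Lemma derive_row (c : 'I_m -> V -> R) a v :
  (forall i, differentiable (c i) a) ->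
  'D_v (fun b => \row_i c i b) a = \row_i 'D_v (c i) a.
Proof.
move=> dc; rewrite derive_mx; last exact/diff_derivable/differentiable_row.
apply/matrixP => i j; rewrite 2!mxE.
suff -> : (fun b => (\row_k c k b) i j) = c j by [].
by apply/funext => b; rewrite mxE.
Qed.

Lemma derive_comp (H : 'rV[R]_m -> R) (c : 'I_m -> V -> R) a v :
  (forall i, differentiable (c i) a) -> differentiable H (\row_i c i a) ->
  'D_v (fun b => H (\row_i c i b)) a =
  \sum_i 'D_v (c i) a * 'D_(delta_mx 0 i) H (\row_i c i a).
Proof.
move=> dc dH; have dr := differentiable_row dc.
rewrite (_ : (fun b => _) = H \o (fun b => \row_i c i b))//.
rewrite deriveE; last exact: differentiable_comp.
rewrite diff_comp//= -(deriveE v dr) derive_row// [X in 'd _ _ X]row_sum_delta linear_sum.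
by apply: eq_bigr => i _; rewrite linearZ (deriveE _ dH).
Qed.

(** The chain rule turns a derivative of the composite into a sum of products in which [H] is
    replaced by its partial derivatives; these are smooth as well, so the induction on [k]
    quantifies over [H]. *)
Lemma smooth_comp (O : set V) (O' : set 'rV[R]_m) (H : 'rV[R]_m -> R)
    (c : 'I_m -> V -> R) :
  open O -> open O' -> (forall a, O a -> O' (\row_i c i a)) ->
  (forall i, smooth_on O (c i)) -> smooth_on O' H ->
  smooth_on O (fun a => H (\row_i c i a)).
Proof.
move=> oO oO' sub sc sH k; elim: k H sH => [|k IH] H sH.
  apply/(Ck0P _ oO) => a Oa.
  have dc i : differentiable (c i) a by exact: smooth_diff (sc i) Oa.
  apply: (continuous_comp (differentiable_continuous (differentiable_row dc))).
  exact: smooth_continuous sH (sub _ Oa).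
split=> [a Oa|v].
  have dc i : differentiable (c i) a by exact: smooth_diff (sc i) Oa.
  apply: (differentiable_comp (differentiable_row dc)).
  exact: smooth_diff sH (sub _ Oa).
apply: (@Ck_ext _ _ _ _
  (fun a => \sum_i 'D_v (c i) a * 'D_(delta_mx 0 i) H (\row_i c i a))) => //.
  move=> a Oa; rewrite derive_comp// => [i|]; first exact: smooth_diff (sc i) Oa.
  exact: smooth_diff sH (sub _ Oa).
have : forall i, Ck k O (fun a => 'D_v (c i) a * 'D_(delta_mx 0 i) H (\row_i c i a)).
  move=> i; apply: Ck_mul => //; first exact: smooth_derive (sc i) k.
  by apply: (IH ('D_(delta_mx 0 i) H)); exact: smooth_derive.
(* Only the order [k] is available at this point, so the finite sum is treated by induction on its
   index list. *)
elim: (index_enum _) => [|i r IHr] h.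
  by apply: (Ck_ext oO) (Ck_cst k 0 oO) => a _; rewrite big_nil.
by apply: (Ck_ext oO) (Ck_add oO (h i) (IHr h)) => a _; rewrite big_cons.
Qed.

End Composition.

(** * Symmetry of second derivatives *)

Section Schwarz.
Context {R : realType} {V : normedModType R}.
Implicit Types (O : set V) (f g : V -> R).

Lemma is_derive_line f a v (t : R) : derivable f (a + t *: v) v ->
  is_derive t 1 (fun t => f (a + t *: v)) ('D_v f (a + t *: v)).
Proof.
have E : (fun h : R => h^-1 *: (f (a + (h *: 1 + t) *: v) - f (a + t *: v))) =
         (fun h : R => h^-1 *: (f (h *: v + (a + t *: v)) - f (a + t *: v))).
  apply/funext => h; congr (_ *: (f _ - _)).
  by rewrite -[h *: 1]/(h * 1) mulr1 scalerDl addrCA.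
move=> df; apply: DeriveDef; last by rewrite /derive /= E.
by rewrite /derivable /= E.
Qed.

Lemma MVT_line f a v (h : R) : 0 < h ->
  (forall t, 0 <= t <= h -> differentiable f (a + t *: v)) ->
  exists2 t, 0 <= t <= h & f (a + h *: v) - f a = 'D_v f (a + t *: v) * h.
Proof.
move=> h0 df.
have dl t : 0 <= t <= h ->
    is_derive t 1 (fun t => f (a + t *: v)) ('D_v f (a + t *: v)).
  by move=> th; apply/is_derive_line/diff_derivable/df.
have [||t th] := @MVT R (fun t => f (a + t *: v)) (fun t => 'D_v f (a + t *: v)) _ _ h0.
- by move=> t; rewrite in_itv/= => /andP[/ltW ? /ltW ?]; apply: dl; apply/andP.
- apply: derivable_within_continuous => t; rewrite in_itv/= => th.
  by case: (dl t th).
rewrite scale0r addr0 subr0 => ->; exists t => //.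
by move: th; rewrite in_itv/= => /andP[/ltW -> /ltW ->].
Qed.

(** Two mean value theorems: one for the increment by [h *: w], seen as a function along [v], and
    one for ['D_v f] along [w]. *)
Lemma mixed_difference O f a v w (h : R) : 0 < h -> smooth_on O f ->
  (forall s t, 0 <= s <= h -> 0 <= t <= h -> O (a + s *: v + t *: w)) ->
  exists s t, [/\ 0 <= s <= h, 0 <= t <= h &
    f (a + h *: v + h *: w) - f (a + h *: v) - (f (a + h *: w) - f a) =
    'D_w ('D_v f) (a + s *: v + t *: w) * h * h].
Proof.
move=> h0 sf Ob.
have hh : 0 <= h <= h by rewrite lexx ltW.
have h00 : 0 <= (0 : R) <= h by rewrite lexx ltW.
pose g t := f (a + h *: w + t *: v) - f (a + t *: v).
have O1 t : 0 <= t <= h -> O (a + h *: w + t *: v).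
  by move=> th; rewrite addrAC; exact: Ob.
have O2 t : 0 <= t <= h -> O (a + t *: v).
  by move=> th; have := Ob t 0 th h00; rewrite scale0r addr0.
pose dg t := 'D_v f (a + h *: w + t *: v) - 'D_v f (a + t *: v).
have dgE t : 0 <= t <= h -> is_derive t 1 g (dg t).
  by move=> th; apply: is_deriveB; apply/is_derive_line;
    apply: (smooth_derivable sf); [exact: O1|exact: O2].
have [||s sh] := @MVT R g dg _ _ h0.
- by move=> t; rewrite in_itv/= => /andP[/ltW ? /ltW ?]; apply: dgE; apply/andP.
- apply: derivable_within_continuous => t; rewrite in_itv/= => th.
  by case: (dgE t th).
rewrite subr0 /g !scale0r !addr0 => gE.
have {}sh : 0 <= s <= h by move: sh; rewrite in_itv/= => /andP[/ltW -> /ltW ->].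
have [t th tE] := @MVT_line ('D_v f) (a + s *: v) w h h0
  (fun t th => smooth_diff (smooth_derive v sf) (Ob s t sh th)).
exists s, t; split => //.
rewrite -tE [a + s *: v + _]addrAC -/(dg s) -gE.
by rewrite [a + h *: v + _]addrAC.
Qed.

(** The second difference over a parallelogram does not depend on the order of its sides, so the two
    mixed derivatives share a value, taken at two points close to [a]. If they differed at [a],
    continuity would keep them apart on a small parallelogram. *)
Lemma derive_comm O f a v w : open O -> smooth_on O f -> O a ->
  'D_w ('D_v f) a = 'D_v ('D_w f) a.
Proof.
move=> oO sf Oa; apply/eqP; rewrite -subr_eq0 -normr_eq0; apply/eqP.
set A := 'D_w ('D_v f); set B := 'D_v ('D_w f).
have cA : A b @[b --> a] --> A a.
  exact: smooth_continuous (smooth_derive w (smooth_derive v sf)) Oa.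
have cB : B b @[b --> a] --> B a.
  exact: smooth_continuous (smooth_derive v (smooth_derive w sf)) Oa.
pose Q v w (A : V -> R) := forall h, 0 < h ->
  (forall s t, 0 <= s <= h -> 0 <= t <= h -> O (a + s *: v + t *: w)) ->
  exists s t, [/\ 0 <= s <= h, 0 <= t <= h &
    f (a + h *: v + h *: w) - f (a + h *: v) - (f (a + h *: w) - f a) =
    A (a + s *: v + t *: w) * h * h].
have mA : Q v w A by move=> h h0; exact: mixed_difference h0 sf.
have mB : Q w v B by move=> h h0; exact: mixed_difference h0 sf.
rewrite -[_ - _]/(A a - B a); clearbody A B.
apply/eqP/negPn/negP => n0.
pose e := `|A a - B a| / 2.
have e0 : 0 < e by rewrite divr_gt0// lt0r n0/=.
have nA : \forall b \near a, O b /\ (`|A a - A b| < e /\ `|B a - B b| < e).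
  have nO : \forall b \near a, O b by exact: open_nbhs_nbhs.
  have nA : \forall b \near a, `|A a - A b| < e by move/cvgrPdist_lt: cA => /(_ _ e0).
  have nB : \forall b \near a, `|B a - B b| < e by move/cvgrPdist_lt: cB => /(_ _ e0).
  by apply: filterI => //; apply: filterI.
have /nbhs_ballP[d /= d0 bd] := nA.
(* The 1 keeps [k] positive when [v = w = 0]; with [h = d / (2 * k)] the whole parallelogram stays
   within d/2 of [a]. *)
pose k := `|v| + `|w| + 1.
have k0 : 0 < k by rewrite ltr_wpDl// addr_ge0.
pose h := d / (2 * k).
have h0 : 0 < h by rewrite divr_gt0// mulr_gt0.
have box s t : 0 <= s <= h -> 0 <= t <= h -> ball a d (a + s *: v + t *: w).
  move=> /andP[s0 sh] /andP[t0 th]; rewrite -ball_normE/=.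
  rewrite -addrA opprD addrA subrr sub0r normrN.
  apply: (@le_lt_trans _ _ (h * k)).
    apply: le_trans (ler_normD _ _) _; rewrite !normrZ !ger0_norm//.
    rewrite /k !mulrDr mulr1.
    apply: (@le_trans _ _ (h * `|v| + h * `|w|)); last by rewrite lerDl ltW.
    by apply: lerD; apply: ler_wpM2r.
  rewrite /h invfM mulrA -mulrA mulVf ?gt_eqF// mulr1.
  by rewrite ltr_pdivrMr// ltr_pMr// ltr1n.
have Ob s t : 0 <= s <= h -> 0 <= t <= h -> O (a + s *: v + t *: w).
  by move=> sh th; have [] := bd _ (box s t sh th).
have Ob' s t : 0 <= s <= h -> 0 <= t <= h -> O (a + s *: w + t *: v).
  by move=> sh th; rewrite addrAC; exact: Ob.
have [s [t [sh th E]]] := mA h h0 Ob.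
have [s' [t' [sh' th' E']]] := mB h h0 Ob'.
have EE : A (a + s *: v + t *: w) = B (a + t' *: v + s' *: w).
  apply: (@mulIf _ h); first by rewrite gt_eqF.
  apply: (@mulIf _ h); first by rewrite gt_eqF.
  rewrite -E [a + t' *: v + _]addrAC -E' [a + h *: w + _]addrAC.
  by rewrite -!addrA -!opprD; congr (_ - _); rewrite addrA [RHS]addrA
    [f _ + f _]addrC.
have [_ [nA1 _]] := bd _ (box s t sh th).
have [_ [_ nB1]] := bd _ (box t' s' th' sh').
have : `|A a - B a| < e + e.
  rewrite -(subrKA (A (a + s *: v + t *: w))).
  apply: le_lt_trans (ler_normD _ _) _; apply: ltrD => //.
  by rewrite EE distrC.
by rewrite -splitr ltxx.
Qed.

End Schwarz.

(** * Continuous linear functionals, determinants and inverse matrices *)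

Section LinearFunctionals.
Context {R : realType} {V : normedModType R}.

Lemma smooth_linear (O : set V) (f : V -> R) :
  open O -> linear f -> continuous f -> smooth_on O f.
Proof.
move=> oO lf cf k; pose m := GRing.isLinear.Build _ _ _ _ _ lf.
by pose L : {linear V -> R} := HB.pack f m; exact: (@Ck_linear _ _ k O L).
Qed.

Lemma derive_linear (f : V -> R) a v : linear f -> continuous f -> 'D_v f a = f v.
Proof.
move=> lf cf; pose m := GRing.isLinear.Build _ _ _ _ _ lf.
pose L : {linear V -> R} := HB.pack f m.
rewrite (@deriveE _ _ _ L); last exact: linear_differentiable.
by rewrite (@diff_lin _ _ _ L).
Qed.

End LinearFunctionals.

Section SmoothMatrix.
Context {R : realType} {V : normedModType R}.

Lemma smooth_det (O : set V) (m : nat) (A : V -> 'M[R]_m) : open O ->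
  (forall i j, smooth_on O (fun p => A p i j)) -> smooth_on O (fun p => \det (A p)).
Proof.
move=> oO sA; apply: smooth_sum => // s _; apply: smoothM => //.
  exact: smooth_cst.
by apply: smooth_prod => // i _; exact: sA.
Qed.

(** Cofactor formula: an entry of the inverse is a polynomial in the entries divided by the
    determinant. *)
Lemma smooth_invmx (O : set V) (m : nat) (A : V -> 'M[R]_m) i j : open O ->
  (forall p, O p -> A p \in unitmx) ->
  (forall i j, smooth_on O (fun p => A p i j)) ->
  smooth_on O (fun p => invmx (A p) i j).
Proof.
move=> oO uA sA.
have h : smooth_on O (fun p => (\det (A p))^-1 *
    ((-1) ^+ (j + i) * \det (row' j (col' i (A p))))).
  apply: smoothM => //.
    apply: smoothV => //; last exact: smooth_det.
    by move=> p /uA; rewrite unitmxE unitfE.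
  apply: smoothM => //; first exact: smooth_cst.
  apply: smooth_det => // k l.
  by apply: (smooth_ext oO) (sA (lift j k) (lift i l)) => p _; rewrite !mxE.
by apply: (smooth_ext oO) h => p Op; rewrite /invmx uA// !mxE.
Qed.

End SmoothMatrix.

(** * Functions on the tangent bundle *)

Section TangentBundle.
Context {R : realType} {n : nat}.
Notation vec := 'rV[R]_(n.+1).
Notation TM := (vec * vec)%type.
Implicit Types (p v : TM) (G : vec -> vec -> R).

(** On the product space [dx A] and [dy A] become derivatives of one function along [(e_A, 0)] and
    [(0, e_A)], so that the general rules, symmetry of second derivatives included, apply to
    both. *)
Definition unc G : TM -> R := fun p => G p.1 p.2.

Lemma unc_dx A G : unc (dx A G) = 'D_(ebasis R A, 0) (unc G).
Proof.
apply/funext => -[x y]; rewrite /unc /dx /derive /=.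
suff -> : (fun h : R => h^-1 *: (((fun x' => G x' y) \o shift x) (h *: ebasis R A) - G x y)) =
  (fun h : R => h^-1 *:
    (((fun p : TM => G p.1 p.2) \o shift (x, y)) (h *: (ebasis R A, 0)) - G x y)) by [].
by apply/funext => h /=; rewrite scaler0 add0r.
Qed.

Lemma unc_dy A G : unc (dy A G) = 'D_(0, ebasis R A) (unc G).
Proof.
apply/funext => -[x y]; rewrite /unc /dy /derive /=.
suff -> : (fun h : R => h^-1 *: (((fun y' => G x y') \o shift y) (h *: ebasis R A) - G x y)) =
  (fun h : R => h^-1 *:
    (((fun p : TM => G p.1 p.2) \o shift (x, y)) (h *: (0, ebasis R A)) - G x y)) by [].
by apply/funext => h /=; rewrite scaler0 add0r.
Qed.

Definition cX A : TM -> R := fun p => p.1 0 A.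
Definition cY A : TM -> R := fun p => p.2 0 A.

Lemma linear_cX A : linear (cX A). Proof. by move=> k p q; rewrite /cX /= !mxE. Qed.
Lemma linear_cY A : linear (cY A). Proof. by move=> k p q; rewrite /cY /= !mxE. Qed.

Lemma continuous_cX A : continuous (cX A).
Proof.
move=> p; have c : {for p, continuous (@fst vec vec)} by exact: cvg_fst.
exact: (continuous_comp c (@coord_continuous _ _ _ _ _ _)).

Qed.
Lemma continuous_cY A : continuous (cY A).
Proof.
move=> p; have c : {for p, continuous (@snd vec vec)} by exact: cvg_snd.
exact: (continuous_comp c (@coord_continuous _ _ _ _ _ _)).

Qed.

Lemma smooth_cX O A : open O -> smooth_on O (cX A).
Proof. by move=> oO; apply: smooth_linear => //; [exact: linear_cX|exact: continuous_cX]. Qed.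
Lemma smooth_cY O A : open O -> smooth_on O (cY A).
Proof. by move=> oO; apply: smooth_linear => //; [exact: linear_cY|exact: continuous_cY]. Qed.

Lemma derive_cX A p v : 'D_v (cX A) p = v.1 0 A.
Proof. by rewrite derive_linear//; [exact: linear_cX|exact: continuous_cX]. Qed.
Lemma derive_cY A p v : 'D_v (cY A) p = v.2 0 A.
Proof. by rewrite derive_linear//; [exact: linear_cY|exact: continuous_cY]. Qed.

Lemma bar_dotC (x y : vec) : bar_dot x y = bar_dot y x.
Proof. by apply: eq_bigr => i _; rewrite mulrC. Qed.
Lemma bar_dotDr (x y z : vec) : bar_dot x (y + z) = bar_dot x y + bar_dot x z.
Proof. by rewrite -big_split; apply: eq_bigr => i _; rewrite mxE mulrDr. Qed.
Lemma bar_dotZr (k : R) (x y : vec) : bar_dot x (k *: y) = k * bar_dot x y.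
Proof. by rewrite big_distrr; apply: eq_bigr => i _; rewrite mxE mulrCA. Qed.
Lemma bar_dotDl (x y z : vec) : bar_dot (y + z) x = bar_dot y x + bar_dot z x.
Proof. by rewrite bar_dotC bar_dotDr ![bar_dot x _]bar_dotC. Qed.
Lemma bar_dotZl (k : R) (x y : vec) : bar_dot (k *: y) x = k * bar_dot y x.
Proof. by rewrite bar_dotC bar_dotZr bar_dotC. Qed.
Lemma bar_dot_ge0 (x : vec) : 0 <= bar_dot x x.
Proof. by apply: sumr_ge0 => i _; rewrite -expr2 sqr_ge0. Qed.
Lemma bar_norm_sqr (x : vec) : bar_norm x ^+ 2 = bar_dot x x.
Proof. by rewrite sqr_sqrtr// bar_dot_ge0. Qed.
Lemma bar_norm_ge0 (x : vec) : 0 <= bar_norm x.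
Proof. exact: sqrtr_ge0. Qed.

Lemma smooth_bar_dot O (f g : 'I_n.+1 -> TM -> R) : open O ->
  (forall A, smooth_on O (f A)) -> (forall A, smooth_on O (g A)) ->
  smooth_on O (fun p => \sum_(i < n) f (lift ord0 i) p * g (lift ord0 i) p).
Proof. by move=> oO sf sg; apply: smooth_sum => // i _; exact: smoothM. Qed.

Lemma derive_bar_dot (f g : 'I_n.+1 -> TM -> R) p v :
  (forall A, differentiable (f A) p) -> (forall A, differentiable (g A) p) ->
  'D_v (fun q => \sum_(i < n) f (lift ord0 i) q * g (lift ord0 i) q) p =
  \sum_(i < n) ('D_v (f (lift ord0 i)) p * g (lift ord0 i) p +
                f (lift ord0 i) p * 'D_v (g (lift ord0 i)) p).
Proof.
move=> df dg.
rewrite (_ : (fun q => _) = \sum_(i < n) (fun q =>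
  f (lift ord0 i) q * g (lift ord0 i) q)); last first.
  by apply/funext => q; rewrite fct_sumE.
rewrite derive_sum => [|i]; last by apply/diff_derivable/differentiableM.
apply: eq_bigr => i _; rewrite deriveM; [|exact: diff_derivable|exact: diff_derivable].
by rewrite addrC -[_ *: _]/(_ * _) mulrC.
Qed.

Definition fxx p := bar_dot p.1 p.1.
Definition fxy p := bar_dot p.1 p.2.
Definition fyy p := bar_dot p.2 p.2.

Lemma smooth_fxx O : open O -> smooth_on O fxx.
Proof. by move=> oO; apply: (@smooth_bar_dot O cX cX) => // A; exact: smooth_cX. Qed.
Lemma smooth_fxy O : open O -> smooth_on O fxy.
Proof.
by move=> oO; apply: (@smooth_bar_dot O cX cY) => // A; [exact: smooth_cX|exact: smooth_cY].
Qed.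
Lemma smooth_fyy O : open O -> smooth_on O fyy.
Proof. by move=> oO; apply: (@smooth_bar_dot O cY cY) => // A; exact: smooth_cY. Qed.

Lemma diff_cX A p : differentiable (cX A) p.
Proof. exact: smooth_diff (smooth_cX A openT) I. Qed.
Lemma diff_cY A p : differentiable (cY A) p.
Proof. exact: smooth_diff (smooth_cY A openT) I. Qed.

Lemma derive_fxx p v : 'D_v fxx p = 2 * bar_dot p.1 v.1.
Proof.
rewrite (@derive_bar_dot cX cX); [|exact: (diff_cX ^~ p)|exact: (diff_cX ^~ p)].
rewrite mulr_sumr; apply: eq_bigr => i _; rewrite !derive_cX /cX.
by rewrite mulrC -mulr2n mulr_natl.
Qed.
Lemma derive_fxy p v : 'D_v fxy p = bar_dot v.1 p.2 + bar_dot p.1 v.2.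
Proof.
rewrite (@derive_bar_dot cX cY); [|exact: (diff_cX ^~ p)|exact: (diff_cY ^~ p)].
by rewrite -big_split; apply: eq_bigr => i _; rewrite !derive_cX !derive_cY.
Qed.
Lemma derive_fyy p v : 'D_v fyy p = 2 * bar_dot p.2 v.2.
Proof.
rewrite (@derive_bar_dot cY cY); [|exact: (diff_cY ^~ p)|exact: (diff_cY ^~ p)].
rewrite mulr_sumr; apply: eq_bigr => i _; rewrite !derive_cY /cY.
by rewrite mulrC -mulr2n mulr_natl.
Qed.

Lemma smooth_continuousT (f : TM -> R) : smooth_on setT f -> continuous f.
Proof. by move=> sf p; exact: smooth_continuous sf I. Qed.

End TangentBundle.

(** * Smoothness of the fundamental tensor, the spray and the Douglas curvature *)

Section FinslerMetric.
Context {R : realType} {n : nat}.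
Notation vec := 'rV[R]_(n.+1).
Notation TM := (vec * vec)%type.
Variables (I : set R) (rho : R) (F : vec -> vec -> R).
Hypothesis oI : open I.

Definition slit : set TM := [set p | cyl_domain I rho p.1 /\ p.2 != 0].

Lemma open_slit : open slit.
Proof.
have o1 : open [set p : TM | I (cX ord0 p)].
  exact: (@open_comp _ _ (cX ord0) I (fun p _ => @continuous_cX _ _ ord0 p) oI).
have o2 : open [set p : TM | bar_norm p.1 < rho].
  apply: (@open_comp _ _ (fun p : TM => bar_norm p.1) [set t | t < rho]).
    move=> p _; apply: (@continuous_comp _ _ _ (@fxx R n) Num.sqrt).
      exact: smooth_continuousT (smooth_fxx openT) p.
    exact: sqrt_continuous.
  exact: open_lt.
have o3 : open [set p : TM | 0 < `|p.2|].
  apply: (@open_comp _ _ (fun p : TM => `|p.2|) [set t | 0 < t]).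
    move=> p _; have c : {for p, continuous (@snd vec vec)} by exact: cvg_snd.
    exact: (continuous_comp c (@norm_continuous _ _ _)).
  exact: open_gt.
have -> : slit = [set p : TM | I (cX ord0 p)] `&` [set p : TM | bar_norm p.1 < rho]
   `&` [set p : TM | 0 < `|p.2|].
  by apply/seteqP; split => p; rewrite /slit /= /cyl_domain /= normr_gt0; tauto.
by apply: openI => //; exact: openI.
Qed.

Hypothesis FF : is_Finsler (cyl_domain I rho) F.

Lemma smooth_unc : smooth_on slit (unc F).
Proof. by case: FF. Qed.

Lemma smooth_Fsq : smooth_on slit (unc (Fsq F)).
Proof. exact: smoothX 2 open_slit smooth_unc. Qed.

Lemma smooth_dx A G : smooth_on slit (unc G) -> smooth_on slit (unc (dx A G)).
Proof. by rewrite unc_dx; exact: smooth_derive. Qed.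

Lemma smooth_dy A G : smooth_on slit (unc G) -> smooth_on slit (unc (dy A G)).
Proof. by rewrite unc_dy; exact: smooth_derive. Qed.

Lemma smooth_gten A B : smooth_on slit (unc (fun x y => gten F x y A B)).
Proof.
have h := smooth_dy A (smooth_dy B smooth_Fsq).
apply: (smooth_ext open_slit) (smoothM open_slit (smooth_cst 2^-1 open_slit) h).
by move=> p _; rewrite /unc mxE.
Qed.

(** A nonzero kernel vector would annihilate the quadratic form of [gten], against strong
    convexity. *)
Lemma gten_unit p : slit p -> gten F p.1 p.2 \in unitmx.
Proof.
move=> [xM y0]; have [_ _ _ pd] := FF.
rewrite unitmxE unitfE; apply/det0P => -[v v0 vg].
have := pd p.1 p.2 xM y0 v v0; rewrite exchange_big/= big1 ?ltxx// => B _.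
rewrite -mulr_suml; suff -> : \sum_A gten F p.1 p.2 A B * v 0 A = 0 by rewrite mul0r.
move/rowP: vg => /(_ B); rewrite !mxE => vg; rewrite -[RHS]vg.
by apply: eq_bigr => A _; rewrite mulrC.
Qed.

Lemma smooth_geod A : smooth_on slit (unc (geod F A)).
Proof.
apply: smoothM open_slit (smooth_cst _ open_slit) _.
apply: smooth_sum open_slit _ => B _; apply: smoothM open_slit _ _.
  apply: (smooth_invmx (A := fun p => gten F p.1 p.2)) open_slit gten_unit _.
  exact: smooth_gten.
apply: smoothB open_slit _ _; last exact: smooth_dx smooth_Fsq.
apply: smooth_sum open_slit _ => C _; apply: smoothM open_slit _ _.
  by apply: smooth_dx; apply: smooth_dy; exact: smooth_Fsq.
exact: smooth_cY open_slit.
Qed.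

(** The projective spray: adding P y to the geodesic coefficients, with P of degree one in y, adds
    (n + 2) P to their divergence and leaves this expression unchanged. *)
Definition hatG A : vec -> vec -> R := fun x y =>
  geod F A x y - (n.+2%:R)^-1 * (\sum_(E < n.+1) dy E (geod F E) x y) * y 0 A.

Lemma smooth_hatG A : smooth_on slit (unc (hatG A)).
Proof.
apply: smoothB open_slit (smooth_geod A) _.
apply: smoothM open_slit _ (smooth_cY A open_slit).
apply: smoothM open_slit (smooth_cst _ open_slit) _.
by apply: smooth_sum open_slit _ => E _; apply: smooth_dy; exact: smooth_geod.
Qed.

Lemma unc_douglas A B C D : unc (douglas F A B C D) =
  'D_(0, ebasis R B) ('D_(0, ebasis R C) ('D_(0, ebasis R D) (unc (hatG A)))).
Proof. by rewrite /douglas !unc_dy. Qed.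

Lemma smooth_douglas A B C D : smooth_on slit (unc (douglas F A B C D)).
Proof. by rewrite unc_douglas; do 3! apply: smooth_derive; exact: smooth_hatG. Qed.

End FinslerMetric.

(** * Density of the points with independent bar parts *)

Section Density.
Context {R : realType} {n : nat}.
Notation vec := 'rV[R]_(n.+1).
Notation TM := (vec * vec)%type.

Lemma bar_dot_eq0 (x : vec) i : bar_dot x x = 0 -> x 0 (lift ord0 i) = 0.
Proof.
move=> x0; have := psumr_eq0P (P := predT) _ x0 => /(_ _ i isT) h.
by apply/eqP; rewrite -[_ == 0]orbb -mulf_eq0 h// => j _; rewrite -expr2 sqr_ge0.
Qed.

(** [w] is [y] minus its projection on [x]; its squared bar length is the Gram determinant divided
    by |x|^2, and a nonzero minor excludes that the bar part of [w] vanishes. *)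
Lemma gram_gt0 (x y : vec) i j :
  x 0 (lift ord0 i) * y 0 (lift ord0 j) - x 0 (lift ord0 j) * y 0 (lift ord0 i) != 0 ->
  bar_dot x y ^+ 2 < bar_dot x x * bar_dot y y.
Proof.
move=> m0.
have xx0 : 0 < bar_dot x x.
  rewrite lt0r bar_dot_ge0 andbT; apply: contra_neq m0 => xx0.
  by rewrite !(bar_dot_eq0 _ xx0) !mul0r subrr.
pose c := bar_dot x y / bar_dot x x.
pose w := y + (- c) *: x.
have ww : bar_dot w w = bar_dot y y - bar_dot x y ^+ 2 / bar_dot x x.
  rewrite /w !(bar_dotDl, bar_dotDr, bar_dotZl, bar_dotZr) (bar_dotC y x) /c.
  by field; rewrite gt_eqF.
have : 0 < bar_dot w w.
  rewrite lt0r bar_dot_ge0 andbT; apply: contra_neq m0 => ww0.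
  have wE k : y 0 (lift ord0 k) = c * x 0 (lift ord0 k).
    have := bar_dot_eq0 k ww0; rewrite !mxE mulNr => /eqP.
    by rewrite subr_eq0 => /eqP.
  by rewrite !wE; ring.
by rewrite ww subr_gt0 ltr_pdivrMr// mulrC.
Qed.

Lemma small_nonroot (q : {poly R}) (e : R) : q != 0 -> 0 < e ->
  exists t, [/\ 0 < t, t < e & q.[t] != 0].
Proof.
(* Distinct points below [e]; the shift by 2 keeps even the one for [k = 0] strictly below. No
   polynomial [q] has [size q] roots. *)
move=> q0 e0; pose f (k : nat) : R := e / k.+2%:R.
have f_inj : injective f.
  move=> k l /(mulfI (lt0r_neq0 e0)) /invr_inj /eqP.
  by rewrite eqr_nat => /eqP[].
have : ~~ all (root q) [seq f k | k <- iota 0 (size q)].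
  apply/negP => h.
  have := max_poly_roots q0 h; rewrite map_inj_uniq// iota_uniq size_map size_iota.
  by rewrite ltnn => /(_ isT).
case/allPn => t /mapP[k _ ->] nr; exists (f k); split => //.
  by rewrite divr_gt0.
by rewrite ltr_pdivrMr// ltr_pMr// ltr1n.
Qed.

(* Along the line (x + t e_1, y + t e_2) the minor x_1 y_2 - x_2 y_1 is a nonzero
   polynomial in t. *)
Lemma gram_dense (O : set TM) (g : TM -> R) p : (2 <= n)%N -> open O ->
  (forall q, O q -> {for q, continuous g}) ->
  (forall q, O q -> fxy q ^+ 2 < fxx q * fyy q -> g q = 0) -> O p -> g p = 0.
Proof.
move=> n2 oO gc g0 Op; apply/eqP/negPn/negP => gp0.
pose i := Ordinal (ltnW n2); pose j := Ordinal n2.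
have ij : i != j by [].
pose e1 : vec := ebasis R (lift ord0 i).
pose b : vec := ebasis R (lift ord0 j).
pose path (t : R) : TM := (p.1 + t *: e1, p.2 + t *: b).
have cpath : {for 0, continuous path}.
  have c (a v : vec) : {for (0 : R), continuous (fun t : R => a + t *: v)}.
    by move=> ?; apply: cvgD; [exact: cvg_cst|apply: cvgZr_tmp; exact: cvg_id].
  exact: cvg_pair (c p.1 e1) (c p.2 b).
have path0 : path 0 = p by rewrite /path !scale0r !addr0; case: (p).
have cg : {for 0, continuous (g \o path)}.
  by apply: (continuous_comp cpath); apply: gc; rewrite path0.
have n1 : \forall t \near (0 : R), g (path t) != 0.
  have : (g \o path) 0 != 0 by rewrite /= path0.
  exact: (cvgr_neq0 _ cg).
have n2' : \forall t \near (0 : R), O (path t).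
  by apply: cpath; rewrite path0; exact: open_nbhs_nbhs.
have nn : \forall t \near (0 : R), g (path t) != 0 /\ O (path t).
  exact: filterI n1 n2'.
have /nbhs_ballP[e /= e0 be] := nn.
pose x1 := p.1 0 (lift ord0 i); pose x2 := p.1 0 (lift ord0 j).
pose y1 := p.2 0 (lift ord0 i); pose y2 := p.2 0 (lift ord0 j).
pose q : {poly R} := 'X^2 + (x1 + y2) *: 'X + (x1 * y2 - x2 * y1)%:P.
have qn0 : q != 0.
  apply/eqP => /(congr1 (fun q : {poly R} => q`_2)).
  rewrite !coefD coefXn coefZ coefX coefC coef0 /= mulr0 !addr0 => /eqP.
  by rewrite oner_eq0.
have [t [t0 te]] := small_nonroot qn0 e0.
have /be[gt Ot] : ball 0 e t by rewrite -ball_normE/= sub0r normrN gtr0_norm.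
rewrite !hornerE => h1; move/negP: gt; apply; apply/eqP/g0 => //.
have E1 k : e1 0 k = (k == lift ord0 i)%:R by rewrite mxE eqxx.
have E2 k : b 0 k = (k == lift ord0 j)%:R by rewrite mxE eqxx.
clearbody e1 b; apply: (@gram_gt0 _ _ i j) => /=.
rewrite !mxE !E2 !E1 !(inj_eq lift_inj) [j == i]eq_sym (negPf ij) !eqxx /=.
by apply: contra_neq h1 => <-; rewrite /x1 /x2 /y1 /y2 /=; ring.
Qed.

End Density.

(** * Differentiation rules for smooth functions *)

Section SmoothRules.
Context {R : realType} {V : normedModType R}.
Implicit Types (O : set V) (f g : V -> R).

Lemma derive_smoothD O f g a v : smooth_on O f -> smooth_on O g -> O a ->
  'D_v (fun b => f b + g b) a = 'D_v f a + 'D_v g a.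
Proof.
move=> sf sg Oa.
by rewrite deriveD//; [exact: smooth_derivable sf Oa|exact: smooth_derivable sg Oa].
Qed.

Lemma derive_smoothB O f g a v : smooth_on O f -> smooth_on O g -> O a ->
  'D_v (fun b => f b - g b) a = 'D_v f a - 'D_v g a.
Proof.
move=> sf sg Oa.
by rewrite deriveB//; [exact: smooth_derivable sf Oa|exact: smooth_derivable sg Oa].
Qed.

Lemma derive_smoothM O f g a v : smooth_on O f -> smooth_on O g -> O a ->
  'D_v (fun b => f b * g b) a = 'D_v f a * g a + f a * 'D_v g a.
Proof.
move=> sf sg Oa.
rewrite (deriveM (smooth_derivable sf Oa) (smooth_derivable sg Oa)).
by rewrite addrC -[g a *: _]/(g a * _) [g a * _]mulrC.
Qed.

Lemma derive_smooth_sum O m (F : 'I_m -> V -> R) a v :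
  (forall i, smooth_on O (F i)) -> O a ->
  'D_v (fun b => \sum_(i < m) F i b) a = \sum_(i < m) 'D_v (F i) a.
Proof.
move=> sF Oa; rewrite (_ : (fun b => _) = \sum_(i < m) F i).
  by rewrite derive_sum => // i; exact: smooth_derivable (sF i) Oa.
by apply/funext => b; rewrite fct_sumE.
Qed.

Lemma derive_divr f (c : V -> R) p v :
  derivable f p v -> derivable c p v -> c p != 0 ->
  'D_v (fun q => f q / c q) p = 'D_v f p / c p - f p * 'D_v c p / c p ^+ 2.
Proof.
move=> df dc c0; have dV : derivable (fun q => (c q)^-1) p v by exact: derivableV.
rewrite (deriveM df dV) (deriveV c0 dc).
rewrite -[X in X + _ = _]/(f p * (- (c p) ^- 2 * 'D_v c p)) -[X in _ + X = _]/((c p)^-1 * 'D_v f p).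
by move: ('D_v f p) ('D_v c p) (f p) (c p) c0 => a b d e e0; field.
Qed.

End SmoothRules.

(** * Functions of (x^0, r, s, z) *)

Section Profile.
Context {R : realType} (I : set R) (rho : R).
Hypothesis oI : open I.
Implicit Types f g : fun4 R.

Definition Dom4 : set 'rV[R]_4 :=
  [set p : 'rV[R]_4 | I (p 0 0) /\ 0 < p 0 1 < rho /\ `|p 0 2%:R| < p 0 1].

Definition sm4 f := smooth_on Dom4 (uncurry4 f).

Lemma linear_coord (j : 'I_4) : linear (fun p : 'rV[R]_4 => p 0 j).
Proof. by move=> k p q; rewrite !mxE. Qed.

Lemma smooth_coord O (j : 'I_4) : open O -> smooth_on O (fun p : 'rV[R]_4 => p 0 j).
Proof.
by move=> oO; apply: smooth_linear oO (linear_coord j) _; exact: coord_continuous.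
Qed.

Lemma derive_coord (i j : 'I_4) (p : 'rV[R]_4) :
  'D_(delta_mx 0 i) (fun p : 'rV[R]_4 => p 0 j) p = (j == i)%:R.
Proof.
rewrite derive_linear; [by rewrite mxE eqxx|exact: linear_coord|].
exact: coord_continuous.
Qed.

Lemma open_Dom4 : open Dom4.
Proof.
have cc j : continuous (fun p : 'rV[R]_4 => p 0 j) by exact: coord_continuous.
have sm j := smooth_coord j (@openT 'rV[R]_4).
have op (f : 'rV[R]_4 -> R) : smooth_on setT f -> open [set p | 0 < f p].
  move=> sf; apply: (@open_comp _ _ f [set t | 0 < t]); last exact: open_gt.
  by move=> p _; exact: smooth_continuous sf _.
have -> : Dom4 = [set p : 'rV[R]_4 | I (p 0 0)] `&` [set p | 0 < p 0 1]
   `&` [set p | 0 < rho - p 0 1] `&` [set p | 0 < p 0 1 - p 0 2%:R]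
   `&` [set p | 0 < p 0 1 + p 0 2%:R].
  have E (b c : R) : (- b < c) = (0 < b + c) by rewrite -subr_gt0 opprK addrC.
  apply/seteqP; split => p; rewrite /Dom4 /= !subr_gt0 ltr_norml E.
    by case=> ? [/andP[? ?] /andP[? ?]].
  by case=> -[[[? ?] ?] ?] ?; do 2! split => //; exact/andP.
apply: openI; [apply: openI; [apply: openI; [apply: openI|]|]|].
- exact: (@open_comp _ _ (fun p : 'rV[R]_4 => p 0 0) I).
- exact/op/sm.
- by apply: op; apply: smoothB (@openT _) (smooth_cst _ (@openT _)) (sm _).
- by apply: op; apply: smoothB (@openT _) (sm _) (sm _).
- by apply: op; apply: smoothD (@openT _) (sm _) (sm _).
Qed.

Let dquot f (i : 'I_4) (p : 'rV[R]_4) (h : R) : R :=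
  h^-1 *: (f (h * (0 == i)%:R + p 0 0) (h * (1 == i)%:R + p 0 1)
     (h * (2%:R == i)%:R + p 0 2%:R) (h * (3%:R == i)%:R + p 0 3%:R) -
     f (p 0 0) (p 0 1) (p 0 2%:R) (p 0 3%:R)).

(** Bridge between one-variable and directional derivatives: once the coordinates not touched by the
    basis vector are simplified, both have the same difference quotient. *)
Let uncurry4_derive f (i : 'I_4) p :
  'D_(delta_mx 0 i) (uncurry4 f) p = lim (dquot f i p @ 0^').
Proof.
rewrite /derive [X in X @ _](_ : _ = dquot f i p)//.
by apply/funext => h; rewrite /uncurry4 /dquot /= !mxE.
Qed.

Lemma uncurry4_d0 f : uncurry4 (d0 f) = 'D_(delta_mx 0 0) (uncurry4 f).
Proof.
apply/funext => p; rewrite uncurry4_derive (_ : dquot f 0 p = fun h =>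
  h^-1 *: (f (h + p 0 0) (p 0 1) (p 0 2%:R) (p 0 3%:R) -
           f (p 0 0) (p 0 1) (p 0 2%:R) (p 0 3%:R)))//.
by apply/funext => h; rewrite /dquot /= mulr1 !mulr0 !add0r.
Qed.
Lemma uncurry4_dr f : uncurry4 (dr f) = 'D_(delta_mx 0 1) (uncurry4 f).
Proof.
apply/funext => p; rewrite uncurry4_derive (_ : dquot f 1 p = fun h =>
  h^-1 *: (f (p 0 0) (h + p 0 1) (p 0 2%:R) (p 0 3%:R) -
           f (p 0 0) (p 0 1) (p 0 2%:R) (p 0 3%:R)))//.
by apply/funext => h; rewrite /dquot /= mulr1 !mulr0 !add0r.
Qed.
Lemma uncurry4_ds f : uncurry4 (ds f) = 'D_(delta_mx 0 2%:R) (uncurry4 f).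
Proof.
apply/funext => p; rewrite uncurry4_derive (_ : dquot f 2%:R p = fun h =>
  h^-1 *: (f (p 0 0) (p 0 1) (h + p 0 2%:R) (p 0 3%:R) -
           f (p 0 0) (p 0 1) (p 0 2%:R) (p 0 3%:R)))//.
by apply/funext => h; rewrite /dquot /= mulr1 !mulr0 !add0r.
Qed.
Lemma uncurry4_dz f : uncurry4 (dz f) = 'D_(delta_mx 0 3%:R) (uncurry4 f).
Proof.
apply/funext => p; rewrite uncurry4_derive (_ : dquot f 3%:R p = fun h =>
  h^-1 *: (f (p 0 0) (p 0 1) (p 0 2%:R) (h + p 0 3%:R) -
           f (p 0 0) (p 0 1) (p 0 2%:R) (p 0 3%:R)))//.
by apply/funext => h; rewrite /dquot /= mulr1 !mulr0 !add0r.
Qed.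

Lemma sm4_d0 f : sm4 f -> sm4 (d0 f).
Proof. by rewrite /sm4 uncurry4_d0; exact: smooth_derive. Qed.
Lemma sm4_dr f : sm4 f -> sm4 (dr f).
Proof. by rewrite /sm4 uncurry4_dr; exact: smooth_derive. Qed.
Lemma sm4_ds f : sm4 f -> sm4 (ds f).
Proof. by rewrite /sm4 uncurry4_ds; exact: smooth_derive. Qed.
Lemma sm4_dz f : sm4 f -> sm4 (dz f).
Proof. by rewrite /sm4 uncurry4_dz; exact: smooth_derive. Qed.

Lemma sm4D f g : sm4 f -> sm4 g -> sm4 (fun a r s z => f a r s z + g a r s z).
Proof. exact: smoothD open_Dom4. Qed.
Lemma sm4B f g : sm4 f -> sm4 g -> sm4 (fun a r s z => f a r s z - g a r s z).
Proof. exact: smoothB open_Dom4. Qed.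
Lemma sm4M f g : sm4 f -> sm4 g -> sm4 (fun a r s z => f a r s z * g a r s z).
Proof. exact: smoothM open_Dom4. Qed.
Lemma sm4_cst c : sm4 (fun _ _ _ _ => c).
Proof. exact: smooth_cst open_Dom4. Qed.
Lemma sm4_r : sm4 (fun a r s z => r). Proof. exact: smooth_coord open_Dom4. Qed.
Lemma sm4_s : sm4 (fun a r s z => s). Proof. exact: smooth_coord open_Dom4. Qed.
Lemma sm4_z : sm4 (fun a r s z => z). Proof. exact: smooth_coord open_Dom4. Qed.

Definition row4 (a r s z : R) : 'rV[R]_4 := \row_i nth 0 [:: a; r; s; z] i.

Lemma uncurry4_row f a r s z : uncurry4 f (row4 a r s z) = f a r s z.
Proof. by rewrite /uncurry4 !mxE. Qed.

Lemma derive_row4_s f a r s z :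
  'D_(delta_mx 0 2%:R) (uncurry4 f) (row4 a r s z) = ds f a r s z.
Proof. by rewrite -[RHS]uncurry4_row uncurry4_ds. Qed.
Lemma derive_row4_z f a r s z :
  'D_(delta_mx 0 3%:R) (uncurry4 f) (row4 a r s z) = dz f a r s z.
Proof. by rewrite -[RHS]uncurry4_row uncurry4_dz. Qed.

Lemma row4_s a r s z : row4 a r s z 0 2%:R = s. Proof. by rewrite mxE. Qed.
Lemma row4_z a r s z : row4 a r s z 0 3%:R = z. Proof. by rewrite mxE. Qed.

Definition D4 (a r s z : R) := I a /\ 0 < r < rho /\ `|s| < r.

Lemma Dom4_row a r s z : D4 a r s z -> Dom4 (row4 a r s z).
Proof. by rewrite /Dom4 /= !mxE. Qed.

Lemma Dom4_D4 p : Dom4 p -> D4 (p 0 0) (p 0 1) (p 0 2%:R) (p 0 3%:R).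
Proof. by []. Qed.

Lemma sm4V f : (forall a r s z, D4 a r s z -> f a r s z != 0) -> sm4 f ->
  sm4 (fun a r s z => (f a r s z)^-1).
Proof. by move=> f0; apply: smoothV open_Dom4 _ => p /Dom4_D4; exact: f0. Qed.

Lemma ds_dz f a r s z : sm4 f -> D4 a r s z ->
  ds (dz f) a r s z = dz (ds f) a r s z.
Proof.
move=> sf h; have := derive_comm (delta_mx 0 3%:R) (delta_mx 0 2%:R) open_Dom4 sf (Dom4_row h).
by rewrite -(uncurry4_dz f) -(uncurry4_ds f) derive_row4_s derive_row4_z.
Qed.

Lemma dz_eq f g a r s z : D4 a r s z ->
  (forall a r s z, D4 a r s z -> f a r s z = g a r s z) ->
  dz f a r s z = dz g a r s z.
Proof.
move=> h fg; rewrite -!derive_row4_z.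
by apply: (derive_open_eq _ open_Dom4) (Dom4_row h) => p /Dom4_D4; exact: fg.
Qed.

(** [Omega] is used from here on as an operator on arbitrary f: by Euler's identity f - s f_s - z
    f_z vanishes when f is homogeneous of degree one in (s, z). *)
Lemma Omega_derive f (i : 'I_4) p : sm4 f -> Dom4 p ->
  'D_(delta_mx 0 i) (uncurry4 (Omega f)) p =
  'D_(delta_mx 0 i) (uncurry4 f) p
  - ((2%:R == i)%:R * uncurry4 (ds f) p + p 0 2%:R * 'D_(delta_mx 0 i) (uncurry4 (ds f)) p)
  - ((3%:R == i)%:R * uncurry4 (dz f) p + p 0 3%:R * 'D_(delta_mx 0 i) (uncurry4 (dz f)) p).
Proof.
move=> sf Dp.
have c j := smooth_coord j open_Dom4.
have s1 := smoothM open_Dom4 (c 2%:R) (sm4_ds sf).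
have s2 := smoothM open_Dom4 (c 3%:R) (sm4_dz sf).
rewrite (derive_smoothB _ (smoothB open_Dom4 sf s1) s2)//.
rewrite (derive_smoothB _ sf s1)//.
rewrite (derive_smoothM _ (c 2%:R) (sm4_ds sf))// (derive_smoothM _ (c 3%:R) (sm4_dz sf))//.
by rewrite !derive_coord.
Qed.

(** The first-order terms cancel, so only second derivatives are left. *)
Lemma ds_Omega f a r s z : sm4 f -> D4 a r s z ->
  ds (Omega f) a r s z = - s * ds (ds f) a r s z - z * ds (dz f) a r s z.
Proof.
move=> sf h; have := Omega_derive 2%:R sf (Dom4_row h).
rewrite !derive_row4_s !uncurry4_row row4_s row4_z => ->.
have -> : (3%:R == 2%:R :> 'I_4) = false by [].
by rewrite (eqxx (_ : 'I_4)) mul1r mul0r add0r opprD addrA subrr sub0r mulNr.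
Qed.

Lemma dz_Omega f a r s z : sm4 f -> D4 a r s z ->
  dz (Omega f) a r s z = - s * dz (ds f) a r s z - z * dz (dz f) a r s z.
Proof.
move=> sf h; have := Omega_derive 3%:R sf (Dom4_row h).
rewrite !derive_row4_z !uncurry4_row row4_s row4_z => ->.
have -> : (2%:R == 3%:R :> 'I_4) = false by [].
by rewrite (eqxx (_ : 'I_4)) mul1r mul0r add0r opprD addrA [_ - _ - dz f _ _ _ _]addrAC
  subrr sub0r mulNr.
Qed.

Lemma dz_Omega_sz f a r s z : sm4 f -> D4 a r s z ->
  dz (Omega f) a r s z = - s * ds (dz f) a r s z - z * dz (dz f) a r s z.
Proof. by move=> sf h; rewrite (ds_dz sf h) (dz_Omega sf h). Qed.

Lemma sm4_Omega f : sm4 f -> sm4 (Omega f).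
Proof.
move=> sf; apply: sm4B; [apply: sm4B => //|]; apply: sm4M.
- exact: sm4_s.
- exact: sm4_ds.
- exact: sm4_z.
- exact: sm4_dz.
Qed.

End Profile.

(** * Pairings of x and y with a fixed vector *)

Section Pairing.
Context {R : realType} {n : nat}.
Notation vec := 'rV[R]_(n.+1).
Notation TM := (vec * vec)%type.
Implicit Types (w : vec) (p v : TM).

(** [gX w] is constant on the fibres and [gY w] is linear on them: these are the explicit polynomial
    factors in y. *)
Definition gX w : TM -> R := fun q => bar_dot q.1 w.
Definition gY w : TM -> R := fun q => bar_dot q.2 w.

Lemma smooth_gX O w : open O -> smooth_on O (gX w).
Proof.
move=> oO; apply: (@smooth_bar_dot R n O (@cX R n) (fun A _ => w 0 A)) => // A.
  exact: smooth_cX.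
exact: smooth_cst.
Qed.
Lemma smooth_gY O w : open O -> smooth_on O (gY w).
Proof.
move=> oO; apply: (@smooth_bar_dot R n O (@cY R n) (fun A _ => w 0 A)) => // A.
  exact: smooth_cY.
exact: smooth_cst.
Qed.

Lemma derive_gX w p v : 'D_v (gX w) p = bar_dot v.1 w.
Proof.
rewrite derive_linear// => [k a b|]; first by rewrite /gX /= bar_dotDl bar_dotZl.
exact: smooth_continuousT (smooth_gX w openT).
Qed.
Lemma derive_gY w p v : 'D_v (gY w) p = bar_dot v.2 w.
Proof.
rewrite derive_linear// => [k a b|]; first by rewrite /gY /= bar_dotDl bar_dotZl.
exact: smooth_continuousT (smooth_gY w openT).
Qed.

End Pairing.

(** * The chart (x^0, r, s, z) and vertical derivatives in it *)

Section Region.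
Context {R : realType} {n : nat}.
Notation vec := 'rV[R]_(n.+1).
Notation TM := (vec * vec)%type.
Context {I : set R} {rho : R}.
Hypothesis oI : open I.
Implicit Types (p v : TM) (f g : fun4 R).

(** Strict Cauchy-Schwarz for the bar parts gives at once r > 0, u > 0 and |s| < r: the square roots
    are smooth and (x^0, r, s, z) lies in the open domain of [phi]. *)
Definition Reg : set TM :=
  [set p | cyl_domain I rho p.1 /\ fxy p ^+ 2 < fxx p * fyy p].

Definition fr p := bar_norm p.1.
Definition fu p := bar_norm p.2.
Definition fs p := fxy p / fu p.
Definition fz p := p.2 0 ord0 / fu p.

Lemma fr_sqr p : fr p ^+ 2 = fxx p. Proof. exact: bar_norm_sqr. Qed.
Lemma fu_sqr p : fu p ^+ 2 = fyy p. Proof. exact: bar_norm_sqr. Qed.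

Lemma Reg_xx p : Reg p -> 0 < fxx p.
Proof.
case=> _ h; rewrite lt0r bar_dot_ge0 andbT; apply/eqP => x0.
by move: h; rewrite x0 mul0r ltNge sqr_ge0.
Qed.
Lemma Reg_yy p : Reg p -> 0 < fyy p.
Proof.
case=> _ h; rewrite lt0r bar_dot_ge0 andbT; apply/eqP => x0.
by move: h; rewrite x0 mulr0 ltNge sqr_ge0.
Qed.
Lemma Reg_r p : Reg p -> 0 < fr p. Proof. by move=> /Reg_xx; rewrite sqrtr_gt0. Qed.
Lemma Reg_u p : Reg p -> 0 < fu p. Proof. by move=> /Reg_yy; rewrite sqrtr_gt0. Qed.

Lemma Reg_s p : Reg p -> `|fs p| < fr p.
Proof.
move=> Rp; have u0 := Reg_u Rp; case: Rp => _ h.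
rewrite /fs normf_div (gtr0_norm u0) ltr_pdivrMr//.
rewrite -(@ltr_pXn2r _ 2) ?nnegrE ?mulr_ge0 ?bar_norm_ge0//.
by rewrite real_normK ?num_real// exprMn fr_sqr fu_sqr.
Qed.

Lemma Reg_D4 p : Reg p -> D4 I rho (p.1 0 ord0) (fr p) (fs p) (fz p).
Proof.
move=> Rp; have s := Reg_s Rp; have r0 := Reg_r Rp.
by case: Rp => -[? ?] _; split => //; split => //; exact/andP.
Qed.

Lemma Reg_slit : Reg `<=` slit I rho.
Proof.
move=> p Rp; have yy := Reg_yy Rp; case: Rp => cM _; split => //.
apply: contraTneq yy => y0; rewrite /fyy y0 -leNgt /bar_dot big1// => i _.
by rewrite mxE mul0r.
Qed.

Lemma open_Reg : open Reg.
Proof.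
have o : open [set p : TM | 0 < fxx p * fyy p - fxy p ^+ 2].
  apply: (@open_comp _ _ (fun p : TM => fxx p * fyy p - fxy p ^+ 2) [set t | 0 < t]);
    last exact: open_gt.
  move=> p _; have oT := @openT TM; apply: (smooth_continuous (O := setT)) => //.
  apply: (smoothB oT); last exact: smoothX 2 oT (smooth_fxy oT).
  exact: smoothM oT (smooth_fxx oT) (smooth_fyy oT).
have -> : Reg = slit I rho `&` [set p : TM | 0 < fxx p * fyy p - fxy p ^+ 2].
  apply/seteqP; split => p.
    by move=> Rp; split; [exact: Reg_slit|case: Rp => _ /=; rewrite subr_gt0].
  by case=> -[? _]; rewrite /= subr_gt0.
by apply: openI => //; exact: open_slit.
Qed.

Lemma smooth_fr : smooth_on Reg fr.
Proof. exact: smooth_sqrt open_Reg Reg_xx (smooth_fxx open_Reg). Qed.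
Lemma smooth_fu : smooth_on Reg fu.
Proof. exact: smooth_sqrt open_Reg Reg_yy (smooth_fyy open_Reg). Qed.
Lemma smooth_invfu : smooth_on Reg (fun p => (fu p)^-1).
Proof. by apply: smoothV open_Reg _ smooth_fu => p /Reg_u/gt_eqF ->. Qed.
Lemma smooth_fs : smooth_on Reg fs.
Proof. exact: smoothM open_Reg (smooth_fxy open_Reg) smooth_invfu. Qed.
Lemma smooth_fz : smooth_on Reg fz.
Proof. exact: smoothM open_Reg (smooth_cY ord0 open_Reg) smooth_invfu. Qed.

Lemma derive_fr p v : Reg p -> 'D_v fr p = bar_dot p.1 v.1 / fr p.
Proof.
move=> Rp; have x0 := Reg_xx Rp; have r0 := Reg_r Rp.
have := derive_comp1 v (smooth_diff (smooth_fxx open_Reg) Rp) (is_derive1_sqrt x0).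
rewrite derive_fxx (_ : Num.sqrt \o fxx = fr)// => ->.
by rewrite -/(fr p) invfM mulrACA mulVf ?pnatr_eq0// mul1r mulrC.
Qed.

Lemma derive_fu p v : Reg p -> 'D_v fu p = bar_dot p.2 v.2 / fu p.
Proof.
move=> Rp; have x0 := Reg_yy Rp; have r0 := Reg_u Rp.
have := derive_comp1 v (smooth_diff (smooth_fyy open_Reg) Rp) (is_derive1_sqrt x0).
rewrite derive_fyy (_ : Num.sqrt \o fyy = fu)// => ->.
by rewrite -/(fu p) invfM mulrACA mulVf ?pnatr_eq0// mul1r mulrC.
Qed.

Lemma derive_divfu (f : TM -> R) p v : smooth_on Reg f -> Reg p ->
  'D_v (fun q => f q / fu q) p =
  'D_v f p / fu p - f p / fu p * bar_dot p.2 v.2 / fu p ^+ 2.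
Proof.
move=> sf Rp; have u0 := lt0r_neq0 (Reg_u Rp).
rewrite (derive_smoothM _ sf smooth_invfu)// deriveV//; last first.
  exact: smooth_derivable smooth_fu Rp.
rewrite derive_fu// -[_ *: _]/(_ * _); congr (_ + _).
move: (f p) (fu p) (bar_dot _ _) u0 => a b c u0.
by field.
Qed.

Lemma derive_fs p v : Reg p -> 'D_v fs p =
  (bar_dot v.1 p.2 + bar_dot p.1 v.2) / fu p - fs p * bar_dot p.2 v.2 / fu p ^+ 2.
Proof. by move=> Rp; rewrite (derive_divfu v (smooth_fxy open_Reg) Rp) derive_fxy. Qed.

Lemma derive_fz p v : Reg p -> 'D_v fz p =
  v.2 0 ord0 / fu p - fz p * bar_dot p.2 v.2 / fu p ^+ 2.
Proof.
by move=> Rp; rewrite (derive_divfu v (smooth_cY ord0 open_Reg) Rp) derive_cY.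
Qed.

Lemma fxyE p : Reg p -> fxy p = fs p * fu p.
Proof. by move=> /Reg_u u0; rewrite /fs divfK ?gt_eqF. Qed.
Lemma y0E p : Reg p -> p.2 0 ord0 = fz p * fu p.
Proof. by move=> /Reg_u u0; rewrite /fz divfK ?gt_eqF. Qed.

Definition pull f p := f (p.1 0 ord0) (fr p) (fs p) (fz p).

Definition chart (i : 'I_4) : TM -> R :=
  nth (fun=> 0) [:: cX ord0; fr; fs; fz] i.

Lemma pullE f p : pull f p = uncurry4 f (\row_i chart i p).
Proof. by rewrite /uncurry4 !mxE. Qed.

Lemma smooth_chart i : smooth_on Reg (chart i).
Proof.
case: i => -[|[|[|[|]]]]//= ?; [|exact: smooth_fr|exact: smooth_fs|exact: smooth_fz].
exact: smooth_cX open_Reg.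
Qed.

Lemma chart_Dom4 p : Reg p -> Dom4 I rho (\row_i chart i p).
Proof. by move=> /Reg_D4; rewrite /Dom4 /= !mxE. Qed.

Lemma smooth_pull f : sm4 I rho f -> smooth_on Reg (pull f).
Proof.
move=> sf; have oD : open (Dom4 I rho) by exact: open_Dom4.
apply: (smooth_ext open_Reg) (smooth_comp open_Reg oD chart_Dom4 smooth_chart sf).
by move=> p _; rewrite pullE.
Qed.

Lemma derive_pull f p v : sm4 I rho f -> Reg p ->
  'D_v (pull f) p = v.1 0 ord0 * pull (d0 f) p + 'D_v fr p * pull (dr f) p +
    'D_v fs p * pull (ds f) p + 'D_v fz p * pull (dz f) p.
Proof.
move=> sf Rp; rewrite (_ : pull f = fun q => uncurry4 f (\row_i chart i q)); last first.
  by apply/funext => q; exact: pullE.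
rewrite derive_comp; last 2 first.
  by move=> i; exact: smooth_diff (smooth_chart i) Rp.
  exact: smooth_diff sf (chart_Dom4 Rp).
rewrite 4!big_ord_recl big_ord0 addr0.
have -> : lift ord0 (ord0 : 'I_3) = 1 :> 'I_4 by apply/val_inj.
have -> : lift ord0 (lift ord0 (ord0 : 'I_2)) = 2%:R :> 'I_4 by apply/val_inj.
have -> : lift ord0 (lift ord0 (lift ord0 (ord0 : 'I_1))) = 3%:R :> 'I_4 by apply/val_inj.
have E0 := esym (etrans (pullE (d0 f) p) (congr1 (@^~ _) (uncurry4_d0 f))).
have Er := esym (etrans (pullE (dr f) p) (congr1 (@^~ _) (uncurry4_dr f))).
have Es := esym (etrans (pullE (ds f) p) (congr1 (@^~ _) (uncurry4_ds f))).
have Ez := esym (etrans (pullE (dz f) p) (congr1 (@^~ _) (uncurry4_dz f))).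
rewrite -(derive_cX ord0 p v) -!addrA.
exact: (congr2 +%R (congr1 ( *%R _) E0) (congr2 +%R (congr1 ( *%R _) Er)
  (congr2 +%R (congr1 ( *%R _) Es) (congr1 ( *%R _) Ez)))).
Qed.

(** A vertical vector leaves x^0 and r fixed; only s = <x, y> / u and z = y^0 / u move. *)
Lemma derive_vert f p (eta : vec) : sm4 I rho f -> Reg p ->
  'D_(0, eta) (pull f) p =
  (bar_dot p.1 eta / fu p - fs p * bar_dot p.2 eta / fu p ^+ 2) * pull (ds f) p +
  (eta 0 ord0 / fu p - fz p * bar_dot p.2 eta / fu p ^+ 2) * pull (dz f) p.
Proof.
move=> sf Rp; rewrite derive_pull// derive_fr// derive_fs// derive_fz//= mxE.
have -> : bar_dot (0 : vec) p.2 = 0 by rewrite -(scale0r p.2) bar_dotZl mul0r.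
have -> : bar_dot p.1 (0 : vec) = 0 by rewrite -(scale0r p.2) bar_dotZr mul0r.
by rewrite !mul0r !add0r.
Qed.

Lemma pull_Omega f p :
  pull (Omega f) p = pull f p - fs p * pull (ds f) p - fz p * pull (dz f) p.
Proof. by []. Qed.

(** The terms in <y, eta> coming from u, s and z combine into [Omega f], which is how [Omega] enters
    the formulas. *)
Lemma derive_u_pull f p (eta : vec) : sm4 I rho f -> Reg p ->
  'D_(0, eta) (fun q => fu q * pull f q) p =
  bar_dot p.2 eta / fu p * pull (Omega f) p + bar_dot p.1 eta * pull (ds f) p +
  eta 0 ord0 * pull (dz f) p.
Proof.
move=> sf Rp; have u0 := lt0r_neq0 (Reg_u Rp).
rewrite (derive_smoothM _ smooth_fu (smooth_pull sf) Rp) (derive_fu _ Rp) (derive_vert _ sf Rp) /=.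
rewrite pull_Omega.
move: (fu p) u0 (pull f p) (pull (ds f) p) (pull (dz f) p) (fs p) (fz p) (eta 0 ord0)
  (bar_dot p.1 eta) (bar_dot p.2 eta) => u u0 a b c s z e0 ex ey.
by field.
Qed.

Lemma derive_u2_pull f p (eta : vec) : sm4 I rho f -> Reg p ->
  'D_(0, eta) (fun q => fu q ^+ 2 * pull f q) p =
  bar_dot p.2 eta * (2 * pull f p - fs p * pull (ds f) p - fz p * pull (dz f) p) +
  fu p * (bar_dot p.1 eta * pull (ds f) p + eta 0 ord0 * pull (dz f) p).
Proof.
move=> sf Rp; have u0 := lt0r_neq0 (Reg_u Rp).
rewrite (derive_smoothM _ (smoothM open_Reg smooth_fu smooth_fu) (smooth_pull sf))//.
rewrite (derive_smoothM _ smooth_fu smooth_fu Rp) (derive_fu _ Rp) (derive_vert _ sf Rp) /=.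
move: (fu p) u0 (pull f p) (pull (ds f) p) (pull (dz f) p) (fs p) (fz p) (eta 0 ord0)
  (bar_dot p.1 eta) (bar_dot p.2 eta) => u u0 a b c s z e0 ex ey.
by field.
Qed.

End Region.

(** * Bar directions and points with prescribed coordinates *)

Section HorizontalBasis.
Context {R : realType} {n : nat}.
Notation vec := 'rV[R]_(n.+1).
Implicit Types (x y : vec) (k l : 'I_n).

Definition ebar k : vec := ebasis R (lift ord0 k).
Definition hbar x : vec := x - x 0 ord0 *: ebasis R ord0.

Lemma ebasisE A B : (ebasis R A : vec) 0 B = (B == A)%:R.
Proof. by rewrite mxE eqxx. Qed.

Lemma bar_dot_ebar x k : bar_dot x (ebar k) = x 0 (lift ord0 k).
Proof.
rewrite /bar_dot (bigD1 k)//= big1 => [|l lk]; rewrite ebasisE.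
  by rewrite eqxx mulr1 addr0.
by rewrite (inj_eq lift_inj) (negPf lk) mulr0.
Qed.

Lemma bar_dot_e0 x : bar_dot x (ebasis R ord0) = 0.
Proof. by rewrite /bar_dot big1// => l _; rewrite ebasisE mulr0. Qed.

Lemma bar_dot0 x : bar_dot x 0 = 0.
Proof. by rewrite -(scale0r x) bar_dotZr mul0r. Qed.

Lemma bar_dot0l x : bar_dot 0 x = 0.
Proof. by rewrite bar_dotC bar_dot0. Qed.

Lemma bar_dot_hbar x y : bar_dot x (hbar y) = bar_dot x y.
Proof. by rewrite /hbar -scaleNr bar_dotDr bar_dotZr bar_dot_e0 mulr0 addr0. Qed.

Lemma hbar0 x : hbar x 0 ord0 = 0.
Proof. by rewrite !mxE !eqxx mulr1 subrr. Qed.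

Lemma hbar_lift x k : hbar x 0 (lift ord0 k) = x 0 (lift ord0 k).
Proof. by rewrite !mxE mulr0 subr0. Qed.

Lemma vec_sum_ebasis x : x = \sum_A x 0 A *: ebasis R A.
Proof.
apply/rowP => B; rewrite summxE (bigD1 B)//= big1 => [|A AB]; rewrite mxE ebasisE.
  by rewrite eqxx mulr1 addr0.
by rewrite eq_sym (negPf AB) mulr0.
Qed.

(** Take x = a e_0 + r e_k1 and y = z e_0 + c e_k1 + d e_k2 with c = s / r and c^2 + d^2 = 1. The
    other bar coordinates of both vanish, so a third index gives a direction orthogonal to x and
    y. *)
Lemma exists_point (I : set R) (rho : R) a r s z k1 k2 : k1 != k2 ->
  D4 I rho a r s z ->
  exists p : vec * vec, [/\ [/\ Reg (I := I) (rho := rho) p, p.1 0 ord0 = a & fr p = r],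
    [/\ fu p = 1, fs p = s & fz p = z] &
    [/\ p.1 0 (lift ord0 k1) = r, forall k, k != k1 -> p.1 0 (lift ord0 k) = 0 &
        forall k, k != k1 -> k != k2 -> p.2 0 (lift ord0 k) = 0]].
Proof.
move=> k12 [Ia [/andP[r0 rrho] sr]].
pose c := s / r; pose d := Num.sqrt (1 - c ^+ 2).
have c1 : 0 <= 1 - c ^+ 2.
  rewrite subr_ge0 -real_normK ?num_real// exprn_ile1//.
  by rewrite /c normf_div (gtr0_norm r0) ler_pdivrMr// mul1r ltW.
have d2 : d ^+ 2 = 1 - c ^+ 2 by rewrite sqr_sqrtr.
pose x : vec := a *: ebasis R ord0 + r *: ebar k1.
pose y : vec := z *: ebasis R ord0 + c *: ebar k1 + d *: ebar k2.
have e11 k : bar_dot (ebar k) (ebar k) = 1 by rewrite bar_dot_ebar ebasisE eqxx.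
have e12 : bar_dot (ebar k2) (ebar k1) = 0.
  by rewrite bar_dot_ebar ebasisE (inj_eq lift_inj) (negPf k12).
have e21 : bar_dot (ebar k1) (ebar k2) = 0 by rewrite bar_dotC.
have e0l (w : vec) : bar_dot (ebasis R ord0) w = 0 by rewrite bar_dotC bar_dot_e0.
have xx : bar_dot x x = r ^+ 2.
  rewrite /x !(bar_dotDl, bar_dotDr, bar_dotZl, bar_dotZr, bar_dot_e0, e0l, e11).
  by ring.
have xy : bar_dot x y = s.
  rewrite /x /y !(bar_dotDl, bar_dotDr, bar_dotZl, bar_dotZr, bar_dot_e0, e0l, e11, e21).
  by rewrite /c; field; rewrite gt_eqF.
have yy : bar_dot y y = 1.
  rewrite /y !(bar_dotDl, bar_dotDr, bar_dotZl, bar_dotZr, bar_dot_e0, e0l, e11, e21, e12).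
  by rewrite -[RHS](subrK (c ^+ 2)) -d2; ring.
have frE : bar_norm x = r by rewrite /bar_norm xx sqrtr_sqr gtr0_norm.
have fuE : bar_norm y = 1 by rewrite /bar_norm yy sqrtr1.
have addE (v w : vec) B : (v + w) 0 B = v 0 B + w 0 B by rewrite mxE.
have scaE (t : R) (v : vec) B : (t *: v) 0 B = t * v 0 B by rewrite mxE.
have x0 : x 0 ord0 = a.
  by rewrite !(addE, scaE) /ebar !ebasisE /= mulr1 mulr0 addr0.
have y0 : y 0 ord0 = z.
  by rewrite !(addE, scaE) /ebar !ebasisE /= mulr1 !mulr0 !addr0.
have xk k : x 0 (lift ord0 k) = r * (k == k1)%:R.
  by rewrite !(addE, scaE) /ebar !ebasisE (inj_eq lift_inj) mulr0 add0r.
have yk k : y 0 (lift ord0 k) = c * (k == k1)%:R + d * (k == k2)%:R.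
  by rewrite !(addE, scaE) /ebar !ebasisE !(inj_eq lift_inj) mulr0 add0r.
clearbody x y.
exists (x, y); split; split => //=.
- split; first by split => /=; rewrite ?x0 ?frE.
  rewrite /fxy /fxx /fyy /= xx xy yy mulr1.
  by rewrite -real_normK ?num_real// ltr_pXn2r// ?nnegrE ?(ltW r0).
- by rewrite /fs /fxy /fu /= xy fuE divr1.
- by rewrite /fz /fu /= y0 fuE divr1.
- by rewrite xk eqxx mulr1.
- by move=> k /negPf kk; rewrite xk kk mulr0.
- by move=> k /negPf kk /negPf kk2; rewrite yk kk kk2 !mulr0 addr0.
Qed.

End HorizontalBasis.

(* Cramer's rule: U and L are the solution of the 2x2 linear system with determinant
   Lambda that the Hessian of F produces. *)
Lemma cramer (R : realFieldType) (Om w pzz pss psz a b Lm : R) : Lm != 0 ->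
  Lm = Om * pzz + w * (pss * pzz - psz ^+ 2) ->
  let U := (2 * Lm)^-1 * (a * pzz - b * psz) in
  let V := (2 * Lm)^-1 * (a * psz - b * pss) in
  let L := Om / (2 * Lm) * b - w * V in
  b = 2 * (pzz * L + w * psz * U) /\ a = 2 * (psz * L + U * (Om + w * pss)).
Proof. by move=> + LmE; rewrite LmE => L0 /=; split; field. Qed.

(** * Smoothness of U, V, L, R, T and the linear system for L and U *)

Section Quantities.
Context {R : realType} (I : set R) (rho : R) (phi : fun4 R) (n : nat).
Hypothesis oI : open I.
Hypothesis sphi : sm4 I rho phi.
Hypothesis Lam0 : forall a r s z, D4 I rho a r s z -> Lambda phi a r s z != 0.

Let Ma (f g : fun4 R) := @sm4M R I rho oI f g.
Let Ad (f g : fun4 R) := @sm4D R I rho oI f g.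
Let Su (f g : fun4 R) := @sm4B R I rho oI f g.
Let Co c := @sm4_cst R I rho oI c.
Let Cr := @sm4_r R I rho oI.
Let Cs := @sm4_s R I rho oI.
Let Cz := @sm4_z R I rho oI.

Lemma sm4_invr : sm4 I rho (fun a r s z => r^-1).
Proof. by apply: (sm4V oI _ Cr) => a r s z [_ [/andP[r0 _] _]]; rewrite gt_eqF. Qed.

Lemma sm4_vphi : sm4 I rho (vphi phi).
Proof.
exact: Ad (Ad (Ma Cz (sm4_d0 sphi)) (Ma (Ma Cs sm4_invr) (sm4_dr sphi))) (sm4_ds sphi).
Qed.

Let W : sm4 I rho (fun a r s z => r ^+ 2 - s ^+ 2).
Proof. exact: Su (Ma Cr Cr) (Ma Cs Cs). Qed.

Let sm_ss : sm4 I rho (ds (ds phi)). Proof. exact/sm4_ds/sm4_ds. Qed.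
Let sm_zz : sm4 I rho (dz (dz phi)). Proof. exact/sm4_dz/sm4_dz. Qed.
Let sm_sz : sm4 I rho (ds (dz phi)). Proof. exact/sm4_ds/sm4_dz. Qed.

Lemma sm4_Lambda : sm4 I rho (Lambda phi).
Proof.
exact: Ad (Ma (sm4_Omega oI sphi) sm_zz) (Ma W (Su (Ma sm_ss sm_zz) (Ma sm_sz sm_sz))).
Qed.

Let sm_inv : sm4 I rho (fun a r s z => (2 * Lambda phi a r s z)^-1).
Proof.
apply: (sm4V oI _ (Ma (Co 2) sm4_Lambda)) => a r s z h.
by rewrite mulf_neq0 ?pnatr_eq0// Lam0.
Qed.

Let sm_a : sm4 I rho (fun a r s z => ds (vphi phi) a r s z - 2 / r * dr phi a r s z).
Proof. exact: Su (sm4_ds sm4_vphi) (Ma (Ma (Co 2) sm4_invr) (sm4_dr sphi)). Qed.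
Let sm_b : sm4 I rho (fun a r s z => dz (vphi phi) a r s z - 2 * d0 phi a r s z).
Proof. exact: Su (sm4_dz sm4_vphi) (Ma (Co 2) (sm4_d0 sphi)). Qed.

Lemma sm4_Uf : sm4 I rho (Uf phi).
Proof. exact: Ma sm_inv (Su (Ma sm_a sm_zz) (Ma sm_b sm_sz)). Qed.
Lemma sm4_Vf : sm4 I rho (Vf phi).
Proof. exact: Ma sm_inv (Su (Ma sm_a sm_sz) (Ma sm_b sm_ss)). Qed.
Lemma sm4_Lf : sm4 I rho (Lf phi).
Proof. exact: Su (Ma (Ma (sm4_Omega oI sphi) sm_inv) sm_b) (Ma W sm4_Vf). Qed.
Lemma sm4_Rf : sm4 I rho (Rf phi n).
Proof.
exact: Su sm4_Lf (Ma (Ma Cz (Co _)) (Ad (Su (sm4_dz sm4_Lf)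
  (Ma (Ma (Co _) Cs) sm4_Uf)) (Ma W (sm4_ds sm4_Uf)))).
Qed.
Lemma sm4_Tf : sm4 I rho (Tf phi n).
Proof.
exact: Ma (Co _) (Ad (Ad (Ma (Ma (Co 3) Cs) sm4_Uf) (sm4_dz sm4_Lf)) (Ma W (sm4_ds sm4_Uf))).
Qed.

Lemma UL_system a r s z : D4 I rho a r s z ->
  dz (vphi phi) a r s z - 2 * d0 phi a r s z =
    2 * (dz (dz phi) a r s z * Lf phi a r s z +
         (r ^+ 2 - s ^+ 2) * ds (dz phi) a r s z * Uf phi a r s z) /\
  ds (vphi phi) a r s z - 2 / r * dr phi a r s z =
    2 * (ds (dz phi) a r s z * Lf phi a r s z +
         Uf phi a r s z * (Omega phi a r s z + (r ^+ 2 - s ^+ 2) * ds (ds phi) a r s z)).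
Proof. by move=> h; apply: cramer; [exact: Lam0|]. Qed.

(* L + z s U is the x^0-component of the spray modulo y, divided by u^2. *)
Definition L0f : fun4 R := fun a r s z => Lf phi a r s z + z * s * Uf phi a r s z.
(** Fixed by the requirement that F_{y^A} G^A be half of F_{x^C} y^C = u^2 [vphi]: the bracket is
    what L and U already contribute, and the part along y contributes [Pf] times [phi]. *)
Definition Pf : fun4 R := fun a r s z =>
  (2^-1 * vphi phi a r s z - (s * Uf phi a r s z * Omega phi a r s z +
    r ^+ 2 * Uf phi a r s z * ds phi a r s z + L0f a r s z * dz phi a r s z)) /
  phi a r s z.

Lemma sm4_L0f : sm4 I rho L0f.
Proof. exact: Ad sm4_Lf (Ma (Ma Cz Cs) sm4_Uf). Qed.

Hypothesis phi0 : forall a r s z, D4 I rho a r s z -> phi a r s z != 0.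

Lemma sm4_Pf : sm4 I rho Pf.
Proof.
exact: Ma (Su (Ma (Co _) sm4_vphi) (Ad (Ad (Ma (Ma Cs sm4_Uf) (sm4_Omega oI sphi))
  (Ma (Ma (Ma Cr Cr) sm4_Uf) (sm4_ds sphi))) (Ma sm4_L0f (sm4_dz sphi)))) (sm4V oI phi0 sphi).
Qed.

End Quantities.

Opaque d0 dr ds dz.

Lemma dz_L0f (R : realType) (I : set R) (rho : R) (phi : fun4 R) a r s z : open I ->
  sm4 I rho (Lf phi) -> sm4 I rho (Uf phi) -> D4 I rho a r s z ->
  dz (L0f phi) a r s z =
  dz (Lf phi) a r s z + s * Uf phi a r s z + z * s * dz (Uf phi) a r s z.
Proof.
move=> oI sL sU h; have oD : open (Dom4 I rho) by exact: open_Dom4.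
have c j : smooth_on (Dom4 I rho) (fun p : 'rV[R]_4 => p 0 j) by exact: smooth_coord.
have Dp := Dom4_row h.
have szU := smoothM oD (smoothM oD (c 3%:R) (c 2%:R)) sU.
have := derive_smoothD (delta_mx 0 3%:R) sL szU Dp.
rewrite (derive_smoothM _ (smoothM oD (c 3%:R) (c 2%:R)) sU Dp).
rewrite (derive_smoothM _ (c 3%:R) (c 2%:R) Dp) !derive_coord.
have -> : (2%:R == 3%:R :> 'I_4) = false by [].
rewrite (eqxx (_ : 'I_4)) mul1r mulr0 addr0 (row4_s a) (row4_z a).
rewrite (uncurry4_row (Uf phi)) (derive_row4_z (Lf phi)) (derive_row4_z (Uf phi)) addrA => <-.
by rewrite -(derive_row4_z (L0f phi)).
Qed.

(** A kernel vector is read off a nonzero row, as (-b, a) or (-d, c); when both rows vanish, (1, 0)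
    serves. *)
Lemma singular2 (R : fieldType) (a b c d : R) : a * d - b * c = 0 ->
  exists l q : R, [/\ (l != 0) || (q != 0), a * l + b * q = 0 & c * l + d * q = 0].
Proof.
move=> D0; have [ab|] := boolP ((a != 0) || (b != 0)).
  exists (- b), a; split; first by rewrite oppr_eq0 orbC.
    by rewrite mulrN mulrC addNr.
  by rewrite -[RHS]D0; ring.
rewrite negb_or !negbK => /andP[/eqP-> /eqP->].
have [cd|] := boolP ((c != 0) || (d != 0)).
  exists (- d), c; split; first by rewrite oppr_eq0 orbC.
    by rewrite !mul0r addr0.
  by rewrite mulrN mulrC addNr.
rewrite negb_or !negbK => /andP[/eqP-> /eqP->].
by exists 1, 0; rewrite oner_eq0 !mul0r addr0.
Qed.

(** * Quadratic and linear profiles in (s, z) *)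

Section ScalarConditions.
Context {R : realType} (I : set R) (rho : R).
Hypothesis oI : open I.
Implicit Types f : fun4 R.
Notation Dom := (Dom4 I rho).
Let oD : open Dom := open_Dom4 (rho := rho) oI.

(** Identities obtained after division by z or by s say nothing where that coordinate is 0; moving
    along its axis recovers those points by continuity. *)
Lemma smooth_eq0_extend (g : 'rV[R]_4 -> R) (j : 'I_4) : smooth_on Dom g ->
  (forall p, Dom p -> p 0 j != 0 -> g p = 0) -> forall p, Dom p -> g p = 0.
Proof.
move=> sg g0 p Dp; apply/eqP/negPn/negP => gp0.
have [pj|pj] := eqVneq (p 0 j) 0; last by rewrite g0 ?eqxx in gp0.
pose path (t : R) : 'rV[R]_4 := p + t *: delta_mx 0 j.
have cpath : {for (0 : R), continuous path}.
  by apply: cvgD; [exact: cvg_cst|apply: cvgZr_tmp; exact: cvg_id].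
have path0 : path 0 = p by rewrite /path scale0r addr0.
have cg : {for (0 : R), continuous (g \o path)}.
  by apply: (continuous_comp cpath); rewrite path0; exact: smooth_continuous sg Dp.
have n1 : \forall t \near (0 : R), g (path t) != 0.
  have : (g \o path) 0 != 0 by rewrite /= path0.
  exact: (cvgr_neq0 _ cg).
have n2 : \forall t \near (0 : R), Dom (path t).
  by apply: cpath; rewrite path0; exact: open_nbhs_nbhs.
have nn : \forall t \near (0 : R), g (path t) != 0 /\ Dom (path t).
  exact: filterI n1 n2.
have /nbhs_ballP[e /= e0 be] := nn.
have h : 0 < e / 2 by rewrite divr_gt0.
have /be[gt Dt] : ball 0 e (e / 2).
  by rewrite -ball_normE/= sub0r normrN gtr0_norm// ltr_pdivrMr// ltr_pMr// ltr1n.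
move/negP: gt; apply; apply/eqP/g0 => //.
by rewrite /path !mxE pj !eqxx /= mulr1 add0r gt_eqF.
Qed.

Lemma sm4_eq0_z f : sm4 I rho f ->
  (forall a r s z, D4 I rho a r s z -> z != 0 -> f a r s z = 0) ->
  forall a r s z, D4 I rho a r s z -> f a r s z = 0.
Proof.
move=> sf f0 a r s z h; rewrite -uncurry4_row.
apply: (smooth_eq0_extend (j := 3%:R) sf) (Dom4_row h) => p Dp.
exact: f0 (Dom4_D4 Dp).
Qed.

Lemma sm4_eq0_s f : sm4 I rho f ->
  (forall a r s z, D4 I rho a r s z -> s != 0 -> f a r s z = 0) ->
  forall a r s z, D4 I rho a r s z -> f a r s z = 0.
Proof.
move=> sf f0 a r s z h; rewrite -uncurry4_row.
apply: (smooth_eq0_extend (j := 2%:R) sf) (Dom4_row h) => p Dp.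
exact: f0 (Dom4_D4 Dp).
Qed.

Lemma ds_eq0 f a r s z : (forall a r s z, D4 I rho a r s z -> f a r s z = 0) ->
  D4 I rho a r s z -> ds f a r s z = 0.
Proof.
move=> f0 h; rewrite -derive_row4_s.
rewrite (derive_open_eq (g := fun=> 0) _ oD) ?derive_cst//; last exact: Dom4_row.
by move=> p /Dom4_D4; exact: f0.
Qed.

Lemma dz_eq0 f a r s z : (forall a r s z, D4 I rho a r s z -> f a r s z = 0) ->
  D4 I rho a r s z -> dz f a r s z = 0.
Proof.
move=> f0 h; rewrite -derive_row4_z.
rewrite (derive_open_eq (g := fun=> 0) _ oD) ?derive_cst//; last exact: Dom4_row.
by move=> p /Dom4_D4; exact: f0.
Qed.

Lemma Psi_over_z f a r s z : sm4 I rho f -> D4 I rho a r s z -> z != 0 ->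
  z * Psi (over_z f) a r s z = Omega f a r s z.
Proof.
move=> sf h z0; have Dp := Dom4_row h.
pose c := fun p : 'rV[R]_4 => p 0 3%:R.
have sc : smooth_on Dom c := smooth_coord 3%:R oD.
have cz : c (row4 a r s z) != 0 by rewrite /c row4_z.
have dc v : derivable c (row4 a r s z) v := smooth_derivable sc Dp.
have df v : derivable (uncurry4 f) (row4 a r s z) v := smooth_derivable sf Dp.
have E (i : 'I_4) : 'D_(delta_mx 0 i) (uncurry4 (over_z f)) (row4 a r s z) =
    'D_(delta_mx 0 i) (uncurry4 f) (row4 a r s z) / z - f a r s z * (3%:R == i)%:R / z ^+ 2.
  have -> : uncurry4 (over_z f) = fun p => uncurry4 f p * (c p)^-1 by [].
  rewrite (derive_divr (df _) (dc _) cz) derive_coord uncurry4_row.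
  by rewrite -[c _]/(row4 a r s z 0 3%:R) row4_z.
have Es := E 2%:R; have Ez := E 3%:R; rewrite /Psi.
rewrite (derive_row4_s (over_z f)) (derive_row4_s f) in Es.
rewrite (derive_row4_z (over_z f)) (derive_row4_z f) (eqxx (_ : 'I_4)) mulr1 in Ez.
have e32 : (3%:R == 2%:R :> 'I_4) = false by [].
rewrite e32 mulr0 mul0r subr0 in Es; move: Es Ez; rewrite /Omega.
generalize (ds (over_z f) a r s z) (dz (over_z f) a r s z) (ds f a r s z) (dz f a r s z)
  (f a r s z) => b c' d e g -> ->.
by field.
Qed.

(** The first two equations make f_s and f_z homogeneous of degree one in (s, z); the third makes
    f_z affine in z. *)
Definition quadratic_profile f := forall a r s z, D4 I rho a r s z ->
  [/\ Omega (ds f) a r s z = 0, Omega (dz f) a r s z = 0 & dz (dz (dz f)) a r s z = 0].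

Definition linear_profile f := forall a r s z, D4 I rho a r s z ->
  Omega f a r s z = 0 /\ dz (dz f) a r s z = 0.

Let isolate (s z b c : R) : s != 0 -> c = 0 -> - s * b - z * c = 0 -> b = 0.
Proof.
by move=> s0 -> /eqP; rewrite mulr0 subr0 mulf_eq0 oppr_eq0 (negPf s0) => /eqP.
Qed.

Section Linear.
Variable f : fun4 R.
Hypotheses (sf : sm4 I rho f) (lf : linear_profile f).

(** The z-derivative of [Omega f = 0] is s f_sz + z f_zz = 0, where f_zz = 0; division by s leaves
    the points s = 0 to continuity. *)
Lemma linear_sz a r s z : D4 I rho a r s z -> ds (dz f) a r s z = 0.
Proof.
apply: (sm4_eq0_s (sm4_ds (sm4_dz sf))) => {}a {}r {}s {}z h s0.
have o0 : dz (Omega f) a r s z = 0 by apply: (dz_eq0 _ h) => a' r' s' z' h'; case: (lf h').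
exact: isolate s0 (lf h).2 (etrans (esym (dz_Omega_sz oI sf h)) o0).
Qed.

(** Likewise, the s-derivative of [Omega f = 0] is s f_ss + z f_sz = 0, where now f_sz = 0. *)
Lemma linear_ss a r s z : D4 I rho a r s z -> ds (ds f) a r s z = 0.
Proof.
apply: (sm4_eq0_s (sm4_ds (sm4_ds sf))) => {}a {}r {}s {}z h s0.
have o0 : ds (Omega f) a r s z = 0 by apply: (ds_eq0 _ h) => a' r' s' z' h'; case: (lf h').
exact: isolate s0 (linear_sz h) (etrans (esym (ds_Omega oI sf h)) o0).
Qed.

End Linear.

Section Quadratic.
Variable f : fun4 R.
Hypotheses (sf : sm4 I rho f) (qf : quadratic_profile f).

Lemma quadratic_dz : linear_profile (dz f).
Proof. by move=> a r s z h; have [_ ? ?] := qf h. Qed.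

Lemma quadratic_szz a r s z : D4 I rho a r s z -> ds (dz (dz f)) a r s z = 0.
Proof. exact: linear_sz (sm4_dz sf) quadratic_dz _ _ _ _. Qed.

Lemma quadratic_zsz a r s z : D4 I rho a r s z -> dz (ds (dz f)) a r s z = 0.
Proof. by move=> h; rewrite -(ds_dz oI (sm4_dz sf) h); exact: quadratic_szz. Qed.

End Quadratic.

End ScalarConditions.

(** * Fibrewise polynomials u f and u^2 f *)

Section VerticalPolynomials.
Context {R : realType} {n : nat}.
Notation vec := 'rV[R]_(n.+1).
Notation TM := (vec * vec)%type.
Variables (I : set R) (rho : R).
Hypothesis oI : open I.
Notation Reg := (@Reg R n I rho).
Notation fr := (@fr R n). Notation fu := (@fu R n).
Notation fs := (@fs R n). Notation fz := (@fz R n).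
Notation e_ A := (ebasis R A : vec).
Implicit Types (p : TM) (e w eta : vec) (f : fun4 R) (g h : TM -> R).

Let oR : open Reg := open_Reg oI.

(* On each fibre, g is a polynomial of degree < k in y. *)
Fixpoint vdeg_lt (k : nat) (g : TM -> R) : Prop :=
  match k with
  | 0%N => forall p, Reg p -> g p = 0
  | k'.+1 => smooth_on Reg g /\ forall eta, vdeg_lt k' ('D_(0, eta) g)
  end.

Lemma vdeg_ext k g h : (forall p, Reg p -> g p = h p) -> vdeg_lt k g -> vdeg_lt k h.
Proof.
elim: k g h => [|k IH] g h gh; first by move=> g0 p Rp; rewrite -gh// g0.
move=> [sg Dg]; split; first exact: smooth_ext oR gh sg.
by move=> eta; apply: IH (Dg eta) => p Rp; exact: derive_open_eq oR gh Rp.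
Qed.

Lemma vdeg0 k : vdeg_lt k (fun=> 0).
Proof.
elim: k => [//|k IH]; split; first exact: smooth_cst.
by move=> eta; apply: vdeg_ext IH => p _; rewrite derive_cst.
Qed.

Lemma vdegD k g h : vdeg_lt k g -> vdeg_lt k h -> vdeg_lt k (fun q => g q + h q).
Proof.
elim: k g h => [|k IH] g h; first by move=> g0 h0 p Rp; rewrite g0// h0// addr0.
move=> [sg Dg] [sh Dh]; split; first exact: smoothD oR sg sh.
move=> eta; apply: vdeg_ext (IH _ _ (Dg eta) (Dh eta)) => p Rp.
by rewrite (derive_smoothD _ sg sh Rp).
Qed.

(** Each summand of the Leibniz rule lowers one of the two degrees, hence induction on [j + k]; the
    derivative of a factor of degree 0 vanishes. The successors reflect the strict bound: degrees at
    most j and k add up to at most j + k. *)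
Lemma vdegM j k g h : vdeg_lt j.+1 g -> vdeg_lt k.+1 h ->
  vdeg_lt (j + k).+1 (fun q => g q * h q).
Proof.
have [m] := ubnP (j + k); elim: m j k g h => // m IH j k g h; rewrite ltnS => jkm.
move=> Pg Ph; have [sg Dg] := Pg; have [sh Dh] := Ph.
split; first exact: smoothM oR sg sh.
move=> eta; apply: (@vdeg_ext _ (fun q => 'D_(0, eta) g q * h q + g q * 'D_(0, eta) h q)).
  by move=> p Rp; rewrite (derive_smoothM _ sg sh Rp).
apply: vdegD.
  case: j jkm Pg Dg => [|j] jkm Pg Dg.
    by apply: vdeg_ext (vdeg0 _) => p Rp; rewrite (Dg eta p Rp) mul0r.
  by apply: (IH j k) => //; exact: Dg.
case: k jkm Ph Dh => [|k] jkm Ph Dh.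
  by apply: vdeg_ext (vdeg0 _) => p Rp; rewrite (Dh eta p Rp) mulr0.
rewrite addnS; apply: (IH j k) => //; first by rewrite -addnS.
Qed.

Lemma vdeg_cst c : vdeg_lt 1 (fun=> c).
Proof. by split=> [|eta p _]; [exact: smooth_cst|rewrite derive_cst]. Qed.

Lemma vdeg_gX w : vdeg_lt 1 (gX w).
Proof. by split=> [|eta p _]; [exact: smooth_gX|rewrite derive_gX /= bar_dot0l]. Qed.

Lemma vdeg_gY w : vdeg_lt 2 (gY w).
Proof.
split=> [|eta]; first exact: smooth_gY.
by apply: vdeg_ext (vdeg_cst (bar_dot eta w)) => p _; rewrite derive_gY.
Qed.

Lemma vdeg_pull f : sm4 I rho f -> (forall a r s z, D4 I rho a r s z -> ds f a r s z = 0) ->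
  (forall a r s z, D4 I rho a r s z -> dz f a r s z = 0) -> vdeg_lt 1 (pull f).
Proof.
move=> sf fs0 fz0; split; first exact: smooth_pull.
move=> eta p Rp; rewrite (derive_vert oI _ sf Rp).
have E1 : pull (ds f) p = 0 by exact: fs0 (Reg_D4 Rp).
have E2 : pull (dz f) p = 0 by exact: fz0 (Reg_D4 Rp).
by rewrite E1 E2 !mulr0 addr0.
Qed.

Definition w1 f : TM -> R := fun q => fu q * pull f q.
Definition w2 f : TM -> R := fun q => fu q ^+ 2 * pull f q.
(** This is 2 f - s f_s - z f_z, the coefficient of <y, eta> in the vertical derivative of u^2 f.
    Its derivatives in s and z are [Omega (ds f)] and [Omega (dz f)], so the first two quadratic
    conditions say that it is constant on fibres. *)
Definition Hf f : fun4 R := fun a r s z => f a r s z + Omega f a r s z.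

Lemma smooth_w1 f : sm4 I rho f -> smooth_on Reg (w1 f).
Proof. by move=> sf; exact: smoothM oR (smooth_fu oI) (smooth_pull oI sf). Qed.
Lemma smooth_w2 f : sm4 I rho f -> smooth_on Reg (w2 f).
Proof. by move=> sf; exact: smoothM oR (smoothX 2 oR (smooth_fu oI)) (smooth_pull oI sf). Qed.
Lemma sm4_Hf f : sm4 I rho f -> sm4 I rho (Hf f).
Proof. by move=> sf; exact: (@sm4D R I rho oI f (Omega f) sf (sm4_Omega oI sf)). Qed.

Lemma derive_w1 f p eta : sm4 I rho f -> Reg p -> 'D_(0, eta) (w1 f) p =
  gY eta p / fu p * pull (Omega f) p + gX eta p * pull (ds f) p + eta 0 ord0 * pull (dz f) p.
Proof. by move=> sf Rp; rewrite (derive_u_pull oI _ sf Rp). Qed.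

Lemma derive_w2 f p eta : sm4 I rho f -> Reg p -> 'D_(0, eta) (w2 f) p =
  gY eta p * pull (Hf f) p + gX eta p * w1 (ds f) p + eta 0 ord0 * w1 (dz f) p.
Proof.
move=> sf Rp; rewrite (derive_u2_pull oI _ sf Rp) -/(gY eta p) -/(gX eta p).
have -> : pull (Hf f) p = pull f p + (pull f p - fs p * pull (ds f) p - fz p * pull (dz f) p)
  by [].
have -> : w1 (ds f) p = fu p * pull (ds f) p by [].
have -> : w1 (dz f) p = fu p * pull (dz f) p by [].
generalize (pull f p) (pull (ds f) p) (pull (dz f) p) (gY eta p) (gX eta p) (eta 0 ord0).
generalize (fu p) (fs p) (fz p) => u s z a b c d e g.
by ring.
Qed.

Lemma ds_Hf f a r s z : sm4 I rho f -> D4 I rho a r s z ->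
  ds (Hf f) a r s z = Omega (ds f) a r s z.
Proof.
move=> sf h; rewrite -(derive_row4_s (Hf f)).
rewrite (derive_smoothD (f := uncurry4 f) (g := uncurry4 (Omega f)) _ sf
  (sm4_Omega oI sf) (Dom4_row h)).
rewrite (derive_row4_s f) (derive_row4_s (Omega f)) (ds_Omega oI sf h) /Omega.
rewrite -(ds_dz oI sf h).
generalize (ds (dz f) a r s z) (ds f a r s z) (ds (ds f) a r s z) => b c d.
by ring.
Qed.

Lemma dz_Hf f a r s z : sm4 I rho f -> D4 I rho a r s z ->
  dz (Hf f) a r s z = Omega (dz f) a r s z.
Proof.
move=> sf h; rewrite -(derive_row4_z (Hf f)).
rewrite (derive_smoothD (f := uncurry4 f) (g := uncurry4 (Omega f)) _ sf
  (sm4_Omega oI sf) (Dom4_row h)).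
rewrite (derive_row4_z f) (derive_row4_z (Omega f)) (dz_Omega_sz oI sf h) /Omega.
generalize (ds (dz f) a r s z) (dz f a r s z) (dz (dz f) a r s z) => b c d.
by ring.
Qed.

(** As [Omega f] vanishes, the derivative along eta is <x, eta> f_s + eta^0 f_z, and for a linear
    profile f_s and f_z are constant on fibres. *)
Lemma vdeg_w1 f : sm4 I rho f -> linear_profile I rho f -> vdeg_lt 2 (w1 f).
Proof.
move=> sf lf; split; first exact: smooth_w1.
move=> eta.
have P1 : vdeg_lt 1 (pull (ds f)).
  apply: vdeg_pull (sm4_ds sf) _ _ => a r s z h; first exact: linear_ss sf lf _ _ _ _ h.
  by rewrite -(ds_dz oI sf h); exact: linear_sz sf lf _ _ _ _ h.
have P2 : vdeg_lt 1 (pull (dz f)).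
  apply: vdeg_pull (sm4_dz sf) _ _ => a r s z h; first exact: linear_sz sf lf _ _ _ _ h.
  by have [] := lf _ _ _ _ h.
apply: vdeg_ext (vdegD (vdegM (vdeg_gX eta) P1) (vdegM (vdeg_cst (eta 0 ord0)) P2)) => p Rp.
have O0 : pull (Omega f) p = 0 by have [] := lf _ _ _ _ (Reg_D4 Rp).
by rewrite (derive_w1 _ sf Rp) O0 mulr0 add0r.
Qed.

(** The derivative along eta is <y, eta> [Hf f] + <x, eta> u f_s + eta^0 u f_z: [Hf f] is constant
    on fibres, and u f_s, u f_z are linear because f_s and f_z have linear profiles. *)
Lemma vdeg_w2 f : sm4 I rho f -> quadratic_profile I rho f -> vdeg_lt 3 (w2 f).
Proof.
move=> sf qf; split; first exact: smooth_w2.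
move=> eta.
have P0 : vdeg_lt 1 (pull (Hf f)).
  apply: vdeg_pull (sm4_Hf sf) _ _ => a r s z h.
    by rewrite (ds_Hf sf h); have [] := qf _ _ _ _ h.
  by rewrite (dz_Hf sf h); have [] := qf _ _ _ _ h.
have P1 : vdeg_lt 2 (w1 (ds f)).
  apply: vdeg_w1 (sm4_ds sf) _ => a r s z h; split; first by have [] := qf _ _ _ _ h.
  (* The vanishing of (f_s)_zz is read off f_z, whose profile is linear, after exchanging
     derivatives. *)
  apply: etrans (quadratic_zsz oI sf qf h); apply: (dz_eq oI h) => a' r' s' z' h'.
  exact: esym (ds_dz oI sf h').
have P2 : vdeg_lt 2 (w1 (dz f)) := vdeg_w1 (sm4_dz sf) (quadratic_dz qf).
apply: vdeg_ext (vdegD (vdegD (vdegM (vdeg_gY eta) P0) (vdegM (vdeg_gX eta) P1))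
  (vdegM (vdeg_cst (eta 0 ord0)) P2)) => p Rp.
by rewrite (derive_w2 _ sf Rp).
Qed.

Lemma derive_gXM w e g p : smooth_on Reg g -> Reg p ->
  'D_(0, w) (fun q => gX e q * g q) p = gX e p * 'D_(0, w) g p.
Proof.
move=> sg Rp; rewrite (derive_smoothM _ (smooth_gX e oR) sg Rp) derive_gX /=.
by rewrite bar_dot0l mul0r add0r.
Qed.

Lemma derive_gYM w e g p : smooth_on Reg g -> Reg p ->
  'D_(0, w) (fun q => gY e q * g q) p = bar_dot w e * g p + gY e p * 'D_(0, w) g p.
Proof. by move=> sg Rp; rewrite (derive_smoothM _ (smooth_gY e oR) sg Rp) derive_gY. Qed.

Lemma e0_0 : e_ ord0 0 ord0 = 1. Proof. by rewrite ebasisE eqxx. Qed.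

Lemma derive_e0_w1 f p : sm4 I rho f -> Reg p -> 'D_(0, e_ ord0) (w1 f) p = pull (dz f) p.
Proof.
move=> sf Rp; rewrite (derive_w1 _ sf Rp) /gX /gY !bar_dot_e0 e0_0.
by rewrite !mul0r add0r mul1r add0r.
Qed.

Lemma derive_e0_w2 f p : sm4 I rho f -> Reg p -> 'D_(0, e_ ord0) (w2 f) p = w1 (dz f) p.
Proof.
move=> sf Rp; rewrite (derive_w2 _ sf Rp) /gX /gY !bar_dot_e0 e0_0.
by rewrite !mul0r add0r mul1r add0r.
Qed.

Lemma derive_e0_pull f p : sm4 I rho f -> Reg p ->
  'D_(0, e_ ord0) (pull f) p = pull (dz f) p / fu p.
Proof.
move=> sf Rp; rewrite (derive_vert oI _ sf Rp) !bar_dot_e0 e0_0.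
by rewrite !mulr0 !mul0r !subr0 mul0r add0r mul1r mulrC.
Qed.

(* y^k hidden behind [gY e] and x^k behind [gX e] vanish at p, so differentiating
   twice along e leaves only the coefficient [pull (Hf f)]. *)
Lemma derive_w_ee_w2 f p e w : sm4 I rho f -> Reg p -> e 0 ord0 = 0 ->
  bar_dot e e = 1 -> bar_dot w e = 0 -> gX e p = 0 -> gY e p = 0 ->
  'D_(0, w) ('D_(0, e) ('D_(0, e) (w2 f))) p = 'D_(0, w) (pull (Hf f)) p.
Proof.
move=> sf Rp e00 ee we Xp Yp.
have sH : smooth_on Reg (pull (Hf f)) := smooth_pull oI (sm4_Hf sf).
have sW : smooth_on Reg (w1 (ds f)) := smooth_w1 (sm4_ds sf).
have sX := smooth_gX e oR; have sY := smooth_gY e oR.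
have sH' := smooth_derive (0, e) sH; have sW' := smooth_derive (0, e) sW.
have E1 q : Reg q -> 'D_(0, e) (w2 f) q = gY e q * pull (Hf f) q + gX e q * w1 (ds f) q.
  by move=> Rq; rewrite (derive_w2 _ sf Rq) e00 mul0r addr0.
have E2 q : Reg q -> 'D_(0, e) ('D_(0, e) (w2 f)) q = (pull (Hf f) q +
    gY e q * 'D_(0, e) (pull (Hf f)) q) + gX e q * 'D_(0, e) (w1 (ds f)) q.
  move=> Rq; rewrite (derive_open_eq (0, e) oR E1 Rq).
  rewrite (derive_smoothD _ (smoothM oR sY sH) (smoothM oR sX sW) Rq).
  by rewrite (derive_gYM _ _ sH Rq) (derive_gXM _ _ sW Rq) ee mul1r.
rewrite (derive_open_eq (0, w) oR E2 Rp).
rewrite (derive_smoothD _ (smoothD oR sH (smoothM oR sY sH')) (smoothM oR sX sW') Rp).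
rewrite (derive_smoothD _ sH (smoothM oR sY sH') Rp).
rewrite (derive_gYM _ _ sH' Rp) (derive_gXM _ _ sW' Rp).
have drop (a b c d x y k : R) : x = 0 -> y = 0 -> k = 0 -> a + (k * b + y * c) + x * d = a.
  by move=> -> -> ->; rewrite !mul0r !addr0.
exact: drop Xp Yp we.
Qed.

(** Two derivatives along [e] leave [Hf f], which is therefore stationary at [p] in every direction
    orthogonal to [e]: e_0 gives (Hf f)_z = 0, and the bar part of x then gives (Hf f)_s = 0. The
    third derivative along e_0 is f_zzz / u. *)
Lemma quadratic_necessary f p e : sm4 I rho f -> Reg p -> e 0 ord0 = 0 ->
  bar_dot e e = 1 -> gX e p = 0 -> gY e p = 0 ->
  (forall w, 'D_(0, w) ('D_(0, e) ('D_(0, e) (w2 f))) p = 0) ->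
  'D_(0, e_ ord0) ('D_(0, e_ ord0) ('D_(0, e_ ord0) (w2 f))) p = 0 ->
  [/\ pull (Omega (ds f)) p = 0, pull (Omega (dz f)) p = 0 & pull (dz (dz (dz f))) p = 0].
Proof.
move=> sf Rp e00 ee Xp Yp Dw D0.
have u0 := lt0r_neq0 (Reg_u Rp); have D := Reg_D4 Rp.
have sH := sm4_Hf sf.
have divu (a : R) : a / fu p = 0 -> a = 0.
  by move=> /eqP; rewrite mulf_eq0 invr_eq0 (negPf u0) orbF => /eqP.
have Dwe w : bar_dot w e = 0 -> 'D_(0, w) (pull (Hf f)) p = 0.
  by move=> we; exact: etrans (esym (derive_w_ee_w2 sf Rp e00 ee we Xp Yp)) (Dw w).
have Hz : pull (dz (Hf f)) p = 0.
  apply: divu; apply: etrans (esym (derive_e0_pull sH Rp)) (Dwe _ _).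
  by rewrite bar_dotC bar_dot_e0.
have Hs : pull (ds (Hf f)) p = 0.
  have hX : bar_dot (hbar p.1) e = 0 by rewrite bar_dotC bar_dot_hbar bar_dotC.
  have := etrans (esym (derive_vert oI (hbar p.1) sH Rp)) (Dwe _ hX).
  move: Hz; generalize (pull (dz (Hf f)) p) (pull (ds (Hf f)) p) => b c b0.
  rewrite b0 mulr0 addr0 !bar_dot_hbar (bar_dotC p.2 p.1).
  rewrite -/(fxx p) -/(fxy p) -fr_sqr (fxyE Rp) => /eqP; rewrite mulf_eq0.
  (* The other factor is (r^2 - s^2) / u, positive because |s| < r. *)
  case/orP=> /eqP // E; exfalso.
  have sr := Reg_s Rp; have r0 := Reg_r Rp.
  have : fr p ^+ 2 - fs p ^+ 2 = 0.
    move: u0 E; generalize (fu p) (fr p) (fs p) => u r s u0 E.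
    by rewrite -[RHS](mulr0 u) -E; field.
  apply/eqP; rewrite subr_eq0 eq_sym -real_normK ?num_real// lt_eqF//.
  by rewrite ltr_pXn2r ?nnegrE ?(ltW r0).
split.
- exact: etrans (esym (ds_Hf sf D)) Hs.
- exact: etrans (esym (dz_Hf sf D)) Hz.
- apply: divu; apply: etrans (esym (derive_e0_pull (sm4_dz (sm4_dz sf)) Rp)) _.
  apply: etrans D0; apply: (derive_open_eq _ oR) Rp => q Rq.
  apply: etrans (esym (derive_e0_w1 (sm4_dz sf) Rq)) _.
  by apply: (derive_open_eq _ oR) Rq => q' Rq'; exact: esym (derive_e0_w2 sf Rq').
Qed.

End VerticalPolynomials.

(** * The Hessian of the metric and the nonvanishing of Lambda *)

Section CylindricalMetric.
Context {R : realType} {n : nat}.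
Notation vec := 'rV[R]_(n.+1).
Notation TM := (vec * vec)%type.
Variables (I : set R) (rho : R) (phi : fun4 R) (F : vec -> vec -> R).
Hypothesis n3 : (3 <= n)%N.
Hypothesis oI : open I.
Hypothesis sphi : sm4 I rho phi.
Hypothesis phi_gt0 : forall a r s z, D4 I rho a r s z -> 0 < phi a r s z.
Hypothesis FF : is_Finsler (cyl_domain I rho) F.
Hypothesis FE : forall x y, @cyl_domain R n I rho x -> bar_norm y != 0 ->
  F x y = bar_norm y * phi (x 0 ord0) (bar_norm x) (bar_dot x y / bar_norm y)
                           (y 0 ord0 / bar_norm y).
Notation Reg := (@Reg R n I rho).
Notation fr := (@fr R n). Notation fu := (@fu R n).
Notation fs := (@fs R n). Notation fz := (@fz R n).
Notation e_ A := (ebasis R A : vec).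
Implicit Types (p : TM) (zeta e w : vec).

Let oR : open Reg := open_Reg oI.
Let oS : open (slit I rho) := @open_slit R n I rho oI.
Let sF : smooth_on (slit I rho) (unc F) := smooth_unc FF.
Let sF2 : smooth_on (slit I rho) (unc (Fsq F)) := smooth_Fsq oI FF.
Let k1 : 'I_n := Ordinal (ltnW (ltnW n3)).
Let k2 : 'I_n := Ordinal (ltnW n3).

Lemma unc_F p : Reg p -> unc F p = fu p * pull phi p.
Proof.
move=> Rp; have u0 := Reg_u Rp.
by rewrite /unc FE ?gt_eqF//; case: Rp.
Qed.

(** The shape of the spray with free parameters in place of L, U and the multiple of y; it serves
    both for the spray and for a kernel vector of a degenerate Hessian. *)
Definition svec (l q P : R) p : vec :=
  (fu p ^+ 2 * (l + fz p * fs p * q)) *: ebasis R ord0 + (fu p ^+ 2 * q) *: hbar p.1 + P *: p.2.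

Lemma svec0 l q P p : Reg p ->
  svec l q P p 0 ord0 = fu p ^+ 2 * (l + fz p * fs p * q) + P * (fz p * fu p).
Proof.
move=> Rp; have addE (v w : vec) B : (v + w) 0 B = v 0 B + w 0 B by rewrite mxE.
have scaE (t : R) (v : vec) B : (t *: v) 0 B = t * v 0 B by rewrite mxE.
by rewrite /svec 2!addE 3!scaE ebasisE eqxx mulr1 hbar0 mulr0 addr0 (y0E Rp).
Qed.

Lemma bar_dot_svec l q P p w :
  bar_dot w (svec l q P p) = fu p ^+ 2 * q * bar_dot w p.1 + P * bar_dot w p.2.
Proof.
by rewrite /svec !bar_dotDr !bar_dotZr bar_dot_e0 bar_dot_hbar mulr0 add0r.
Qed.

Lemma derive_F p zeta : Reg p -> 'D_(0, zeta) (unc F) p =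
  bar_dot p.2 zeta / fu p * pull (Omega phi) p + bar_dot p.1 zeta * pull (ds phi) p +
  zeta 0 ord0 * pull (dz phi) p.
Proof.
move=> Rp; rewrite -(derive_u_pull oI _ sphi Rp).
by apply: (derive_open_eq _ oR) => // q; exact: unc_F.
Qed.

Lemma derive_F_svec p l q P : Reg p -> 'D_(0, svec l q P p) (unc F) p =
  fu p ^+ 2 * (fs p * q * pull (Omega phi) p + fr p ^+ 2 * q * pull (ds phi) p +
    (l + fz p * fs p * q) * pull (dz phi) p) + P * (fu p * pull phi p).
Proof.
move=> Rp; have u0 := lt0r_neq0 (Reg_u Rp).
rewrite derive_F// !bar_dot_svec svec0// (bar_dotC p.2 p.1).
rewrite -/(fxx p) -/(fxy p) -/(fyy p) -fr_sqr -fu_sqr (fxyE Rp) pull_Omega.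
move: (fu p) u0 (fs p) (fz p) (fr p) (pull phi p) (pull (ds phi) p) (pull (dz phi) p).
by move=> u u0 s z r a b c; field.
Qed.

Lemma derive_vert_Omega p zeta : Reg p -> 'D_(0, zeta) (pull (Omega phi)) p =
  (bar_dot p.1 zeta / fu p - fs p * bar_dot p.2 zeta / fu p ^+ 2) *
    (- fs p * pull (ds (ds phi)) p - fz p * pull (ds (dz phi)) p) +
  (zeta 0 ord0 / fu p - fz p * bar_dot p.2 zeta / fu p ^+ 2) *
    (- fs p * pull (ds (dz phi)) p - fz p * pull (dz (dz phi)) p).
Proof.
move=> Rp; have D := Reg_D4 Rp.
rewrite (derive_vert oI _ (sm4_Omega oI sphi) Rp).
exact: (congr2 +%R (congr1 ( *%R _) (ds_Omega oI sphi D))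
                   (congr1 ( *%R _) (dz_Omega_sz oI sphi D))).
Qed.

Lemma derive_vert_s p zeta : Reg p -> 'D_(0, zeta) (pull (ds phi)) p =
  (bar_dot p.1 zeta / fu p - fs p * bar_dot p.2 zeta / fu p ^+ 2) *
    pull (ds (ds phi)) p +
  (zeta 0 ord0 / fu p - fz p * bar_dot p.2 zeta / fu p ^+ 2) * pull (ds (dz phi)) p.
Proof.
move=> Rp; rewrite (derive_vert oI _ (sm4_ds sphi) Rp).
exact: (congr1 (+%R _) (congr1 ( *%R _) (esym (ds_dz oI sphi (Reg_D4 Rp))))).
Qed.

(* [svec l q P p] is frozen at p: this is the Hessian of F in y, not a derivative along
   a vector field. *)
Lemma hessian_F p l q P zeta : Reg p ->
  'D_(0, zeta) ('D_(0, svec l q P p) (unc F)) p =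
  (fu p * zeta 0 ord0 - fz p * bar_dot p.2 zeta) *
    (pull (dz (dz phi)) p * l + (fr p ^+ 2 - fs p ^+ 2) * pull (ds (dz phi)) p * q) +
  (fu p * bar_dot p.1 zeta - fs p * bar_dot p.2 zeta) *
    (pull (ds (dz phi)) p * l +
     q * (pull (Omega phi) p + (fr p ^+ 2 - fs p ^+ 2) * pull (ds (ds phi)) p)).
Proof.
move=> Rp; have u0 := lt0r_neq0 (Reg_u Rp).
set G := svec l q P p.
have sgy : smooth_on Reg (gY G) := smooth_gY G oR.
have sgx : smooth_on Reg (gX G) := smooth_gX G oR.
have sO : smooth_on Reg (pull (Omega phi)) := smooth_pull oI (sm4_Omega oI sphi).
have sS : smooth_on Reg (pull (ds phi)) := smooth_pull oI (sm4_ds sphi).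
have sZ : smooth_on Reg (pull (dz phi)) := smooth_pull oI (sm4_dz sphi).
have sgyu := smoothM oR sgy (smooth_invfu oI).
rewrite (derive_open_eq (g := fun q => gY G q / fu q * pull (Omega phi) q +
  gX G q * pull (ds phi) q + G 0 ord0 * pull (dz phi) q) _ oR)//; last first.
  by move=> q' Rq'; rewrite derive_F.
have c0 := smooth_cst (G 0 ord0) oR.
rewrite (derive_smoothD _ (smoothD oR (smoothM oR sgyu sO) (smoothM oR sgx sS))
  (smoothM oR c0 sZ))//.
rewrite (derive_smoothD _ (smoothM oR sgyu sO) (smoothM oR sgx sS))//.
rewrite (derive_smoothM _ sgyu sO)// (derive_smoothM _ sgx sS)// (derive_smoothM _ c0 sZ)//.
rewrite (derive_divfu oI _ sgy Rp) (derive_vert_Omega _ Rp) (derive_vert_s _ Rp).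
rewrite (derive_vert oI _ (sm4_dz sphi) Rp).
rewrite derive_cst derive_gY derive_gX.
rewrite /gY /gX /= bar_dot0l /G !bar_dot_svec svec0// (bar_dotC p.2 p.1).
rewrite -/(fxx p) -/(fxy p) -/(fyy p) -fr_sqr -fu_sqr (fxyE Rp)
  (bar_dotC zeta p.1) (bar_dotC zeta p.2).
generalize (pull (Omega phi) p) (pull (ds phi) p) (pull (dz phi) p)
  (pull (ds (ds phi)) p) (pull (ds (dz phi)) p) (pull (dz (dz phi)) p).
move: u0; generalize (fu p) (fs p) (fz p) (fr p) (bar_dot p.1 zeta) (bar_dot p.2 zeta)
  (zeta 0 ord0).
by move=> u s z r zx zy z0 u0 a b c pss psz pzz; field.
Qed.

Lemma vert_sum (f : TM -> R) p (w : vec) : differentiable f p ->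
  'D_(0, w) f p = \sum_B w 0 B * 'D_(0, e_ B) f p.
Proof.
move=> df; have E r : \sum_(B <- r) w 0 B *: ((0, e_ B) : TM) =
    (0, \sum_(B <- r) w 0 B *: e_ B).
  elim: r => [|B r IH]; first by rewrite !big_nil.
  by rewrite !big_cons IH; congr pair; rewrite /= scaler0 addr0.
rewrite [in LHS](vec_sum_ebasis w) -E derive_sumv//.
by apply: eq_bigr => B _; rewrite deriveZv.
Qed.

Lemma horiz_sum (f : TM -> R) p (w : vec) : differentiable f p ->
  'D_(w, 0) f p = \sum_B w 0 B * 'D_(e_ B, 0) f p.
Proof.
move=> df; have E r : \sum_(B <- r) w 0 B *: ((e_ B, 0) : TM) =
    (\sum_(B <- r) w 0 B *: e_ B, 0).
  elim: r => [|B r IH]; first by rewrite !big_nil.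
  by rewrite !big_cons IH; congr pair; rewrite /= scaler0 addr0.
rewrite [in LHS](vec_sum_ebasis w) -E derive_sumv//.
by apply: eq_bigr => B _; rewrite deriveZv.
Qed.

Lemma derive_Fsq p v : slit I rho p -> 'D_v (unc (Fsq F)) p = 2 * (unc F p * 'D_v (unc F) p).
Proof.
move=> Sp; rewrite (_ : unc (Fsq F) = fun q => unc F q * unc F q)//.
rewrite (derive_smoothM _ sF sF Sp); move: (unc F p) ('D_v _ _) => a b.
by ring.
Qed.

(** Product rule for F^2 / 2 with [G] frozen: exchanging derivatives lets the sum over B collapse
    into the single direction [G]. *)
Lemma gten_apply p (G : vec) A : slit I rho p ->
  \sum_B gten F p.1 p.2 A B * G 0 B =
  'D_(0, e_ A) (unc F) p * 'D_(0, G) (unc F) p +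
  unc F p * 'D_(0, e_ A) ('D_(0, G) (unc F)) p.
Proof.
move=> Sp.
have gE B : gten F p.1 p.2 A B * G 0 B =
    2^-1 * (G 0 B * 'D_(0, e_ A) ('D_(0, e_ B) (unc (Fsq F))) p).
  rewrite mxE -[dy A (dy B (Fsq F)) p.1 p.2]/(unc (dy A (dy B (Fsq F))) p) !unc_dy.
  by rewrite -mulrA [_ * G 0 B]mulrC.
rewrite (eq_bigr _ (fun B _ => gE B)) -mulr_sumr.
have -> : \sum_B G 0 B * 'D_(0, e_ A) ('D_(0, e_ B) (unc (Fsq F))) p =
    'D_(0, e_ A) ('D_(0, G) (unc (Fsq F))) p.
  apply: esym; apply: etrans (derive_comm (0, G) (0, e_ A) oS sF2 Sp) _.
  apply: etrans (vert_sum G (smooth_diff (smooth_derive (0, e_ A) sF2) Sp)) _.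
  apply: eq_bigr => B _.
  exact: (congr1 ( *%R (G 0 B)) (derive_comm (0, e_ A) (0, e_ B) oS sF2 Sp)).
rewrite (derive_open_eq (g := fun q => 2 * (unc F q * 'D_(0, G) (unc F) q)) _ oS) //; last first.
  by move=> q; exact: derive_Fsq.
have sG := smooth_derive (0, G) sF.
rewrite (derive_smoothM _ (smooth_cst 2 oS) (smoothM oS sF sG) Sp).
rewrite derive_cst mul0r add0r (derive_smoothM _ sF sG Sp).
by rewrite mulrA mulVf ?pnatr_eq0// mul1r.
Qed.

(** If Lambda vanished, some (l, q) != 0 would solve the homogeneous system, putting [svec l q P p]
    in the kernel of the Hessian of F. For the P that also makes dF vanish on it, the fundamental
    tensor annihilates it, so strong convexity makes it zero; independence of the bar parts then
    forces l = q = 0. *)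
Lemma Lambda_neq0 a r s z : D4 I rho a r s z -> Lambda phi a r s z != 0.
Proof.
move=> h; apply/negP => /eqP Lm0.
have [|p [[Rp p0 pr] [pu ps pz] _]] := @exists_point R n I rho a r s z k1 k2 _ h; first by [].
have ph0 : pull phi p != 0 by rewrite gt_eqF// phi_gt0//; exact: Reg_D4.
have w0 : fr p ^+ 2 - fs p ^+ 2 != 0.
  have sr := Reg_s Rp; have r0 := Reg_r Rp.
  by rewrite subr_eq0 eq_sym -real_normK ?num_real// lt_eqF// ltr_pXn2r ?nnegrE ?(ltW r0).
have LmE : pull (Omega phi) p * pull (dz (dz phi)) p + (fr p ^+ 2 - fs p ^+ 2) *
    (pull (ds (ds phi)) p * pull (dz (dz phi)) p - pull (ds (dz phi)) p ^+ 2) = 0.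
  by rewrite -p0 -pr -ps -pz in Lm0; exact: Lm0.
have [l [q [lq E1 E2]]] : exists l q : R, [/\ (l != 0) || (q != 0),
    pull (dz (dz phi)) p * l + (fr p ^+ 2 - fs p ^+ 2) * pull (ds (dz phi)) p * q = 0 &
    pull (ds (dz phi)) p * l + q * (pull (Omega phi) p +
      (fr p ^+ 2 - fs p ^+ 2) * pull (ds (ds phi)) p) = 0].
  move: LmE; generalize (fr p ^+ 2 - fs p ^+ 2) (pull (dz (dz phi)) p)
    (pull (ds (dz phi)) p) (pull (ds (ds phi)) p) (pull (Omega phi) p) => w b c d e LmE.
  have Dt : b * (e + w * d) - w * c * c = 0 by rewrite -[RHS]LmE; ring.
  have [l [q [lq E1 E2]]] := singular2 Dt.
  by exists l, q; split => //; rewrite mulrC -E2; ring.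
pose c := fs p * q * pull (Omega phi) p + fr p ^+ 2 * q * pull (ds phi) p +
    (l + fz p * fs p * q) * pull (dz phi) p.
(* At this point u = 1, and dF takes the value c + P [phi] on the vector. *)
pose P := - c / pull phi p.
have FG : 'D_(0, svec l q P p) (unc F) p = 0.
  rewrite (derive_F_svec _ _ _ Rp) -/c pu expr1n !mul1r /P divfK//.
  by rewrite subrr.
have HG zeta : 'D_(0, zeta) ('D_(0, svec l q P p) (unc F)) p = 0.
  apply: etrans (hessian_F l q P zeta Rp) _.
  have drop (x1 x2 x3 x4 : R) : x2 = 0 -> x4 = 0 -> x1 * x2 + x3 * x4 = 0.
    by move=> -> ->; rewrite !mulr0 addr0.
  exact: drop E1 E2.
have [_ _ _ pd] := FF.
have Sp := Reg_slit Rp.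
have [G0|G0] := eqVneq (svec l q P p) 0; last first.
  have := pd p.1 p.2 Sp.1 Sp.2 _ G0; rewrite big1 ?ltxx// => A _.
  transitivity (svec l q P p 0 A * \sum_B gten F p.1 p.2 A B * svec l q P p 0 B).
    by rewrite mulr_sumr; apply: eq_bigr => B _; rewrite mulrAC mulrC.
  by rewrite gten_apply// FG HG !mulr0 addr0 mulr0.
have Ew v : q * bar_dot v p.1 + P * bar_dot v p.2 = 0.
  have := bar_dot_svec l q P p v.
  by rewrite G0 bar_dot0 pu expr1n mul1r => <-.
have Ex := Ew p.1; have Ey := Ew p.2.
rewrite (bar_dotC p.2 p.1) -/(fxx p) -/(fxy p) -fr_sqr (fxyE Rp) pu mulr1 in Ex Ey.
rewrite -/(fyy p) -fu_sqr pu expr1n mulr1 in Ey.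
(* Pairing the zero vector with the bar parts of x and y gives two equations; eliminating P leaves q
   (r^2 - s^2) = 0. *)
have q0 : q = 0.
  apply: (mulIf w0); rewrite mul0r; move: Ex Ey; clearbody P.
  generalize (fr p) (fs p) => r' s' Ex Ey.
  have PE : P = - (q * s') by apply/eqP; rewrite -addr_eq0 addrC Ey.
  by rewrite -Ex PE; ring.
have P0 : P = 0 by move: Ey; rewrite q0 mul0r add0r.
have := svec0 l q P Rp; rewrite G0 mxE pu P0 q0 expr1n !mul0r mulr0 !addr0 mul1r => l0.
by move: lq; rewrite -l0 q0 eqxx.
Qed.

Let Lam0 := Lambda_neq0.
Let phi0 a r s z (h : D4 I rho a r s z) : phi a r s z != 0.
Proof. by rewrite gt_eqF// phi_gt0. Qed.
Let sU : sm4 I rho (Uf phi) := sm4_Uf oI sphi Lam0.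
Let sL : sm4 I rho (Lf phi) := sm4_Lf oI sphi Lam0.
Let sL0 : sm4 I rho (L0f phi) := sm4_L0f oI sphi Lam0.
Let sP : sm4 I rho (Pf phi) := sm4_Pf oI sphi Lam0 phi0.
Let sv : sm4 I rho (vphi phi) := sm4_vphi oI sphi.

(** * The geodesic coefficients *)

Lemma derive_F_horiz p (xi : vec) : Reg p -> 'D_(xi, 0) (unc F) p =
  fu p * (xi 0 ord0 * pull (d0 phi) p + bar_dot p.1 xi / fr p * pull (dr phi) p) +
  bar_dot xi p.2 * pull (ds phi) p.
Proof.
move=> Rp; have u0 := lt0r_neq0 (Reg_u Rp); have r0 := lt0r_neq0 (Reg_r Rp).
rewrite (derive_open_eq (g := fun q => fu q * pull phi q) _ oR)//; last first.
  by move=> q Rq; apply: (unc_F Rq).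
rewrite (derive_smoothM _ (smooth_fu oI) (smooth_pull oI sphi) Rp).
rewrite (derive_fu oI _ Rp) (derive_pull oI _ sphi Rp).
rewrite (derive_fr oI _ Rp) (derive_fs oI _ Rp) (derive_fz oI _ Rp) /=.
rewrite !bar_dot0 mxE.
generalize (pull phi p) (pull (d0 phi) p) (pull (dr phi) p) (pull (ds phi) p) (pull (dz phi) p).
move: u0 r0; generalize (fu p) (fs p) (fz p) (fr p) (bar_dot p.1 xi) (bar_dot xi p.2) (xi 0 ord0).
by move=> u s z r x1 x2 x0 u0 r0 a b c d e; field; rewrite r0 u0.
Qed.

Lemma derive_F_horiz_y p : Reg p -> 'D_(p.2, 0) (unc F) p = fu p ^+ 2 * pull (vphi phi) p.
Proof.
move=> Rp; have r0 := lt0r_neq0 (Reg_r Rp).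
rewrite derive_F_horiz// -/(fxy p) -/(fyy p) -fu_sqr (fxyE Rp) (y0E Rp).
have -> : pull (vphi phi) p =
  fz p * pull (d0 phi) p + fs p / fr p * pull (dr phi) p + pull (ds phi) p by [].
generalize (pull (d0 phi) p) (pull (dr phi) p) (pull (ds phi) p).
move: r0; generalize (fu p) (fs p) (fz p) (fr p).
by move=> u s z r r0 a b c; field.
Qed.

(** Here (F^2)_{x^C} y^C = 2 F u^2 [vphi]. Differentiating it in y^A also hits the factor y^C and
    produces one more (F^2)_{x^A}, hence the coefficient 2 of the last term. *)
Lemma horiz_derivative_Fsq p A : Reg p ->
  \sum_C dx C (dy A (Fsq F)) p.1 p.2 * p.2 0 C - dx A (Fsq F) p.1 p.2 =
  2 * 'D_(0, e_ A) (fun q => unc F q * (fu q ^+ 2 * pull (vphi phi) q)) p -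
  2 * 'D_(e_ A, 0) (unc (Fsq F)) p.
Proof.
move=> Rp; have Sp := Reg_slit Rp.
pose h C := 'D_(e_ C, 0) (unc (Fsq F)).
have sh C : smooth_on (slit I rho) (h C) by exact: smooth_derive.
have sm : smooth_on Reg (fun q => unc F q * (fu q ^+ 2 * pull (vphi phi) q)).
  apply: (smoothM oR); first exact: smooth_sub oS oR (@Reg_slit _ _ _ _) sF.
  exact: smoothM oR (smoothX 2 oR (smooth_fu oI)) (smooth_pull oI sv).
have -> : 2 * 'D_(0, e_ A) (fun q => unc F q * (fu q ^+ 2 * pull (vphi phi) q)) p =
    'D_(0, e_ A) (fun q => \sum_C cY C q * h C q) p.
  have h2 := derive_smoothM (0, e_ A) (smooth_cst 2 oR) sm Rp.
  rewrite derive_cst mul0r add0r in h2; rewrite -h2.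
  apply: derive_open_eq oR _ Rp => q Rq; have Sq := Reg_slit Rq.
  transitivity ('D_(q.2, 0) (unc (Fsq F)) q).
    by rewrite (derive_Fsq _ Sq) (derive_F_horiz_y Rq).
  exact: horiz_sum q.2 (smooth_diff sF2 Sq).
rewrite (derive_smooth_sum _ (fun C => smoothM oS (smooth_cY C oS) (sh C)) Sp).
have dxdy C : dx C (dy A (Fsq F)) p.1 p.2 = 'D_(0, e_ A) (h C) p.
  transitivity (unc (dx C (dy A (Fsq F))) p); first by [].
  rewrite unc_dx unc_dy; exact: derive_comm oS sF2 Sp.
have E C : 'D_(0, e_ A) (fun q => cY C q * h C q) p =
    (C == A)%:R * h C p + dx C (dy A (Fsq F)) p.1 p.2 * p.2 0 C.
  rewrite (derive_smoothM _ (smooth_cY C oS) (sh C) Sp) derive_cY dxdy [in LHS]ebasisE.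
  by rewrite -[cY C p]/(p.2 0 C) [X in _ + X]mulrC.
rewrite (eq_bigr _ (fun C _ => E C)) big_split /=.
have -> : \sum_C (C == A)%:R * h C p = h A p.
  rewrite (bigD1 A)//= eqxx mul1r big1 ?addr0// => C CA.
  by rewrite (negPf CA) mul0r.
rewrite -[dx A _ _ _]/(unc (dx A (Fsq F)) p) unc_dx -/(h A).
by rewrite mulr_natl mulr2n [h A p + _]addrC opprD addrA addrK.
Qed.

Definition spray p : vec :=
  svec (pull (Lf phi) p) (pull (Uf phi) p) (fu p * pull (Pf phi) p) p.

Lemma derive_F_spray p : Reg p ->
  'D_(0, spray p) (unc F) p = 2^-1 * (fu p ^+ 2 * pull (vphi phi) p).
Proof.
move=> Rp; rewrite (derive_F_svec _ _ _ Rp).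
have PE : pull (Pf phi) p = (2^-1 * pull (vphi phi) p -
  (fs p * pull (Uf phi) p * pull (Omega phi) p + fr p ^+ 2 * pull (Uf phi) p * pull (ds phi) p +
   (pull (Lf phi) p + fz p * fs p * pull (Uf phi) p) * pull (dz phi) p)) / pull phi p by [].
have ph0 : pull phi p != 0 by apply: phi0; exact: Reg_D4.
rewrite PE; move: ph0; generalize (pull phi p) (pull (Lf phi) p) (pull (Uf phi) p)
  (pull (vphi phi) p) (pull (Omega phi) p) (pull (ds phi) p) (pull (dz phi) p).
generalize (fu p) (fs p) (fz p) (fr p) => u s z r a b c d e f g a0.
by field.
Qed.

Let sub_eq_add (a b c : R) : a - b = c -> a = b + c.
Proof. by move=> <-; rewrite addrC subrK. Qed.

(** [hessian_F] splits along u zeta^0 - z <y, zeta> and u <x, zeta> - s <y, zeta>; matching the two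
    coefficients with the right-hand side is precisely [UL_system]. *)
Lemma hessian_F_spray p zeta : Reg p ->
  'D_(0, zeta) ('D_(0, spray p) (unc F)) p =
  2^-1 * 'D_(0, zeta) (fun q => fu q ^+ 2 * pull (vphi phi) q) p - 'D_(zeta, 0) (unc F) p.
Proof.
move=> Rp; have r0 := lt0r_neq0 (Reg_r Rp).
rewrite (hessian_F _ _ _ _ Rp) (derive_u2_pull oI _ sv Rp) (derive_F_horiz _ Rp).
have [Ez Es] := UL_system Lam0 (Reg_D4 Rp).
have {}Ez : pull (dz (vphi phi)) p = 2 * pull (d0 phi) p +
  2 * (pull (dz (dz phi)) p * pull (Lf phi) p +
       (fr p ^+ 2 - fs p ^+ 2) * pull (ds (dz phi)) p * pull (Uf phi) p).
  by apply: sub_eq_add; exact: Ez.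
have {}Es : pull (ds (vphi phi)) p = 2 / fr p * pull (dr phi) p +
  2 * (pull (ds (dz phi)) p * pull (Lf phi) p + pull (Uf phi) p * (pull (Omega phi) p +
       (fr p ^+ 2 - fs p ^+ 2) * pull (ds (ds phi)) p)).
  by apply: sub_eq_add; exact: Es.
move: Ez Es; generalize (pull (dz (vphi phi)) p) (pull (ds (vphi phi)) p) => vz vs -> ->.
rewrite (bar_dotC zeta p.2).
have -> : pull (vphi phi) p =
  fz p * pull (d0 phi) p + fs p / fr p * pull (dr phi) p + pull (ds phi) p by [].
generalize (pull (d0 phi) p) (pull (dr phi) p) (pull (ds phi) p) (pull (Lf phi) p)
  (pull (Uf phi) p) (pull (Omega phi) p) (pull (dz (dz phi)) p) (pull (ds (ds phi)) p)
  (pull (ds (dz phi)) p).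
move: r0; generalize (fu p) (fs p) (fz p) (fr p) (bar_dot p.1 zeta) (bar_dot p.2 zeta)
  (zeta 0 ord0).
by move=> u s z r z1 z2 z0 r0 a b c d e f g h i; field.
Qed.

(** The inverse of g is never computed: g applied to the candidate is evaluated through
    [gten_apply], where dF and the Hessian of F on [spray p] are known, and compared with the
    bracket in [geod]. *)
Lemma geod_spray p A : Reg p -> geod F A p.1 p.2 = spray p 0 A.
Proof.
move=> Rp; have Sp := Reg_slit Rp.
have gu := gten_unit FF Sp.
pose G : 'cV[R]_(n.+1) := \col_B spray p 0 B.
pose E : 'cV[R]_(n.+1) := \col_B (\sum_C dx C (dy B (Fsq F)) p.1 p.2 * p.2 0 C
   - dx B (Fsq F) p.1 p.2).
have gE : gten F p.1 p.2 *m G = 4^-1 *: E.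
  apply/colP => B; rewrite [RHS]mxE [X in _ * X]mxE (horiz_derivative_Fsq _ Rp).
  rewrite [LHS]mxE (eq_bigr (fun C => gten F p.1 p.2 B C * spray p 0 C)); last first.
    by move=> C _; rewrite [G _ _]mxE.
  rewrite (gten_apply _ _ Sp) (derive_F_spray Rp) (hessian_F_spray _ Rp).
  rewrite (derive_Fsq _ Sp).
  rewrite (derive_smoothM _ (smooth_sub oS oR (@Reg_slit _ _ _ _) sF)
    (smoothM oR (smoothX 2 oR (smooth_fu oI)) (smooth_pull oI sv)) Rp).
  rewrite [X in _ = 4^-1 * (2 * (_ + _ * X) - _)](_ : _ =
    'D_(0, e_ B) (fun q => fu q ^+ 2 * pull (vphi phi) q) p)//.
  generalize (pull (vphi phi) p) (fu p) ('D_(0, e_ B) (unc F) p) ('D_(e_ B, 0) (unc F) p)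
    ('D_(0, e_ B) (fun q => fu q ^+ 2 * pull (vphi phi) q) p) (unc F p).
  by move=> a b c d e f; field.
transitivity (G A 0); last by rewrite mxE.
rewrite -(mulKmx gu G) gE -scalemxAr [RHS]mxE /geod; congr (_ * _).
by rewrite mxE; apply: eq_bigr => B _; rewrite [E _ _]mxE.
Qed.

(** * Components of the projective spray and sufficiency *)

Let sR : sm4 I rho (Rf phi n) := sm4_Rf n oI sphi Lam0.
Let sT : sm4 I rho (Tf phi n) := sm4_Tf n oI sphi Lam0.

Let f1 := fun q : TM => fu q ^+ 2 * pull (L0f phi) q.
Let f2 := fun q : TM => fu q ^+ 2 * pull (Uf phi) q.
Let f3 := fun q : TM => fu q * pull (Pf phi) q.
Let su2 : smooth_on Reg (fun q : TM => fu q ^+ 2) := smoothX 2 oR (smooth_fu oI).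
Let sf1 : smooth_on Reg f1 := smoothM oR su2 (smooth_pull oI sL0).
Let sf2 : smooth_on Reg f2 := smoothM oR su2 (smooth_pull oI sU).
Let sf3 : smooth_on Reg f3 := smoothM oR (smooth_fu oI) (smooth_pull oI sP).

Lemma unc_geod A p : Reg p -> unc (geod F A) p =
  (A == ord0)%:R * f1 p + f2 p * hbar p.1 0 A + f3 p * p.2 0 A.
Proof.
move=> Rp; rewrite /unc (geod_spray _ Rp) /spray /svec.
have addE (v w : vec) B : (v + w) 0 B = v 0 B + w 0 B by rewrite mxE.
have scaE (t : R) (v : vec) B : (t *: v) 0 B = t * v 0 B by rewrite mxE.
rewrite 2!addE 3!scaE ebasisE [_ * (A == _)%:R]mulrC.
by [].
Qed.

Lemma smooth_hbar A : smooth_on Reg (fun q : TM => hbar q.1 0 A).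
Proof.
have c := smooth_cst ((A == ord0)%:R : R) oR.
apply: (smooth_ext oR) (smoothB oR (smooth_cX A oR) (smoothM oR (smooth_cX ord0 oR) c)) => q _.
by rewrite /hbar /cX !mxE eqxx.
Qed.

Lemma derive_hbar A p zeta : Reg p -> 'D_(0, zeta) (fun q : TM => hbar q.1 0 A) p = 0.
Proof.
move=> Rp; have c := smooth_cst ((A == ord0)%:R : R) oR.
rewrite (derive_open_eq (g := fun q => cX A q - cX ord0 q * (A == ord0)%:R) _ oR)//; last first.
  by move=> q _; rewrite /hbar /cX !mxE eqxx.
rewrite (derive_smoothB _ (smooth_cX A oR) (smoothM oR (smooth_cX ord0 oR) c) Rp).
rewrite (derive_smoothM _ (smooth_cX ord0 oR) c Rp) !derive_cX derive_cst /=.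
by rewrite !mxE mul0r mulr0 addr0 subr0.
Qed.

(** The part along y gives n + 1 copies of [f3] and one more by Euler's identity. Divided by u, the
    part along x gives 2 s U + (r^2 - s^2) U_s - s z U_z and the part along e_0 gives L_z + s U + s
    z U_z; their sum is (n + 2) T, which explains the 3 in T. *)
Lemma divergence_geod p : Reg p -> \sum_(E < n.+1) dy E (geod F E) p.1 p.2 =
  n.+2%:R * (fu p * pull (Tf phi n) p + f3 p).
Proof.
move=> Rp; have u0 := lt0r_neq0 (Reg_u Rp).
have dE E : dy E (geod F E) p.1 p.2 = (E == ord0)%:R * 'D_(0, e_ E) f1 p +
    hbar p.1 0 E * 'D_(0, e_ E) f2 p + p.2 0 E * 'D_(0, e_ E) f3 p + f3 p.
  rewrite -[dy E _ _ _]/(unc (dy E (geod F E)) p) unc_dy.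
  rewrite (derive_open_eq (g := fun p => (E == ord0)%:R * f1 p + f2 p * hbar p.1 0 E +
    f3 p * cY E p) _ oR)//; last by move=> q; exact: unc_geod.
  have c := smooth_cst ((E == ord0)%:R : R) oR.
  have s1 := smoothM oR c sf1.
  have s2 := smoothM oR sf2 (smooth_hbar E).
  have s3 := smoothM oR sf3 (smooth_cY E oR).
  rewrite (derive_smoothD _ (smoothD oR s1 s2) s3 Rp) (derive_smoothD _ s1 s2 Rp).
  rewrite (derive_smoothM _ c sf1 Rp) (derive_smoothM _ sf2 (smooth_hbar E) Rp).
  rewrite (derive_smoothM _ sf3 (smooth_cY E oR) Rp) derive_cst (derive_hbar _ _ Rp) derive_cY.
  have e1 : ((0, e_ E) : TM).2 0 E = 1 by rewrite /= ebasisE eqxx.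
  rewrite e1 -[cY E p]/(p.2 0 E).
  by rewrite mul0r mulr0 add0r addr0 mulr1 ![_ * _ 0 E]mulrC addrA.
rewrite (eq_bigr _ (fun E _ => dE E)) !big_split /= sumr_const card_ord.
rewrite -(vert_sum (hbar p.1) (smooth_diff sf2 Rp)) -(vert_sum p.2 (smooth_diff sf3 Rp)).
have -> : \sum_(E < n.+1) (E == ord0)%:R * 'D_(0, e_ E) f1 p = 'D_(0, e_ ord0) f1 p.
  rewrite (bigD1 ord0)//= mul1r big1 ?addr0// => C CA.
  by rewrite (negPf CA) mul0r.
rewrite (derive_u2_pull oI _ sL0 Rp) (derive_u2_pull oI _ sU Rp) (derive_u_pull oI _ sP Rp).
have e1 : e_ ord0 0 ord0 = 1 by rewrite ebasisE eqxx.
rewrite !bar_dot_e0 !bar_dot_hbar hbar0 e1 (bar_dotC p.2 p.1).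
rewrite -/(fxx p) -/(fxy p) -/(fyy p) -fr_sqr -fu_sqr (fxyE Rp) (y0E Rp) pull_Omega.
have Lz : pull (dz (L0f phi)) p = pull (dz (Lf phi)) p + fs p * pull (Uf phi) p +
    fz p * fs p * pull (dz (Uf phi)) p by exact: (dz_L0f oI sL sU (Reg_D4 Rp)).
have TE : n.+2%:R * pull (Tf phi n) p = 3 * fs p * pull (Uf phi) p + pull (dz (Lf phi)) p +
    (fr p ^+ 2 - fs p ^+ 2) * pull (ds (Uf phi)) p.
  have n0 : n.+2%:R != 0 :> R by rewrite pnatr_eq0.
  exact: (mulVKf n0).
rewrite -[f3 p]/(fu p * pull (Pf phi) p).
move: u0 Lz TE.
generalize (pull (dz (L0f phi)) p) (pull (Tf phi n) p).
generalize (pull (L0f phi) p) (pull (ds (L0f phi)) p) (pull (dz (Lf phi)) p)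
  (pull (Uf phi) p) (pull (ds (Uf phi)) p) (pull (dz (Uf phi)) p)
  (pull (Pf phi) p) (pull (ds (Pf phi)) p) (pull (dz (Pf phi)) p).
generalize (fu p) (fs p) (fz p) (fr p).
move=> u s z r a b c d e f g h i l t u0 -> TE.
rewrite [n.+2%:R * _]mulrDr [n.+2%:R * (u * t)]mulrCA TE -natr1.
by generalize (n.+1%:R : R) => m; field.
Qed.

(** The multiple P of y cancels. The 0-component carries L + z s U - z T, and this is R, whose
    coefficient n - 1 is (n + 2) - 3. *)
Lemma hatG_Reg A p : Reg p -> unc (hatG F A) p =
  (A == ord0)%:R * (fu p ^+ 2 * pull (Rf phi n) p) +
  hbar p.1 0 A * (fu p ^+ 2 * pull (Uf phi) p) - hbar p.2 0 A * (fu p * pull (Tf phi n) p).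
Proof.
move=> Rp; rewrite /unc /hatG (divergence_geod Rp).
rewrite -[geod F A _ _]/(unc (geod F A) p) (unc_geod _ Rp).
rewrite (mulrA (n.+2%:R)^-1) mulVf ?pnatr_eq0// mul1r.
have n0 : n.+2%:R != 0 :> R by rewrite pnatr_eq0.
(* The predecessor in R is truncated, so n >= 1 is used to read it as N - 1. *)
have [N [n1 n2]] : exists N : R, n.-1%:R = N - 1 /\ n.+2%:R = N + 2.
  by exists n%:R; rewrite -subn1 natrB ?(leq_trans _ n3)// -addn2 natrD.
have RE : pull (Rf phi n) p = pull (L0f phi) p - fz p * pull (Tf phi n) p.
  have -> : pull (Rf phi n) p = pull (Lf phi) p - fz p / (n.+2%:R) *
    (pull (dz (Lf phi)) p - (n.-1)%:R * fs p * pull (Uf phi) p +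
     (fr p ^+ 2 - fs p ^+ 2) * pull (ds (Uf phi)) p) by [].
  have -> : pull (Tf phi n) p = (n.+2%:R)^-1 * (3 * fs p * pull (Uf phi) p +
    pull (dz (Lf phi)) p + (fr p ^+ 2 - fs p ^+ 2) * pull (ds (Uf phi)) p) by [].
  have -> : pull (L0f phi) p = pull (Lf phi) p + fz p * fs p * pull (Uf phi) p by [].
  rewrite n1 n2; rewrite n2 in n0.
  generalize (pull (dz (Lf phi)) p) (pull (Uf phi) p) (pull (ds (Uf phi)) p) (pull (Lf phi) p).
  by generalize (fs p) (fz p) (fr p) => s z r a b c d; field.
rewrite RE /f1 /f2 /f3.
have yE : p.2 0 A = hbar p.2 0 A + (A == ord0)%:R * (fz p * fu p).
  by rewrite /hbar !mxE eqxx -(y0E Rp) mulrC subrK.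
rewrite yE; generalize (pull (L0f phi) p) (pull (Uf phi) p) (pull (Pf phi) p) (pull (Tf phi n) p).
generalize (hbar p.1 0 A) (hbar p.2 0 A) (fu p) (fz p) ((A == ord0)%:R : R).
move=> h1 h2 u z d a b c e.
ring.
Qed.

Lemma hatG0 p : Reg p -> unc (hatG F ord0) p = w2 (Rf phi n) p.
Proof.
move=> Rp; rewrite (hatG_Reg _ Rp) !hbar0 eqxx.
by rewrite !mul0r addr0 subr0 mul1r.
Qed.

Lemma hatG_lift k p : Reg p -> unc (hatG F (lift ord0 k)) p =
  gX (ebar k) p * w2 (Uf phi) p - gY (ebar k) p * w1 (Tf phi n) p.
Proof.
move=> Rp; rewrite (hatG_Reg _ Rp) !hbar_lift.
by rewrite /gX /gY !bar_dot_ebar mul0r add0r.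
Qed.

Lemma vdeg_hatG A : quadratic_profile I rho (Uf phi) -> quadratic_profile I rho (Rf phi n) ->
  linear_profile I rho (Tf phi n) -> vdeg_lt I rho 3 (unc (hatG F A)).
Proof.
move=> qU qR lT; case: (unliftP ord0 A) => [k ->|->]; last first.
  by apply: (vdeg_ext oI) (vdeg_w2 oI sR qR) => p Rp; rewrite (hatG0 Rp).
have d1 : vdeg_lt I rho 3 (fun q => gX (ebar k) q * w2 (Uf phi) q).
  exact: (vdegM oI (vdeg_gX rho oI (ebar k)) (vdeg_w2 oI sU qU)).
have d2 : vdeg_lt I rho 3 (fun q => - 1 * (gY (ebar k) q * w1 (Tf phi n) q)).
  have d3 : vdeg_lt I rho 3 (fun q => gY (ebar k) q * w1 (Tf phi n) q).
    exact: (vdegM oI (vdeg_gY rho oI (ebar k)) (vdeg_w1 oI sT lT)).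
  have c1 : vdeg_lt I rho 1 (fun _ : TM => - 1) by exact: vdeg_cst.
  exact: (vdegM oI c1 d3).
apply: (vdeg_ext oI) (vdegD oI d1 d2) => p Rp.
by rewrite (hatG_lift k Rp) mulN1r.
Qed.

Lemma douglas_sufficient : quadratic_profile I rho (Uf phi) ->
  quadratic_profile I rho (Rf phi n) -> linear_profile I rho (Tf phi n) ->
  vanishing_Douglas (cyl_domain I rho) F.
Proof.
move=> qU qR lT x y xM y0 A B C D.
have sD := smooth_douglas oI FF A B C D.
rewrite -[LHS]/(unc (douglas F A B C D) (x, y)).
apply: (@gram_dense R n (slit I rho) _ (x, y) (ltnW n3) oS) => //.
  by move=> q Sq; exact: smooth_continuous sD Sq.
move=> q Sq Gq; have Rq : Reg q by split => //; case: Sq.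
rewrite unc_douglas; have [_ d1] := vdeg_hatG A qU qR lT.
by have [_ d2] := d1 (e_ D); have [_ d3] := d2 (e_ C); exact: d3.
Qed.

(** * Necessity: the profiles of T, R and U *)

Hypothesis vD : vanishing_Douglas (cyl_domain I rho) F.

(** Linearity frees the outermost direction from the basis; the bar part of x will be such a
    direction. *)
Lemma hatG_third A C D w p : Reg p ->
  'D_(0, w) ('D_(0, e_ C) ('D_(0, e_ D) (unc (hatG F A)))) p = 0.
Proof.
move=> Rp; have Sp := Reg_slit Rp.
have sh := smooth_derive (0, e_ C) (smooth_derive (0, e_ D) (smooth_hatG oI FF A)).
rewrite (vert_sum w (smooth_diff sh Sp)) big1// => B _.
rewrite [X in _ * X](_ : _ = unc (douglas F A B C D) p); last by rewrite unc_douglas.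
by case: Sp => xM y0; rewrite /unc vD// mulr0.
Qed.

Section Leibniz.
Variables (A B C S : TM -> R) (c : R) (e w : vec) (p : TM).
Hypotheses (sA : smooth_on Reg A) (sB : smooth_on Reg B) (sC : smooth_on Reg C)
  (sS : smooth_on Reg S) (Rp : Reg p).
Let sX : smooth_on Reg (gX e) := smooth_gX e oR.
Let sY : smooth_on Reg (gY e) := smooth_gY e oR.
Let sc : smooth_on Reg (fun=> c) := smooth_cst c oR.

(** This and the following rules treat the shapes met when differentiating a bar component
    repeatedly: [gX e] passes through a vertical derivative, while [gY e] produces [bar_dot w e]. *)
Lemma leibniz1 : 'D_(0, w) (fun q => gX e q * A q - gY e q * B q) p =
  gX e p * 'D_(0, w) A p - (bar_dot w e * B p + gY e p * 'D_(0, w) B p).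
Proof.
rewrite (derive_smoothB _ (smoothM oR sX sA) (smoothM oR sY sB) Rp).
by rewrite (derive_gXM oI _ _ sA Rp) (derive_gYM oI _ _ sB Rp).
Qed.

Lemma leibniz2 : 'D_(0, w) (fun q => gX e q * A q - (C q + gY e q * B q)) p =
  gX e p * 'D_(0, w) A p -
  ('D_(0, w) C p + (bar_dot w e * B p + gY e p * 'D_(0, w) B p)).
Proof.
rewrite (derive_smoothB _ (smoothM oR sX sA) (smoothD oR sC (smoothM oR sY sB)) Rp).
rewrite (derive_smoothD _ sC (smoothM oR sY sB) Rp).
by rewrite (derive_gXM oI _ _ sA Rp) (derive_gYM oI _ _ sB Rp).
Qed.

Lemma leibniz3 : 'D_(0, w) (fun q => gX e q * A q - (C q + (c * S q + gY e q * B q))) p =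
  gX e p * 'D_(0, w) A p -
  ('D_(0, w) C p + (c * 'D_(0, w) S p + (bar_dot w e * B p + gY e p * 'D_(0, w) B p))).
Proof.
have scS := smoothM oR sc sS; have sYB := smoothM oR sY sB.
rewrite (derive_smoothB _ (smoothM oR sX sA) (smoothD oR sC (smoothD oR scS sYB)) Rp).
rewrite (derive_smoothD _ sC (smoothD oR scS sYB) Rp) (derive_smoothD _ scS sYB Rp).
rewrite (derive_smoothM _ sc sS Rp) derive_cst mul0r add0r.
by rewrite (derive_gXM oI _ _ sA Rp) (derive_gYM oI _ _ sB Rp).
Qed.

Lemma leibniz_XX e' : gX e p = 0 ->
  'D_(0, w) (fun q => gX e' q * A q - gX e q * B q) p = gX e' p * 'D_(0, w) A p.
Proof.
move=> X0; rewrite (derive_smoothB _ (smoothM oR (smooth_gX e' oR) sA) (smoothM oR sX sB) Rp).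
by rewrite (derive_gXM oI _ _ sA Rp) (derive_gXM oI _ _ sB Rp) X0 mul0r subr0.
Qed.

Lemma leibniz_XY : bar_dot e e = 1 ->
  'D_(0, e) (fun q => gY e q * A q + gX e q * B q) p =
  A p + gY e p * 'D_(0, e) A p + gX e p * 'D_(0, e) B p.
Proof.
move=> ee; rewrite (derive_smoothD _ (smoothM oR sY sA) (smoothM oR sX sB) Rp).
by rewrite (derive_gYM oI _ _ sA Rp) (derive_gXM oI _ _ sB Rp) ee mul1r.
Qed.

End Leibniz.

(** [gX e] is constant on fibres and zero at [p], so [A], which stands for the U-term, disappears;
    [gY e] is also zero at [p] but contributes wherever it has been differentiated, and that keeps
    [B]. *)
Lemma derive_w_w_e (A B : TM -> R) e w p : smooth_on Reg A -> smooth_on Reg B ->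
  Reg p -> bar_dot e e = 1 -> gX e p = 0 -> gY e p = 0 ->
  'D_(0, w) ('D_(0, w) ('D_(0, e) (fun q => gX e q * A q - gY e q * B q))) p =
  - ('D_(0, w) ('D_(0, w) B) p +
     bar_dot w e * ('D_(0, w) ('D_(0, e) B) p + 'D_(0, w) ('D_(0, e) B) p)).
Proof.
move=> sA sB Rp ee Xp Yp.
have sA1 := smooth_derive (0, e) sA; have sB1 := smooth_derive (0, e) sB.
have sA2 := smooth_derive (0, w) sA1; have sB2 := smooth_derive (0, w) sB1.
have sBw := smooth_derive (0, w) sB.
pose A1 := 'D_(0, e) A; pose B1 := 'D_(0, e) B.
have E1 q : Reg q -> 'D_(0, e) (fun q => gX e q * A q - gY e q * B q) q =
    gX e q * A1 q - (B q + gY e q * B1 q).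
  by move=> Rq; rewrite (leibniz1 e e sA sB Rq) ee mul1r.
have E2 q : Reg q -> 'D_(0, w) ('D_(0, e) (fun q => gX e q * A q - gY e q * B q)) q =
    gX e q * 'D_(0, w) A1 q - ('D_(0, w) B q + (bar_dot w e * B1 q + gY e q * 'D_(0, w) B1 q)).
  move=> Rq; exact: etrans (derive_open_eq (0, w) oR E1 Rq) (leibniz2 e w sA1 sB1 sB Rq).
apply: etrans (derive_open_eq (0, w) oR E2 Rp) _.
apply: etrans (leibniz3 (bar_dot w e) e w sA2 sB2 sBw sB1 Rp) _.
have alg (x y a b c d k : R) : x = 0 -> y = 0 ->
    x * a - (b + (k * c + (k * c + y * d))) = - (b + k * (c + c)).
  by move=> -> ->; ring.
exact: alg Xp Yp.
Qed.

Let k3 : 'I_n := Ordinal n3.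

(** In the component along the direction e orthogonal to x and y, taking [w = e] makes the three
    remaining terms equal and gives 3 [Omega T] / u = 0; taking w = e_0, orthogonal to e, leaves
    T_zz / u = 0. *)
Lemma T_linear : linear_profile I rho (Tf phi n).
Proof.
move=> a r s z h.
have [|p [[Rp p0 pr] [pu ps pz] [_ px py]]] := @exists_point R n I rho a r s z k1 k2 _ h.
  by [].
have sA := smooth_w2 oI sU (n := n); have sB := smooth_w1 oI sT (n := n).
pose e := ebar k3 : vec.
have ee : bar_dot e e = 1 by rewrite bar_dot_ebar ebasisE eqxx.
have Xp : gX e p = 0 by rewrite /gX bar_dot_ebar px.
have Yp : gY e p = 0 by rewrite /gY bar_dot_ebar py.
have D3 w C : w = e_ C -> 'D_(0, w) ('D_(0, w) (w1 (Tf phi n))) p + bar_dot w e *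
    ('D_(0, w) ('D_(0, e) (w1 (Tf phi n))) p + 'D_(0, w) ('D_(0, e) (w1 (Tf phi n))) p) = 0.
  move=> wE; apply/eqP; rewrite -oppr_eq0 -(derive_w_w_e w sA sB Rp ee Xp Yp); apply/eqP.
  rewrite -[RHS](hatG_third (lift ord0 k3) C (lift ord0 k3) w Rp) -wE.
  apply: (derive_open_eq _ oR) Rp => q Rq; apply: (derive_open_eq _ oR) Rq => q' Rq'.
  by apply: (derive_open_eq _ oR) Rq' => q'' Rq''; rewrite (hatG_lift k3 Rq'').
have tr f : pull f p = f a r s z by rewrite /pull p0 pr ps pz.
have u0 := lt0r_neq0 (Reg_u Rp).
split.
  have h3 := D3 e _ erefl; rewrite ee mul1r in h3.
  have E q : Reg q -> 'D_(0, e) (w1 (Tf phi n)) q =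
      gY e q * (pull (Omega (Tf phi n)) q / fu q) + gX e q * pull (ds (Tf phi n)) q.
    move=> Rq; rewrite (derive_w1 oI _ sT Rq) [e 0 ord0]ebasisE mul0r addr0.
    by rewrite mulrAC mulrA.
  have sO : smooth_on Reg (pull (Omega (Tf phi n))) := smooth_pull oI (sm4_Omega oI sT).
  have sS : smooth_on Reg (pull (ds (Tf phi n))) := smooth_pull oI (sm4_ds sT).
  have sOu := smoothM oR sO (smooth_invfu oI).
  have Ee : 'D_(0, e) ('D_(0, e) (w1 (Tf phi n))) p = pull (Omega (Tf phi n)) p / fu p.
    apply: etrans (derive_open_eq (0, e) oR E Rp) _.
    by apply: etrans (leibniz_XY sOu sS Rp ee) _; rewrite Xp Yp !mul0r !addr0.
  rewrite -tr; move: h3; rewrite Ee; generalize (pull (Omega (Tf phi n)) p) (fu p) u0.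
  move=> t u {}u0 h3; apply: (@mulIf _ (3 / u)).
    by rewrite mulf_neq0 ?invr_eq0 ?pnatr_eq0.
  by rewrite mul0r -[RHS]h3; field.
have := D3 (e_ ord0) _ erefl; rewrite bar_dotC bar_dot_e0 mul0r addr0 => h3.
have E : 'D_(0, e_ ord0) ('D_(0, e_ ord0) (w1 (Tf phi n))) p = pull (dz (dz (Tf phi n))) p / fu p.
  apply: etrans (derive_e0_pull oI (sm4_dz sT) Rp).
  apply: (derive_open_eq _ oR) Rp => q Rq; exact: (derive_e0_w1 oI sT Rq).
apply: etrans (esym (tr _)) _.
move: (etrans (esym E) h3); generalize (pull (dz (dz (Tf phi n))) p) => t /eqP.
by rewrite mulf_eq0 invr_eq0 (negPf u0) orbF => /eqP.
Qed.

(** The 0-component is u^2 R with no other term, so the scalar criterion applies to it directly. *)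
Lemma R_quadratic : quadratic_profile I rho (Rf phi n).
Proof.
move=> a r s z h.
have [|p [[Rp p0 pr] [pu ps pz] [_ px py]]] := @exists_point R n I rho a r s z k1 k2 _ h.
  by [].
pose e := ebar k3 : vec.
have ee : bar_dot e e = 1 by rewrite bar_dot_ebar ebasisE eqxx.
have Xp : gX e p = 0 by rewrite /gX bar_dot_ebar px.
have Yp : gY e p = 0 by rewrite /gY bar_dot_ebar py.
have tr f : pull f p = f a r s z by rewrite /pull p0 pr ps pz.
have E C D w : 'D_(0, w) ('D_(0, e_ C) ('D_(0, e_ D) (w2 (Rf phi n)))) p = 0.
  rewrite -[RHS](hatG_third ord0 C D w Rp).
  apply: (derive_open_eq _ oR) Rp => q Rq; apply: (derive_open_eq _ oR) Rq => q' Rq'.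
  by apply: (derive_open_eq _ oR) Rq' => q'' Rq''; rewrite (hatG0 Rq'').
have [|h1 h2 h3] := quadratic_necessary oI sR Rp _ ee Xp Yp
  (fun w => E (lift ord0 k3) (lift ord0 k3) w) (E ord0 ord0 (e_ ord0)).
  by rewrite [e 0 ord0]ebasisE.
by split; [exact: etrans (esym (tr _)) h1|exact: etrans (esym (tr _)) h2|
  exact: etrans (esym (tr _)) h3].
Qed.

Lemma derive_transverse (A B : TM -> R) e w p : smooth_on Reg A -> smooth_on Reg B ->
  Reg p -> bar_dot w e = 0 -> 'D_(0, w) (fun q => gX e q * A q - gY e q * B q) p =
  gX e p * 'D_(0, w) A p - gY e p * 'D_(0, w) B p.
Proof.
move=> sA sB Rp we; have sX := smooth_gX e oR; have sY := smooth_gY e oR.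
rewrite (derive_smoothB _ (smoothM oR sX sA) (smoothM oR sY sB) Rp).
by rewrite (derive_gXM oI _ _ sA Rp) (derive_gYM oI _ _ sB Rp) we mul0r add0r.
Qed.

(** In the component along x the factor of U is <x, e1> = r, which is nonzero. The inner two
    derivatives are taken along e or e_0, both orthogonal to e1, so that <y, e1> is not
    differentiated by them; the linearity of T then disposes of the T-term. *)
Lemma U_quadratic : quadratic_profile I rho (Uf phi).
Proof.
move=> a r s z h.
have [|p [[Rp p0 pr] [pu ps pz] [px1 px py]]] := @exists_point R n I rho a r s z k1 k2 _ h.
  by [].
have lT := T_linear.
pose e := ebar k3 : vec; pose e1 := ebar k1 : vec.
have ee : bar_dot e e = 1 by rewrite bar_dot_ebar ebasisE eqxx.
have ee1 : bar_dot e e1 = 0 by rewrite bar_dot_ebar ebasisE.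
have e0e1 : bar_dot (e_ ord0) e1 = 0 by rewrite bar_dotC bar_dot_e0.
have Xp : gX e p = 0 by rewrite /gX bar_dot_ebar px.
have Yp : gY e p = 0 by rewrite /gY bar_dot_ebar py.
have X1p : gX e1 p != 0 by rewrite /gX bar_dot_ebar px1 -pr gt_eqF// (Reg_r Rp).
have tr f : pull f p = f a r s z by rewrite /pull p0 pr ps pz.
have sA := smooth_w2 oI sU (n := n); have sB := smooth_w1 oI sT (n := n).
have sX1 := smooth_gX e1 oR; have sY1 := smooth_gY e1 oR.
have mulX x : gX e1 p * x = 0 -> x = 0.
  by move=> /eqP; rewrite mulf_eq0 (negPf X1p) => /eqP.
have D2 v q : bar_dot v e1 = 0 -> Reg q ->
    'D_(0, v) ('D_(0, v) (fun q => gX e1 q * w2 (Uf phi) q - gY e1 q * w1 (Tf phi n) q)) q =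
    gX e1 q * 'D_(0, v) ('D_(0, v) (w2 (Uf phi))) q -
    gY e1 q * 'D_(0, v) ('D_(0, v) (w1 (Tf phi n))) q.
  move=> ve Rq; have sA1 := smooth_derive (0, v) sA; have sB1 := smooth_derive (0, v) sB.
  rewrite -(derive_transverse sA1 sB1 Rq ve).
  apply: (derive_open_eq _ oR) Rq => q' Rq'.
  exact: derive_transverse sA sB Rq' ve.
have D3 v C w : v = e_ C -> bar_dot v e1 = 0 ->
    'D_(0, w) (fun q => gX e1 q * 'D_(0, v) ('D_(0, v) (w2 (Uf phi))) q -
    gY e1 q * 'D_(0, v) ('D_(0, v) (w1 (Tf phi n))) q) p = 0.
  move=> vE ve; rewrite -[RHS](hatG_third (lift ord0 k1) C C w Rp) -vE.
  apply: (derive_open_eq _ oR) Rp => q Rq; rewrite -(D2 v q ve Rq).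
  apply: (derive_open_eq _ oR) Rq => q' Rq'; apply: (derive_open_eq _ oR) Rq' => q'' Rq''.
  by rewrite (hatG_lift k1 Rq'').
(* It is enough that two derivatives of u T carry the factor [gX e]: being constant on fibres and
   zero at [p], it still kills the term after the third derivative. For e this factor multiplies a
   derivative of T_s; for e_0 the expression is T_zz / u = 0. *)
have D4' v C w (B : TM -> R) : v = e_ C -> bar_dot v e1 = 0 -> smooth_on Reg B ->
    (forall q, Reg q -> 'D_(0, v) ('D_(0, v) (w1 (Tf phi n))) q = gX e q * B q) ->
    'D_(0, w) ('D_(0, v) ('D_(0, v) (w2 (Uf phi)))) p = 0.
  move=> vE ve sBB BE; apply: mulX; rewrite -[RHS](D3 v C w vE ve).
  have sA2 := smooth_derive (0, v) (smooth_derive (0, v) sA).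
  have sYB := smoothM oR sY1 sBB.
  have BE2 q : Reg q -> gX e1 q * 'D_(0, v) ('D_(0, v) (w2 (Uf phi))) q -
      gY e1 q * 'D_(0, v) ('D_(0, v) (w1 (Tf phi n))) q =
      gX e1 q * 'D_(0, v) ('D_(0, v) (w2 (Uf phi))) q - gX e q * (gY e1 q * B q).
    move=> Rq; apply: (congr1 (fun t => _ - t)).
    exact: (etrans (congr1 ( *%R _) (BE q Rq)) (mulrCA _ _ _)).
  apply: esym; apply: etrans (derive_open_eq (0, w) oR BE2 Rp) _.
  exact: (leibniz_XX w sA2 sYB Rp e1 Xp).
have z0 : smooth_on Reg (fun=> 0 : R) := smooth_cst 0 oR.
have [|||h1 h2 h3] := quadratic_necessary oI sU Rp _ ee Xp Yp _ _.
- by rewrite [e 0 ord0]ebasisE.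
- have sS : smooth_on Reg (pull (ds (Tf phi n))) := smooth_pull oI (sm4_ds sT).
  move=> w; apply: (D4' e _ w _ erefl ee1 (smooth_derive (0, e) sS)) => q Rq.
  rewrite -(derive_gXM oI e e sS Rq); apply: (derive_open_eq _ oR) Rq => q' Rq'.
  rewrite (derive_w1 oI _ sT Rq') [e 0 ord0]ebasisE mul0r addr0.
  have O0 : pull (Omega (Tf phi n)) q' = 0 by have [] := lT _ _ _ _ (Reg_D4 Rq').
  by rewrite O0 mulr0 add0r.
- apply: (D4' (e_ ord0) _ (e_ ord0) _ erefl e0e1 z0) => q Rq; rewrite mulr0.
  have Tzz : pull (dz (dz (Tf phi n))) q = 0 by have [] := lT _ _ _ _ (Reg_D4 Rq).
  have E := derive_e0_pull oI (sm4_dz sT) Rq.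
  rewrite Tzz mul0r in E; rewrite -[RHS]E.
  by apply: (derive_open_eq _ oR) Rq => q' Rq'; exact: (derive_e0_w1 oI sT Rq').
by split; [exact: etrans (esym (tr _)) h1|exact: etrans (esym (tr _)) h2|
  exact: etrans (esym (tr _)) h3].
Qed.

End CylindricalMetric.

(** * From the eight equations to the profiles *)

(** At z = 0 the factor z makes the left-hand equation 0 = 0 whatever f is; there [Omega f = 0]
    comes from the points z != 0 by continuity. *)
Lemma zPsi_eq0 (R : realType) (I : set R) (rho : R) (f : fun4 R) : open I -> sm4 I rho f ->
  (forall a r s z, D4 I rho a r s z -> z * Psi (over_z f) a r s z = 0) <->
  (forall a r s z, D4 I rho a r s z -> Omega f a r s z = 0).
Proof.
move=> oI sf; split=> f0 a r s z h.
  apply: (sm4_eq0_z oI (sm4_Omega oI sf) _ h) => a' r' s' z' h' z0.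
  exact: etrans (esym (Psi_over_z oI sf h' z0)) (f0 _ _ _ _ h').
have [->|z0] := eqVneq z 0; first by rewrite mul0r.
exact: etrans (Psi_over_z oI sf h z0) (f0 _ _ _ _ h).
Qed.

Unset Implicit Arguments.

Theorem mainTheorem4 (R : realType) (n : nat) (I : set R) (rho : R)
  (phi : R -> R -> R -> R -> R) (F : 'rV[R]_(n.+1) -> 'rV[R]_(n.+1) -> R) :
  (3 <= n)%N ->
  open I -> is_interval I ->
  0 < rho ->
  (* phi > 0 and smooth on the open region of the variables (x^0, r, s, z) *)
  smooth_on [set p : 'rV[R]_4 | I (p 0 0) /\ 0 < p 0 1 < rho /\
                                `|p 0 2%:R| < p 0 1] (uncurry4 phi) ->
  (forall a r s z, I a -> 0 < r < rho -> `|s| < r -> 0 < phi a r s z) ->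
  (* F is a Finsler metric on M = I x B^n(rho) *)
  is_Finsler (@cyl_domain R n I rho) F ->
  (* F = u phi(x^0, r, s, z) *)
  (forall x y, @cyl_domain R n I rho x -> bar_norm y != 0 ->
     F x y = bar_norm y *
             phi (x 0 ord0) (bar_norm x) (bar_dot x y / bar_norm y)
                 (y 0 ord0 / bar_norm y)) ->
  (vanishing_Douglas (@cyl_domain R n I rho) F <->
   (forall a r s z, I a -> 0 < r < rho -> `|s| < r ->
     (z * Psi (over_z (ds (Uf phi))) a r s z = 0 /\
         z * Psi (over_z (dz (Uf phi))) a r s z = 0 /\
         dz (dz (dz (Uf phi))) a r s z = 0 /\
         z * Psi (over_z (ds (Rf phi n))) a r s z = 0 /\
         z * Psi (over_z (dz (Rf phi n))) a r s z = 0 /\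
         dz (dz (dz (Rf phi n))) a r s z = 0 /\
         z * Psi (over_z (Tf phi n)) a r s z = 0 /\
         dz (dz (Tf phi n)) a r s z = 0))).
Proof.
move=> n3 oI _ _ sphi phi_gt0 FF FE.
have {}sphi : sm4 I rho phi by exact: sphi.
have {}phi_gt0 a r s z : D4 I rho a r s z -> 0 < phi a r s z.
  by case=> Ia [r0 sr]; exact: phi_gt0.
have Lam0 := Lambda_neq0 n3 oI sphi phi_gt0 FF FE.
have sU : sm4 I rho (Uf phi) := sm4_Uf oI sphi Lam0.
have sR : sm4 I rho (Rf phi n) := sm4_Rf n oI sphi Lam0.
have sT : sm4 I rho (Tf phi n) := sm4_Tf n oI sphi Lam0.
have [sUs sUz] := (sm4_ds sU, sm4_dz sU).
have [sRs sRz] := (sm4_ds sR, sm4_dz sR).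
split=> [vD a r s z Ia r0 sr|cond].
  have h : D4 I rho a r s z by [].
  have qU := U_quadratic n3 oI sphi phi_gt0 FF FE vD.
  have qR := R_quadratic n3 oI sphi phi_gt0 FF FE vD.
  have lT := T_linear n3 oI sphi phi_gt0 FF FE vD.
  split; first by apply: ((zPsi_eq0 oI sUs).2 _ _ _ _ _ h) => ? ? ? ? /qU[].
  split; first by apply: ((zPsi_eq0 oI sUz).2 _ _ _ _ _ h) => ? ? ? ? /qU[].
  split; first by have [] := qU _ _ _ _ h.
  split; first by apply: ((zPsi_eq0 oI sRs).2 _ _ _ _ _ h) => ? ? ? ? /qR[].
  split; first by apply: ((zPsi_eq0 oI sRz).2 _ _ _ _ _ h) => ? ? ? ? /qR[].
  split; first by have [] := qR _ _ _ _ h.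
  split; first by apply: ((zPsi_eq0 oI sT).2 _ _ _ _ _ h) => ? ? ? ? /lT[].
  by have [] := lT _ _ _ _ h.
have {}cond a r s z (h : D4 I rho a r s z) := cond a r s z h.1 h.2.1 h.2.2.
apply: (douglas_sufficient n3 oI sphi phi_gt0 FF FE) => a r s z h; split.
- by apply: ((zPsi_eq0 oI sUs).1 _ _ _ _ _ h) => a' r' s' z' /cond[].
- by apply: ((zPsi_eq0 oI sUz).1 _ _ _ _ _ h) => a' r' s' z' /cond[_ []].
- by have [_ [_ []]] := cond _ _ _ _ h.
- by apply: ((zPsi_eq0 oI sRs).1 _ _ _ _ _ h) => a' r' s' z' /cond[_ [_ [_ []]]].
- by apply: ((zPsi_eq0 oI sRz).1 _ _ _ _ _ h) => a' r' s' z' /cond[_ [_ [_ [_ []]]]].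
- by have [_ [_ [_ [_ [_ []]]]]] := cond _ _ _ _ h.
- by apply: ((zPsi_eq0 oI sT).1 _ _ _ _ _ h) => a' r' s' z' /cond[_ [_ [_ [_ [_ [_ []]]]]]].
- by have [_ [_ [_ [_ [_ [_ []]]]]]] := cond _ _ _ _ h.
Qed.
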